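(* The moduli stack $\mathcal{GH}$ of compact metric spaces is a naive metric stack of quotient type. Moreover, for any naive metric stack $\mathcal X$ of quotient type, pulling back the universal object $p_0:\mathcal{GH}_1\to\mathcal{GH}$, i.e. $(F:\mathcal X\to\mathcal{GH})\mapsto(\mathcal X\times_{F,\mathcal{GH},p_0}\mathcal{GH}_1\to\mathcal X)$, induces a one-to-one correspondence between morphisms $\mathcal X\to\mathcal{GH}$ of stacks in groupoids over $\mathrm{tbMet}_{\mathrm{lsm}}$ (up to 2-isomorphism) and representable proper submetries $\mathcal P\to\mathcal X$ of stacks in groupoids over $\mathrm{tbMet}_{\mathrm{lsm}}$ (up to equivalence over $\mathcal X$).
   Context: Metric spaces. $\mathrm{Met}$ is the category of metric spaces (finite distances) and 1-Lipschitz maps; $\mathrm{tbMet}$ is its full subcategory of totally bounded metric spaces. Fiber products in $\mathrm{Met}$ carry the maximum of the two distances. $B_X(x,r)$ is the open ball. $d^H_X$ is the Hausdorff distance on subsets of $X$. A 1-Lipschitz map $f:X\to B$ of metric spaces is a submetry if it is surjective and $d^H_X(f^{-1}(b_0),f^{-1}(b_1))\le d_B(b_0,b_1)$ for all $b_0,b_1\in B$. It is proper if it is a closed map with compact fibers. The lsm site. A 1-Lipschitz map $f:X\to Y$ of metric spaces is a local submetry if for every $x\in X$ there is $r>0$ such that for every $x'\in B_X(x,r)$ and $0<s<r-d_X(x,x')$ one has $f(B_X(x',s))=B_Y(f(x'),s)$. A family $\{f_i:U_i\to X\}_{i\in I}$ in $\mathrm{tbMet}$ is an lsm covering if each $f_i$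 is a local submetry and for all $x_1,x_2,x_3\in X$ and $\varepsilon>0$ there are $i\in I$ and $u_k\in f_i^{-1}(x_k)$ ($k=1,2,3$) with $d_{U_i}(u_1,u_2)<d_X(x_1,x_2)+\varepsilon$ and $d_{U_i}(u_2,u_3)<d_X(x_2,x_3)+\varepsilon$. These coverings form a Grothendieck pretopology; $\mathrm{tbMet}_{\mathrm{lsm}}$ is the resulting site. Stacks. Stacks in groupoids over $\mathrm{tbMet}_{\mathrm{lsm}}$ form a 2-category; fiber products are 2-fiber products. A metric space $X$ is identified with the sheaf $\mathrm{Hom}_{\mathrm{Met}}(-,X)|_{\mathrm{tbMet}}$ and hence with a stack. $\mathcal X(T)$ denotes the groupoid $\mathrm{Hom}(T,\mathcal X)$ (the fiber over $T$ when $T\in\mathrm{tbMet}$). Let $*=\{0\}$, and for $r>0$ let $2_r=\{0,r\}\subset\mathbb R$; $\iota_{0r}:*\to 2_r$ is the map $0\mapsto 0$, and for $r>s>0$, $\iota_{rs}:2_r\to2_s$ is the bijection with $0\mapsto0$. A morphism $f:\mathcal X\to\mathcal Y$ of stacks is a formal submetry if (1) $\mathcal X( * )\to\mathcal Y( * )$ is essentially surjective; and (2) for all real $r>s>0$, morphisms $x:*\to\mathcal X$, $g:2_s\to\mathcal Y$ and every 2-isomorphism $\alpha:f\circ x\Rightarrow g\circ\iota_{0s}$, there are a morphism $h:2_r\to\mathcal X$ and 2-isomorphisms $\beta:h\circ\iota_{0r}\Rightarrow x$, $\gamma:f\circ h\Rightarrow g\circ\iota_{rs}$ with $\alpha\circ(f\star\beta)=\gamma\star\iota_{0r}$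 ($\star$ is horizontal composition/whiskering). A naive metric stack is a stack $\mathcal X$ admitting a formal submetry $U\to\mathcal X$ from a metric space $U$. It is of quotient type if there is a formal submetry $U\to\mathcal X$ from a metric space $U$ such that for every $T\in\mathrm{tbMet}$ and $t\in\mathcal X(T)$ there is an lsm covering $\{q_i:U_i\to T\}$ with each $q_i^*t$ in the essential image of $U(U_i)\to\mathcal X(U_i)$. A morphism $f:\mathcal X\to\mathcal B$ of stacks is a representable proper submetry if for every $T\in\mathrm{tbMet}$ and every $b:T\to\mathcal B$ there is a proper submetry $X_T\to T$ of metric spaces and an equivalence $X_T\simeq\mathcal X\times_{\mathcal B}T$ over $T$. The moduli stacks. $\mathcal{GH}$ has as objects over $T\in\mathrm{tbMet}$ the proper submetries $P\to T$ with $P\in\mathrm{Met}$; morphisms are commutative squares in $\mathrm{Met}$ inducing an isomorphism $P_1\cong P_2\times_{T_2}T_1$. $\mathcal{GH}_1$ has as objects the pairs $(p:P\to T,\,s:T\to P)$ with $p\in\mathcal{GH}$ and $s$ a section of $p$ in $\mathrm{Met}$; morphisms are those of $\mathcal{GH}$ compatible with the sections. $p_0:\mathcal{GH}_1\to\mathcal{GH}$ forgets the section. Both are stacks in groupoids over $\mathrm{tbMet}_{\mathrm{lsm}}$. *)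

(* Defs.v *)
From HB Require Import structures.
From mathcomp Require Import all_boot all_order all_algebra.
From mathcomp Require Import all_classical all_reals all_analysis.

Set Implicit Arguments.
Unset Strict Implicit.
Unset Printing Implicit Defensive.
Import Order.TTheory GRing.Theory Num.Theory.
Import numFieldNormedType.Exports.
Local Open Scope classical_set_scope.
Local Open Scope ring_scope.

#[local] Obligation Tactic := intros; simpl; try by [].

Section Met.
Context {R : realType}.

Record lipMap (X Y : metricType R) : Type := LipMap {
  lip_fun :> X -> Y;
  lipP : forall x x', mdist (lip_fun x) (lip_fun x') <= mdist x x' }.

Lemma lipMap_eq (X Y : metricType R) (f g : lipMap X Y) : f =1 g -> f = g.
Proof.
case: f g => [f fP] [g gP] /= /funext fg; subst g.
by rewrite (Prop_irrelevance fP gP).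
Qed.

Lemma lipMap_app (X Y : metricType R) (f g : lipMap X Y) :
  f = g -> forall x, f x = g x.
Proof. by move=> ->. Qed.

Definition lid (X : metricType R) : lipMap X X :=
  @LipMap X X id (fun x x' => lexx _).

Lemma lcomp_subproof (X Y Z : metricType R) (g : lipMap Y Z) (f : lipMap X Y)
  x x' : mdist (g (f x)) (g (f x')) <= mdist x x'.
Proof. exact: le_trans (lipP _ _ _) (lipP _ _ _). Qed.

Definition lcomp (X Y Z : metricType R) (g : lipMap Y Z) (f : lipMap X Y) :
  lipMap X Z := LipMap (lcomp_subproof g f).

Definition met_iso (X Y : metricType R) (f : lipMap X Y) : Prop :=
  exists g : lipMap Y X, lcomp g f = lid X /\ lcomp f g = lid Y.

Lemma met_isoP (X Y : metricType R) (f : lipMap X Y) :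
  met_iso f <->
  ((forall y, exists x, f x = y) /\
   forall x x', mdist x x' <= mdist (f x) (f x')).
Proof.
split=> [[g [gf fg]]|[fs fi]].
  have gfE x : g (f x) = x := lipMap_app gf x.
  have fgE y : f (g y) = y := lipMap_app fg y.
  split=> [y|x x']; first by exists (g y).
  by rewrite -{1}(gfE x) -{1}(gfE x') lipP.
have [g gE] := choice fs.
have gl y y' : mdist (g y) (g y') <= mdist y y'.
  by apply: le_trans (fi _ _) _; rewrite !gE.
exists (LipMap gl); split; apply: lipMap_eq => z //=.
apply: mdist_positivity; apply/eqP; rewrite eq_le mdist_ge0 andbT.
by apply: le_trans (fi _ _) _; rewrite gE mdistxx.
Qed.

Definition tot_bounded (X : metricType R) : Prop :=
  forall e : R, 0 < e -> exists2 A : set X,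
    finite_set A & [set: X] `<=` \bigcup_(a in A) ball a e.

Record tbMet : Type := TbMet {
  tb_sort :> metricType R;
  tbP : tot_bounded tb_sort }.

Section FiberProduct.
Context (X Y Z : metricType R) (f : lipMap X Z) (g : lipMap Y Z).

Record fibProd : Type := FibProd {
  fp_fst : X;
  fp_snd : Y;
  fp_eq : f fp_fst = g fp_snd }.

HB.instance Definition _ := gen_eqMixin fibProd.
HB.instance Definition _ := gen_choiceMixin fibProd.

Lemma fibProd_eq (p q : fibProd) :
  fp_fst p = fp_fst q -> fp_snd p = fp_snd q -> p = q.
Proof.
case: p q => [x y e] [x' y' e'] /= xx yy; subst x' y'.
by rewrite (Prop_irrelevance e e').
Qed.

Definition fp_dist (p q : fibProd) : R :=
  Num.max (mdist (fp_fst p) (fp_fst q)) (mdist (fp_snd p) (fp_snd q)).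

Lemma fp_distxx p : fp_dist p p = 0.
Proof. by rewrite /fp_dist !mdistxx maxxx. Qed.

Lemma fp_dist_positivity p q : fp_dist p q = 0 -> p = q.
Proof.
rewrite /fp_dist => pq0.
have : Num.max (mdist (fp_fst p) (fp_fst q)) (mdist (fp_snd p) (fp_snd q)) <= 0.
  by rewrite pq0.
rewrite ge_max => /andP[p1 p2].
by apply: fibProd_eq; apply: mdist_positivity; apply/eqP;
   rewrite eq_le mdist_ge0 andbT.
Qed.

Lemma fp_dist_sym p q : fp_dist p q = fp_dist q p.
Proof. by rewrite /fp_dist (metric_sym (fp_fst p)) (metric_sym (fp_snd p)). Qed.

Lemma fp_dist_triangle q p s : fp_dist p s <= fp_dist p q + fp_dist q s.
Proof.
rewrite /fp_dist ge_max; apply/andP; split.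
  apply: le_trans (metric_triangle _ (fp_fst q) _) _.
  by apply: lerD; rewrite le_max lexx.
apply: le_trans (metric_triangle _ (fp_snd q) _) _.
by apply: lerD; rewrite le_max lexx orbT.
Qed.

HB.instance Definition _ := isMetric.Build R fibProd
  fp_distxx fp_dist_positivity fp_dist_sym fp_dist_triangle.

Lemma fp_mdistE (p q : fibProd) :
  mdist p q = Num.max (mdist (fp_fst p) (fp_fst q)) (mdist (fp_snd p) (fp_snd q)).
Proof. by []. Qed.

Lemma fp_pr1_subproof (p q : fibProd) :
  mdist (fp_fst p) (fp_fst q) <= mdist p q.
Proof. by rewrite fp_mdistE le_max lexx. Qed.

Lemma fp_pr2_subproof (p q : fibProd) :
  mdist (fp_snd p) (fp_snd q) <= mdist p q.
Proof. by rewrite fp_mdistE le_max lexx orbT. Qed.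

Definition fp_pr1 : lipMap fibProd X := LipMap fp_pr1_subproof.
Definition fp_pr2 : lipMap fibProd Y := LipMap fp_pr2_subproof.

Section Lift.
Context (W : metricType R) (a : lipMap W X) (b : lipMap W Y).
Hypothesis ab : lcomp f a = lcomp g b.

Definition fp_lift_fun (w : W) : fibProd :=
  FibProd (lipMap_app ab w).

Lemma fp_lift_subproof w w' :
  mdist (fp_lift_fun w) (fp_lift_fun w') <= mdist w w'.
Proof. by rewrite fp_mdistE ge_max !lipP. Qed.

Definition fp_lift : lipMap W fibProd := LipMap fp_lift_subproof.

End Lift.

End FiberProduct.

Lemma fibProd_tot_bounded (X Y Z : metricType R)
    (f : lipMap X Z) (g : lipMap Y Z) :
  tot_bounded X -> tot_bounded Y -> tot_bounded (fibProd f g).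
Proof.
move=> tX tY e e0; have e20 : 0 < e / 2 by rewrite divr_gt0.
have [A fA cA] := tX _ e20; have [B fB cB] := tY _ e20.
pose near_ (ab : X * Y) (p : fibProd f g) :=
  mdist ab.1 (fp_fst p) < e / 2 /\ mdist ab.2 (fp_snd p) < e / 2.
have [[p0]|nop] := pselect (inhabited (fibProd f g)); last first.
  by exists set0 => // p _; exfalso; apply: nop.
have /choice[c cE] : forall ab, exists q, (exists p, near_ ab p) -> near_ ab q.
  move=> ab; have [[p abp]|no] := pselect (exists p, near_ ab p).
    by exists p.
  by exists p0.
exists (c @` (A `*` B)); first by apply: finite_image; exact: finite_setX.
move=> p _; have [a Aa] := cA (fp_fst p) I; have [b Bb] := cB (fp_snd p) I.
rewrite !ballEmdist /= => bp ap.
have [h1 h2] : near_ (a, b) (c (a, b)) by apply: cE; exists p.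
exists (c (a, b)); first by exists (a, b).
rewrite ballEmdist /= fp_mdistE gt_max; apply/andP; split.
  apply: le_lt_trans (metric_triangle _ a _) _.
  by rewrite metric_sym (splitr e) ltrD.
apply: le_lt_trans (metric_triangle _ b _) _.
by rewrite metric_sym (splitr e) ltrD.
Qed.

Definition tb_fibProd (X Y Z : tbMet) (f : lipMap X Z) (g : lipMap Y Z) :
  tbMet := TbMet (fibProd_tot_bounded f g (@tbP X) (@tbP Y)).

Definition met_pt : Type := unit.

HB.instance Definition _ := Choice.on met_pt.

Lemma met_pt_distxx (x : met_pt) : (0 : R) = 0. Proof. by []. Qed.
Lemma met_pt_positivity (x y : met_pt) : (0 : R) = 0 -> x = y.
Proof. by case: x; case: y. Qed.
Lemma met_pt_sym (x y : met_pt) : (0 : R) = 0. Proof. by []. Qed.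
Lemma met_pt_triangle (y x z : met_pt) : (0 : R) <= 0 + 0.
Proof. by rewrite addr0. Qed.

HB.instance Definition _ := @isMetric.Build R met_pt (fun _ _ => 0)
  met_pt_distxx met_pt_positivity met_pt_sym met_pt_triangle.

Lemma met_pt_tot_bounded : tot_bounded met_pt.
Proof.
move=> e e0; exists [set tt]; first exact: finite_set1.
by case=> _; exists tt => //; exact: ballxx.
Qed.

Definition tb_pt : tbMet := TbMet met_pt_tot_bounded.

(* [false] is the point 0 and [true] the point r of {0, r} *)
Definition met_two (r : {posnum R}) : Type := bool.

Section Two.
Context (r : {posnum R}).

HB.instance Definition _ := Choice.on (met_two r).

Definition two_dist (x y : met_two r) : R := if x == y then 0 else r%:num.

Lemma two_distxx x : two_dist x x = 0.
Proof. by rewrite /two_dist eqxx. Qed.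

Lemma two_dist_positivity x y : two_dist x y = 0 -> x = y.
Proof. by rewrite /two_dist; case: eqP => // _ /eqP; rewrite gt_eqF. Qed.

Lemma two_dist_sym x y : two_dist x y = two_dist y x.
Proof. by rewrite /two_dist eq_sym. Qed.

Lemma two_dist_triangle y x z : two_dist x z <= two_dist x y + two_dist y z.
Proof.
rewrite /two_dist; case: (eqVneq x z) => [->|xz].
  by rewrite addr_ge0 //; case: ifP.
case: (eqVneq x y) => [<-|xy]; first by rewrite (negPf xz) add0r.
by rewrite lerDl; case: ifP.
Qed.

HB.instance Definition _ := @isMetric.Build R (met_two r) two_dist
  two_distxx two_dist_positivity two_dist_sym two_dist_triangle.

Lemma iota0_subproof (x x' : met_pt) :
  mdist (false : met_two r) (false : met_two r) <= mdist x x' :> R.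
Proof. by rewrite mdistxx mdist_ge0. Qed.

Definition iota0 : lipMap met_pt (met_two r) :=
  @LipMap met_pt (met_two r) (fun _ => false) iota0_subproof.

End Two.

Lemma iota2_subproof (r s : {posnum R}) (sr : s%:num < r%:num)
  (x x' : met_two r) :
  mdist (x : met_two s) (x' : met_two s) <= mdist x x' :> R.
Proof. by rewrite /mdist /= /two_dist; case: ifP => // _; exact: ltW. Qed.

Definition iota2 (r s : {posnum R}) (sr : s%:num < r%:num) :
  lipMap (met_two r) (met_two s) :=
  @LipMap (met_two r) (met_two s) (fun x => x) (iota2_subproof sr).

Lemma iota2K (r s : {posnum R}) (sr : s%:num < r%:num) :
  lcomp (iota2 sr) (iota0 r) = iota0 s.
Proof. exact: lipMap_eq. Qed.

Definition hausdorff_dist (X : metricType R) (A B : set X) : \bar R :=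
  ereal_inf [set e%:E | e in [set e : R | 0 < e
    /\ (forall a, A a -> exists2 b, B b & mdist a b < e)
    /\ (forall b, B b -> exists2 a, A a & mdist a b < e)]].

Definition submetry (X B : metricType R) (f : lipMap X B) : Prop :=
  (forall b, exists x, f x = b) /\
  forall b0 b1 : B,
    (hausdorff_dist (f @^-1` [set b0]) (f @^-1` [set b1])
       <= (mdist b0 b1)%:E)%E.

Definition proper_map (X B : metricType R) (f : lipMap X B) : Prop :=
  (forall A : set X, closed A -> closed (f @` A)) /\
  forall b : B, compact (f @^-1` [set b]).

Definition proper_submetry (X B : metricType R) (f : lipMap X B) : Prop :=
  submetry f /\ proper_map f.

Definition local_submetry (X Y : metricType R) (f : lipMap X Y) : Prop :=
  forall x : X, exists2 r : R, 0 < r &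
    forall x', ball x r x' -> forall s : R, 0 < s -> s < r - mdist x x' ->
      f @` ball x' s = ball (f x') s.

Record metFamily (T : tbMet) : Type := MetFamily {
  fam_idx : Type;
  fam_dom : fam_idx -> tbMet;
  fam_map : forall i, lipMap (fam_dom i) T }.

Definition lsm_covering (T : tbMet) (U : metFamily T) : Prop :=
  (forall i, local_submetry (fam_map (m := U) i)) /\
  forall (x1 x2 x3 : T) (e : R), 0 < e ->
    exists (i : fam_idx U) (u1 u2 u3 : fam_dom i),
      [/\ fam_map i u1 = x1, fam_map i u2 = x2 & fam_map i u3 = x3] /\
      (mdist u1 u2 < mdist x1 x2 + e /\ mdist u2 u3 < mdist x2 x3 + e).

End Met.

Arguments lipMap {R}.
Arguments tbMet R : clear implicits.
Arguments tb_pt R : clear implicits.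

Section Over.
Context {R : realType}.

(* A category over tbMet, displayed: objects are indexed by the space below
   them, whereas a single type of arrows carries its projection [obase] to
   tbMet, so that the laws need no transport. *)
Record overCat : Type := OverCat {
  oob : tbMet R -> Type;
  omor : forall T' T : tbMet R, oob T' -> oob T -> Type;
  obase : forall (T' T : tbMet R) (x' : oob T') (x : oob T),
    omor x' x -> lipMap T' T;
  oid : forall (T : tbMet R) (x : oob T), omor x x;
  ocomp : forall (T2 T1 T : tbMet R) (x2 : oob T2) (x1 : oob T1) (x : oob T),
    omor x1 x -> omor x2 x1 -> omor x2 x;
  obase_id : forall T (x : oob T), obase (oid x) = lid T;
  obase_comp : forall T2 T1 T (x2 : oob T2) (x1 : oob T1) (x : oob T)
    (m : omor x1 x) (n : omor x2 x1),
    obase (ocomp m n) = lcomp (obase m) (obase n);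
  ocomp_idl : forall T' T (x' : oob T') (x : oob T) (m : omor x' x),
    ocomp (oid x) m = m;
  ocomp_idr : forall T' T (x' : oob T') (x : oob T) (m : omor x' x),
    ocomp m (oid x') = m;
  ocomp_assoc : forall T3 T2 T1 T
    (x3 : oob T3) (x2 : oob T2) (x1 : oob T1) (x : oob T)
    (m : omor x1 x) (n : omor x2 x1) (k : omor x3 x2),
    ocomp m (ocomp n k) = ocomp (ocomp m n) k }.

Definition fibered_in_groupoids (X : overCat) : Prop :=
  (forall (T' T : tbMet R) (f : lipMap T' T) (x : oob X T),
     exists (x' : oob X T') (m : omor x' x), obase m = f) /\
  forall (T2 T1 T : tbMet R) (x2 : oob X T2) (x1 : oob X T1) (x : oob X T)
    (m : omor x1 x) (n : omor x2 x) (g : lipMap T2 T1),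
    lcomp (obase m) g = obase n ->
    exists! k : omor x2 x1, obase k = g /\ ocomp m k = n.

(* Isom(x, y) is a sheaf: [a i] exhibits [x' i] as the restriction of x to U_i,
   and [m i] is a morphism from this restriction to y over T. *)
Definition morphisms_glue (X : overCat) : Prop :=
  forall (T : tbMet R) (U : metFamily T), lsm_covering U ->
  forall (x y : oob X T) (x' : forall i, oob X (fam_dom (m := U) i))
    (a : forall i, omor (x' i) x) (m : forall i, omor (x' i) y),
    (forall i, obase (a i) = fam_map i) ->
    (forall i, obase (m i) = fam_map i) ->
    (forall i j (V : tbMet R) (z : oob X V)
       (u : omor z (x' i)) (v : omor z (x' j)),
       ocomp (a i) u = ocomp (a j) v -> ocomp (m i) u = ocomp (m j) v) ->
    exists! h : omor x y, obase h = lid T /\ forall i, ocomp h (a i) = m i.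

(* Descent data without a choice of pullbacks: the span
   [dd_ob i <- dd_ob2 i j -> dd_ob j] over the two projections of
   U_i x_T U_j is the isomorphism pr1^* x_i ~ pr2^* x_j, and the cocycle
   condition is tested on all z over a space V mapping to
   U_i x_T U_j x_T U_k. *)
Record descentDatum (X : overCat) (T : tbMet R) (U : metFamily T) : Type :=
  DescentDatum {
  dd_ob : forall i, oob X (fam_dom (m := U) i);
  dd_ob2 : forall i j, oob X (tb_fibProd (fam_map (m := U) i) (fam_map j));
  dd_fst : forall i j, omor (dd_ob2 i j) (dd_ob i);
  dd_snd : forall i j, omor (dd_ob2 i j) (dd_ob j);
  dd_fst_base : forall i j,
    obase (dd_fst i j) = fp_pr1 (fam_map i) (fam_map j);
  dd_snd_base : forall i j,
    obase (dd_snd i j) = fp_pr2 (fam_map i) (fam_map j);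
  dd_cocycle : forall i j k (V : tbMet R) (z : oob X V)
    (u : omor z (dd_ob2 i j)) (v : omor z (dd_ob2 j k))
    (w : omor z (dd_ob2 i k)),
    ocomp (dd_fst i j) u = ocomp (dd_fst i k) w ->
    ocomp (dd_snd i j) u = ocomp (dd_fst j k) v ->
    lcomp (obase (dd_snd j k)) (obase v) =
      lcomp (obase (dd_snd i k)) (obase w) ->
    ocomp (dd_snd j k) v = ocomp (dd_snd i k) w }.

Definition effective (X : overCat) (T : tbMet R) (U : metFamily T)
    (D : descentDatum X U) : Prop :=
  exists (x : oob X T) (a : forall i, omor (dd_ob D i) x),
    (forall i, obase (a i) = fam_map i) /\
    forall i j, ocomp (a i) (dd_fst D i j) = ocomp (a j) (dd_snd D i j).

Definition is_stack (X : overCat) : Prop :=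
  [/\ fibered_in_groupoids X, morphisms_glue X &
      forall (T : tbMet R) (U : metFamily T), lsm_covering U ->
        forall D : descentDatum X U, effective D].

Record overFun (X Y : overCat) : Type := OverFun {
  fob :> forall T : tbMet R, oob X T -> oob Y T;
  fmor : forall (T' T : tbMet R) (x' : oob X T') (x : oob X T),
    omor x' x -> omor (fob x') (fob x);
  fmor_base : forall T' T (x' : oob X T') (x : oob X T) (m : omor x' x),
    obase (fmor m) = obase m;
  fmor_id : forall T (x : oob X T), fmor (oid x) = oid (fob x);
  fmor_comp : forall T2 T1 T (x2 : oob X T2) (x1 : oob X T1) (x : oob X T)
    (m : omor x1 x) (n : omor x2 x1),
    fmor (ocomp m n) = ocomp (fmor m) (fmor n) }.

Program Definition fid (X : overCat) : overFun X X :=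
  {| fob := fun T x => x; fmor := fun T' T x' x m => m |}.

Program Definition fcomp (X Y Z : overCat) (G : overFun Y Z) (F : overFun X Y) :
  overFun X Z :=
  {| fob := fun T x => G T (F T x);
     fmor := fun T' T x' x m => fmor G (fmor F m) |}.
Next Obligation. by rewrite !fmor_base. Qed.
Next Obligation. by rewrite !fmor_id. Qed.
Next Obligation. by rewrite !fmor_comp. Qed.

(* Arrows over an identity are invertible in a category fibered in groupoids,
   so between stacks these are exactly the 2-isomorphisms. *)
Record twoCell (X Y : overCat) (F G : overFun X Y) : Type := TwoCell {
  tc :> forall (T : tbMet R) (x : oob X T), omor (F T x) (G T x);
  tc_base : forall T (x : oob X T), obase (tc x) = lid T;
  tc_nat : forall T' T (x' : oob X T') (x : oob X T) (m : omor x' x),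
    ocomp (tc x) (fmor F m) = ocomp (fmor G m) (tc x') }.

Definition two_isomorphic (X Y : overCat) (F G : overFun X Y) : Prop :=
  inhabited (twoCell F G).

Program Definition vcomp (X Y : overCat) (F G H : overFun X Y)
    (b : twoCell G H) (a : twoCell F G) : twoCell F H :=
  {| tc := fun T x => ocomp (b T x) (a T x) |}.
Next Obligation. by rewrite obase_comp !tc_base; exact: lipMap_eq. Qed.
Next Obligation. by rewrite -ocomp_assoc tc_nat !ocomp_assoc tc_nat. Qed.

Program Definition whiskl (X Y Z : overCat) (K : overFun Y Z)
    (F G : overFun X Y) (a : twoCell F G) : twoCell (fcomp K F) (fcomp K G) :=
  {| tc := fun T x => fmor K (a T x) |}.
Next Obligation. by rewrite fmor_base tc_base. Qed.
Next Obligation. by rewrite -!fmor_comp tc_nat. Qed.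

Program Definition whiskr (X Y Z : overCat) (F G : overFun Y Z)
    (a : twoCell F G) (K : overFun X Y) : twoCell (fcomp F K) (fcomp G K) :=
  {| tc := fun T x => a T (K T x) |}.
Next Obligation. by rewrite tc_base. Qed.
Next Obligation. by rewrite tc_nat. Qed.

Definition equivalent_over (X P Q : overCat) (p : overFun P X)
    (q : overFun Q X) : Prop :=
  exists (E : overFun P Q) (E' : overFun Q P),
    [/\ two_isomorphic (fcomp q E) p,
        two_isomorphic (fcomp E E') (fid Q) &
        two_isomorphic (fcomp E' E) (fid P)].

Section FiberProduct2.
Context (X Y B : overCat) (F : overFun X B) (G : overFun Y B).

Record fib2Ob (T : tbMet R) : Type := Fib2Ob {
  f2_fst : oob X T;
  f2_snd : oob Y T;
  f2_cell : omor (F T f2_fst) (G T f2_snd);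
  f2_cell_base : obase f2_cell = lid T }.

Record fib2Mor (T' T : tbMet R) (z' : fib2Ob T') (z : fib2Ob T) : Type :=
  Fib2Mor {
  f2m_fst : omor (f2_fst z') (f2_fst z);
  f2m_snd : omor (f2_snd z') (f2_snd z);
  f2m_base : obase f2m_fst = obase f2m_snd;
  f2m_comm : ocomp (f2_cell z) (fmor F f2m_fst) =
             ocomp (fmor G f2m_snd) (f2_cell z') }.

Lemma fib2Mor_eq T' T (z' : fib2Ob T') (z : fib2Ob T) (m n : fib2Mor z' z) :
  f2m_fst m = f2m_fst n -> f2m_snd m = f2m_snd n -> m = n.
Proof.
case: m n => [m1 m2 e c] [n1 n2 e' c'] /= mn1 mn2; subst n1 n2.
by rewrite (Prop_irrelevance e e') (Prop_irrelevance c c').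
Qed.

Program Definition fib2_id T (z : fib2Ob T) : fib2Mor z z :=
  {| f2m_fst := oid (f2_fst z); f2m_snd := oid (f2_snd z) |}.
Next Obligation. by rewrite !obase_id. Qed.
Next Obligation. by rewrite !fmor_id ocomp_idl ocomp_idr. Qed.

Program Definition fib2_comp T2 T1 T (z2 : fib2Ob T2) (z1 : fib2Ob T1)
    (z : fib2Ob T) (m : fib2Mor z1 z) (n : fib2Mor z2 z1) : fib2Mor z2 z :=
  {| f2m_fst := ocomp (f2m_fst m) (f2m_fst n);
     f2m_snd := ocomp (f2m_snd m) (f2m_snd n) |}.
Next Obligation. by rewrite !obase_comp !f2m_base. Qed.
Next Obligation.
by rewrite !fmor_comp ocomp_assoc f2m_comm -!ocomp_assoc f2m_comm.
Qed.

Program Definition fib2 : overCat :=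
  {| oob := fib2Ob; omor := fib2Mor;
     obase := fun T' T z' z m => obase (f2m_fst m);
     oid := fib2_id; ocomp := fib2_comp |}.
Next Obligation. by rewrite obase_id. Qed.
Next Obligation. by rewrite obase_comp. Qed.
Next Obligation. by apply: fib2Mor_eq; rewrite /= ocomp_idl. Qed.
Next Obligation. by apply: fib2Mor_eq; rewrite /= ocomp_idr. Qed.
Next Obligation. by apply: fib2Mor_eq; rewrite /= ocomp_assoc. Qed.

Program Definition fib2_pr1 : overFun fib2 X :=
  {| fob := fun T z => f2_fst z; fmor := fun T' T z' z m => f2m_fst m |}.

Program Definition fib2_pr2 : overFun fib2 Y :=
  {| fob := fun T z => f2_snd z; fmor := fun T' T z' z m => f2m_snd m |}.
Next Obligation. by rewrite f2m_base. Qed.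

End FiberProduct2.

Section Representable.
Context (X : metricType R).

Definition repMor (T' T : tbMet R) (x' : lipMap T' X) (x : lipMap T X) :=
  {f : lipMap T' T | lcomp x f = x'}.

Lemma repMor_eq (T' T : tbMet R) (x' : lipMap T' X) (x : lipMap T X) (f g : repMor x' x) :
  sval f = sval g -> f = g.
Proof.
case: f g => [f ef] [g eg] /= fg; subst g.
by rewrite (Prop_irrelevance ef eg).
Qed.

Program Definition rep : overCat :=
  {| oob := fun T => lipMap T X; omor := repMor;
     obase := fun T' T x' x m => sval m;
     oid := fun T x => exist _ (lid T) _;
     ocomp := fun T2 T1 T x2 x1 x m n => exist _ (lcomp (sval m) (sval n)) _ |}.
Next Obligation. exact: lipMap_eq. Qed.
Next Obligation.
by case: m n => [m em] [n en] /=; rewrite -en -em; exact: lipMap_eq.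
Qed.
Next Obligation. by apply: repMor_eq; exact: lipMap_eq. Qed.
Next Obligation. by apply: repMor_eq; exact: lipMap_eq. Qed.
Next Obligation. by apply: repMor_eq; exact: lipMap_eq. Qed.

End Representable.

Program Definition rep_map (X Y : metricType R) (f : lipMap X Y) :
  overFun (rep X) (rep Y) :=
  {| fob := fun T (x : oob (rep X) T) => lcomp f x : oob (rep Y) T;
     fmor := fun T' T x' x m => exist _ (sval m) _ |}.
Next Obligation. by case: m => m em /=; rewrite -em; exact: lipMap_eq. Qed.
Next Obligation. exact: repMor_eq. Qed.
Next Obligation. exact: repMor_eq. Qed.

(* The maps of stacks attached to g o f and to h agree only up to this
   (identity) 2-cell when g o f = h. *)
Program Definition rep_comp (X Y Z : metricType R) (g : lipMap Y Z)
    (f : lipMap X Y) (h : lipMap X Z) (gf : lcomp g f = h) :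
  twoCell (fcomp (rep_map g) (rep_map f)) (rep_map h) :=
  {| tc := fun T (x : oob (rep X) T) => exist _ (lid T) _ |}.
Next Obligation. by rewrite -gf; exact: lipMap_eq. Qed.
Next Obligation. by apply: repMor_eq; exact: lipMap_eq. Qed.

Definition essentially_surjective_at (X Y : overCat) (f : overFun X Y)
    (T : tbMet R) : Prop :=
  forall y : oob Y T, exists (x : oob X T) (m : omor (f T x) y),
    obase m = lid T.

Definition formal_submetry (X Y : overCat) (f : overFun X Y) : Prop :=
  essentially_surjective_at f (tb_pt R) /\
  forall (r s : {posnum R}) (sr : s%:num < r%:num)
    (x : overFun (rep met_pt) X) (g : overFun (rep (met_two s)) Y)
    (alpha : twoCell (fcomp f x) (fcomp g (rep_map (iota0 s)))),
  exists (h : overFun (rep (met_two r)) X)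
    (beta : twoCell (fcomp h (rep_map (iota0 r))) x)
    (gamma : twoCell (fcomp f h) (fcomp g (rep_map (iota2 sr)))),
  forall (T : tbMet R) (t : oob (rep met_pt) T),
    ocomp (alpha T t) (whiskl f beta T t) =
    ocomp (whiskl g (rep_comp (iota2K sr)) T t)
          (whiskr gamma (rep_map (iota0 r)) T t).

Definition naive_metric_stack (X : overCat) : Prop :=
  is_stack X /\
  exists (U : metricType R) (f : overFun (rep U) X), formal_submetry f.

Definition quotient_type (X : overCat) : Prop :=
  exists (U : metricType R) (f : overFun (rep U) X), formal_submetry f /\
  forall (T : tbMet R) (t : oob X T),
  exists V : metFamily T, lsm_covering V /\
  forall i : fam_idx V,
    exists (t' : oob X (fam_dom i)) (q : omor t' t), obase q = fam_map i /\
    exists (u : oob (rep U) (fam_dom i)) (m : omor (f _ u) t'),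
      obase m = lid (fam_dom i).

Definition representable_proper_submetry (X B : overCat) (f : overFun X B) :
  Prop :=
  forall (T : tbMet R) (b : overFun (rep T) B),
  exists (P : metricType R) (p : lipMap P T), proper_submetry p /\
    equivalent_over (rep_map p) (fib2_pr2 f b).

End Over.

Arguments overCat R : clear implicits.

Section GH.
Context {R : realType}.

Record ghOb (T : tbMet R) : Type := GhOb {
  gh_space : metricType R;
  gh_map : lipMap gh_space T;
  gh_proper : proper_submetry gh_map }.

Record ghMor (T' T : tbMet R) (P' : ghOb T') (P : ghOb T) : Type := GhMor {
  ghm_base : lipMap T' T;
  ghm_top : lipMap (gh_space P') (gh_space P);
  ghm_cart : exists e : lcomp (gh_map P) ghm_top = lcomp ghm_base (gh_map P'),
    met_iso (fp_lift e) }.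

Lemma ghMor_eq T' T (P' : ghOb T') (P : ghOb T) (m n : ghMor P' P) :
  ghm_base m = ghm_base n -> ghm_top m = ghm_top n -> m = n.
Proof.
case: m n => [b t c] [b' t' c'] /= eb et; subst b' t'.
by rewrite (Prop_irrelevance c c').
Qed.

Lemma gh_id_subproof (T : tbMet R) (P : ghOb T) :
  exists e : lcomp (gh_map P) (lid _) = lcomp (lid T) (gh_map P),
    met_iso (fp_lift e).
Proof.
have e : lcomp (gh_map P) (lid _) = lcomp (lid T) (gh_map P).
  exact: lipMap_eq.
exists e; apply/met_isoP; split=> [[p t /= pt]|x x'].
  by exists p; apply: fibProd_eq.
by rewrite fp_mdistE le_max lexx.
Qed.

Definition gh_id (T : tbMet R) (P : ghOb T) : ghMor P P :=
  GhMor (gh_id_subproof P).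

Lemma gh_comp_subproof (T2 T1 T : tbMet R) (P2 : ghOb T2) (P1 : ghOb T1)
    (P : ghOb T) (m : ghMor P1 P) (n : ghMor P2 P1) :
  exists e : lcomp (gh_map P) (lcomp (ghm_top m) (ghm_top n)) =
             lcomp (lcomp (ghm_base m) (ghm_base n)) (gh_map P2),
    met_iso (fp_lift e).
Proof.
case: m n => [b t [e /met_isoP[ts ti]]] [b' t' [e' /met_isoP[ts' ti']]] /=.
have eE x : gh_map P (t x) = b (gh_map P1 x) := lipMap_app e x.
have eE' x : gh_map P1 (t' x) = b' (gh_map P2 x) := lipMap_app e' x.
have e2 : lcomp (gh_map P) (lcomp t t') = lcomp (lcomp b b') (gh_map P2).
  by apply: lipMap_eq => x /=; rewrite eE eE'.
exists e2; apply/met_isoP; split=> [[p u /= pu]|x x'].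
  have [p1 p1E] := ts (@FibProd _ _ _ _ (gh_map P) b p (b' u) pu).
  have p1p : t p1 = p := congr1 (@fp_fst _ _ _ _ _ _) p1E.
  have p1u : gh_map P1 p1 = b' u := congr1 (@fp_snd _ _ _ _ _ _) p1E.
  have [p2 p2E] := ts' (@FibProd _ _ _ _ (gh_map P1) b' p1 u p1u).
  exists p2; apply: fibProd_eq => /=.
    by rewrite (congr1 (@fp_fst _ _ _ _ _ _) p2E : t' p2 = p1).
  exact: (congr1 (@fp_snd _ _ _ _ _ _) p2E : gh_map P2 p2 = u).
apply: le_trans (ti' x x') _; rewrite !fp_mdistE /= ge_max.
rewrite [X in _ && X]le_max lexx orbT andbT.
apply: le_trans (ti (t' x) (t' x')) _; rewrite !fp_mdistE /= ge_max.
by rewrite !eE' !le_max lexx /= lipP orbT.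
Qed.

Definition gh_comp (T2 T1 T : tbMet R) (P2 : ghOb T2) (P1 : ghOb T1)
    (P : ghOb T) (m : ghMor P1 P) (n : ghMor P2 P1) : ghMor P2 P :=
  GhMor (gh_comp_subproof m n).

Program Definition GH : overCat R :=
  {| oob := ghOb; omor := ghMor;
     obase := fun T' T P' P m => ghm_base m;
     oid := gh_id; ocomp := gh_comp |}.
Next Obligation. by apply: ghMor_eq; exact: lipMap_eq. Qed.
Next Obligation. by apply: ghMor_eq; exact: lipMap_eq. Qed.
Next Obligation. by apply: ghMor_eq; exact: lipMap_eq. Qed.

Record gh1Ob (T : tbMet R) : Type := Gh1Ob {
  gh1_ob : ghOb T;
  gh1_sec : lipMap T (gh_space gh1_ob);
  gh1_secP : lcomp (gh_map gh1_ob) gh1_sec = lid T }.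

Definition gh1Mor (T' T : tbMet R) (P' : gh1Ob T') (P : gh1Ob T) : Type :=
  {m : ghMor (gh1_ob P') (gh1_ob P) |
     lcomp (ghm_top m) (gh1_sec P') = lcomp (gh1_sec P) (ghm_base m)}.

Lemma gh1Mor_eq T' T (P' : gh1Ob T') (P : gh1Ob T) (m n : gh1Mor P' P) :
  sval m = sval n -> m = n.
Proof.
case: m n => [m em] [n en] /= mn; subst n.
by rewrite (Prop_irrelevance em en).
Qed.

Program Definition GH1 : overCat R :=
  {| oob := gh1Ob; omor := gh1Mor;
     obase := fun T' T P' P m => ghm_base (sval m);
     oid := fun T P => exist _ (gh_id (gh1_ob P)) _;
     ocomp := fun T2 T1 T P2 P1 P m n => exist _ (gh_comp (sval m) (sval n)) _
  |}.
Next Obligation. exact: lipMap_eq. Qed.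
Next Obligation.
case: m n => [m em] [n en] /=; apply: lipMap_eq => x /=.
have /= -> := lipMap_app en x.
exact: (lipMap_app em (ghm_base n x)).
Qed.
Next Obligation. by apply: gh1Mor_eq; apply: ghMor_eq; exact: lipMap_eq. Qed.
Next Obligation. by apply: gh1Mor_eq; apply: ghMor_eq; exact: lipMap_eq. Qed.
Next Obligation. by apply: gh1Mor_eq; apply: ghMor_eq; exact: lipMap_eq. Qed.

Program Definition gh_p0 : overFun GH1 GH :=
  {| fob := fun T (P : oob GH1 T) => gh1_ob P : oob GH T;
     fmor := fun T' T P' P m => sval m |}.

Definition gh_pullback (X : overCat R) (F : overFun X GH) :
  overFun (fib2 F gh_p0) X := fib2_pr1 F gh_p0.

End GH.

Arguments GH R : clear implicits.
Arguments GH1 R : clear implicits.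
Arguments gh_p0 R : clear implicits.

(* Main.v *)
(** An atlas of GH. Call a compact subset A of the bounded functions on
    codes c : nat -> R generic if its coordinates a |-> a c realise every
    1-Lipschitz function on A bounded by the norm, each of them continuum many
    times. Genericity lets an isometric copy of a compact space K be extended
    to any totally bounded Q containing K, with generic compact image fibres:
    every coordinate is extended to Q, and there are enough coordinates to
    realise all extensions. Let U be the set of nonempty generic compacts with
    the Hausdorff distance, and P_U = {(A, a) : a in A} with the maximum
    distance. If T is totally bounded and P -> T is a proper submetry, then P is
    totally bounded; embedding P generically, t |-> P_t is a 1-Lipschitz map
    T -> U that pulls P_U back to P, so that U(T) -> GH(T) is already
    essentially surjective. The lifting along 2_r -> 2_s is the extension of
    the given embedding of the fibre over 0.

    The correspondence. For p : P -> X, say that F : X -> GH classifies p if the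
    objects of P over x are, functorially, the sections of F x. Then F classifies
    its own pullback of GH_1; two stacks over X classified by the same F are
    equivalent over X; being classified by F passes along equivalences over X;
    and p determines F up to 2-isomorphism, since the points and the distances
    of F x are read off from the objects of P over the one- and two-point
    spaces. If p is representable, the spaces representing its pullbacks along
    the objects of X assemble, by the same reading, into an F classifying p. *)

Require Import Defs.
From HB Require Import structures.
From mathcomp Require Import all_boot all_order all_algebra.
From mathcomp Require Import all_classical all_reals all_analysis.
From mathcomp Require Import lra.

Set Implicit Arguments.
Unset Strict Implicit.
Unset Printing Implicit Defensive.
Import Order.TTheory GRing.Theory Num.Theory.
Local Open Scope classical_set_scope.
Local Open Scope ring_scope.

(** * Submetries, cartesian arrows and pullbacks *)

Lemma dep_choice (A : Type) (B : A -> Type) (Q : forall a, B a -> Prop) :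
  (forall a, exists b, Q a b) -> exists f : forall a, B a, forall a, Q a (f a).
Proof. by move=> h; exists (fun a => sval (cid (h a))) => a; exact: svalP. Qed.

Section MetricLemmas.
Context {R : realType}.
Implicit Types M N B : metricType R.

Lemma mdist0_eq M (x y : M) : mdist x y <= 0 -> x = y.
Proof. by move=> h; apply: mdist_positivity; apply/eqP; rewrite eq_le h mdist_ge0. Qed.

Lemma mdist_lt_nbhs M (x : M) (e : R) : 0 < e -> nbhs x [set y | mdist x y < e].
Proof. by move=> e0; rewrite -ballEmdist; exact: nbhsx_ballx. Qed.

Lemma nbhs_mdistW M (x : M) (A : set M) :
  nbhs x A -> exists2 e : R, 0 < e & forall y, mdist x y < e -> A y.
Proof.
rewrite -nbhs_ballE => -[e /= e0 h]; exists e => // y xy.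
by apply: h; rewrite ballEmdist.
Qed.

(** Continuous images of compact sets, phrased with a relation so that the map need only be given
    between A and C. A proper filter on C is pulled back along r; a partner in C of a cluster point
    of the pullback is a cluster point of the filter. *)
Lemma compact_lip_rel M N (r : M -> N -> Prop) (A : set M) (C : set N) :
  (forall a, A a -> exists2 c, C c & r a c) ->
  (forall c, C c -> exists2 a, A a & r a c) ->
  (forall a a' c c', r a c -> r a' c' -> mdist c c' <= mdist a a') ->
  compact A -> compact C.
Proof.
move=> rl rr rlip cA F FF FC.
pose G := filter_from F (fun D => [set a | A a /\ exists2 c, C c /\ D c & r a c]).
have GF : ProperFilter G.
  apply: filter_from_proper; last first.
    move=> D FD; have [c [Cc Dc]] := filter_ex (filterI FC FD).
    by have [a Aa rac] := rr _ Cc; exists a; split => //; exists c.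
  apply: filter_from_filter; first by exists C.
  move=> D1 D2 F1 F2; exists (D1 `&` D2); first exact: filterI.
  by move=> a [Aa [c [Cc [c1 c2]] rac]]; split; split => //; exists c.
have GA : G A by exists C => // a [].
have [a [Aa Ga]] := cA G GF GA; have [c Cc rac] := rl _ Aa.
exists c; split=> // D E FD /nbhs_mdistW[e e0 eE].
have GD : G [set a | A a /\ exists2 c, C c /\ D c & r a c] by exists D.
have [a' [[Aa' [c' [Cc' Dc'] rac']] aa']] := Ga _ _ GD (mdist_lt_nbhs a e0).
exists c'; split=> //; apply: eE; apply: le_lt_trans aa'; exact: rlip.
Qed.

(** Without a finite net, the sets [far D] would generate a proper filter on A; a cluster point a
    would be adherent to [far [set a]], which stays at distance e from a. *)
Lemma compact_finite_net M (A : set M) (e : R) : 0 < e -> compact A ->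
  exists2 D : set M, finite_set D & forall a, A a -> exists2 d, D d & mdist d a < e.
Proof.
move=> e0 cA; apply: contrapT => nD.
pose far (D : set M) := [set a | A a /\ forall d, D d -> e <= mdist d a].
pose F := filter_from [set D : set M | finite_set D] far.
have FF : ProperFilter F.
  apply: filter_from_proper; last first.
    move=> D /= fD; apply: contrapT => nfar; apply: nD; exists D => // a Aa.
    apply: contrapT => nd; apply: nfar; exists a; split=> // d Dd.
    by rewrite leNgt; apply/negP => da; apply: nd; exists d.
  apply: filter_from_filter; first by exists set0; exact: finite_set0.
  move=> D1 D2 f1 f2; exists (D1 `|` D2); first by rewrite /= finite_setU.
  by move=> a [Aa h]; split; split=> // d Dd; apply: h; [left|right].
have FA : F A by exists set0; [exact: finite_set0|move=> a []].
have [a [_ Fa]] := cA F FF FA.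
have Fa1 : F (far [set a]) by exists [set a] => //=; exact: finite_set1.
have [b [[_ h] ab]] := Fa _ _ Fa1 (mdist_lt_nbhs a e0).
by have := h a erefl; rewrite leNgt => /negP.
Qed.

(** The Hausdorff bound of a submetry read pointwise; the slack e stands for the infimum in that
    bound. *)
Definition eps_lifting M B (f : lipMap M B) :=
  forall x b (e : R), 0 < e ->
    exists2 x', f x' = b & mdist x x' < mdist (f x) b + e.

Lemma submetry_lifting M B (f : lipMap M B) : submetry f -> eps_lifting f.
Proof.
move=> [fs fH] x b e e0.
have : (hausdorff_dist (f @^-1` [set f x]) (f @^-1` [set b])
    < (mdist (f x) b + e)%:E)%E.
  by apply: le_lt_trans (fH _ _) _; rewrite lte_fin ltrDl.
move=> /ereal_inf_lt[_ [d [d0 [dl _]] <-]]; rewrite lte_fin => de.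
have [x' fx' xx'] := dl x erefl; exists x' => //; exact: lt_trans de.
Qed.

Lemma lifting_submetry M B (f : lipMap M B) :
  (forall b, exists x, f x = b) -> eps_lifting f -> submetry f.
Proof.
move=> fs fl; split=> // b0 b1; apply/lee_addgt0Pr => e e0.
apply: ge_ereal_inf; exists (mdist b0 b1 + e)%:E; last by rewrite EFinD.
exists (mdist b0 b1 + e) => //; split; first by rewrite ltr_wpDl ?mdist_ge0.
split=> a /= <-.
  by have [x' x'b ax'] := fl a b1 e e0; exists x'.
have [x' x'b ax'] := fl a b0 e e0; exists x' => //.
by rewrite metric_sym (metric_sym b0).
Qed.

(** If b is adherent to the image of A, some points of A can be moved into the fibre over b by
    arbitrarily small amounts. The sets [S e] so obtained generate a proper filter on the compact
    fibre, whose cluster points there are adherent to A. *)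
Lemma lifting_proper M B (f : lipMap M B) : eps_lifting f ->
  (forall b, compact (f @^-1` [set b])) -> proper_map f.
Proof.
move=> fl fc; split=> // A cA b cb.
pose S (e : R) := [set x | f x = b /\ exists2 a, A a & mdist a x < e].
pose F := filter_from [set e : R | 0 < e] S.
have FF : ProperFilter F.
  apply: filter_from_proper; last first.
    move=> e /= e0; have e20 : 0 < e / 2 by rewrite divr_gt0.
    have [y [[a Aa <-] ba]] := cb _ (mdist_lt_nbhs b e20).
    have [x fx ax] := fl a b _ e20.
    exists x; split => //; exists a => //; apply: lt_trans ax _.
    by rewrite /= metric_sym in ba; rewrite [ltRHS](splitr e) ltrD2r.
  apply: filter_from_filter; first by exists 1 => /=.
  move=> e1 e2 /= e10 e20; exists (Num.min e1 e2); first by rewrite /= lt_min e10.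
  move=> x [fx [a Aa]]; rewrite lt_min => /andP[h1 h2].
  by split; split => //; exists a.
have [x [fx xF]] : (f @^-1` [set b]) `&` cluster F !=set0.
  by apply: fc; exists 1 => //= x [].
exists x => //; apply: cA => E /nbhs_mdistW[e e0 eE].
have e20 : 0 < e / 2 by rewrite divr_gt0.
have FS : F (S (e / 2)) by exists (e / 2).
have [x' [[_ [a Aa ax']] xx']] := xF _ _ FS (mdist_lt_nbhs x e20).
exists a; split=> //; apply: eE; apply: le_lt_trans (metric_triangle _ x' _) _.
by rewrite (splitr e) ltrD // metric_sym.
Qed.

Lemma proper_submetryI M B (f : lipMap M B) :
  (forall b, exists x, f x = b) -> eps_lifting f ->
  (forall b, compact (f @^-1` [set b])) -> proper_submetry f.
Proof.
by move=> fs fl fc; split; [exact: lifting_submetry|exact: lifting_proper].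
Qed.

(** A finite net of B together with finite nets of the compact fibres over its points gives a net of
    M, since lifting moves every point into one of these fibres. *)
Lemma proper_submetry_tot_bounded M B (f : lipMap M B) :
  proper_submetry f -> tot_bounded B -> tot_bounded M.
Proof.
move=> [fs [_ fc]] tB e e0; have e20 : 0 < e / 2 by rewrite divr_gt0.
have [D fD BD] := tB _ e20.
have /choice[n nE] : forall b, exists n : set M, finite_set n /\
    forall a, f a = b -> exists2 d, n d & mdist d a < e / 2.
  by move=> b; have [n ? ?] := compact_finite_net e20 (fc b); exists n.
exists (\bigcup_(b in D) n b).
  by apply: bigcup_finite => // b _; have [] := nE b.
move=> x _; have [b Db] := BD (f x) I; rewrite ballEmdist /= => bx.
have [x' fx' xx'] : exists2 x', f x' = b & mdist x x' < e / 2.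
  have e'0 : 0 < e / 2 - mdist b (f x) by rewrite subr_gt0.
  have [x' fx' xx'] := submetry_lifting fs x b e'0.
  by exists x' => //; rewrite [mdist (f x) b]metric_sym addrC subrK in xx'.
have [_ /(_ _ fx')[d nd dx']] := nE b.
exists d; first by exists b.
rewrite ballEmdist /=; apply: le_lt_trans (metric_triangle _ x' _) _.
by rewrite (splitr e) ltrD // metric_sym.
Qed.

Lemma two_tot_bounded (r : {posnum R}) : tot_bounded (met_two r).
Proof.
move=> e e0; exists setT; first exact: (@finite_finset bool).
by move=> x _; exists x => //; exact: ballxx.
Qed.

Definition tb_two (r : {posnum R}) : tbMet R := TbMet (two_tot_bounded r).

Lemma pt_map_subproof M (x : M) (u v : met_pt) :
  mdist x x <= mdist u v :> R.
Proof. by rewrite mdistxx mdist_ge0. Qed.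

Definition pt_map M (x : M) : lipMap (tb_pt R) M :=
  @LipMap _ (tb_pt R) M _ (pt_map_subproof x).

Definition two_fun M (r : {posnum R}) (x y : M) (b : met_two r) : M :=
  if b then y else x.

Lemma two_map_subproof M (r : {posnum R}) (x y : M) : mdist x y <= r%:num ->
  forall b c, mdist (@two_fun M r x y b) (two_fun x y c) <= mdist b c.
Proof.
move=> xy [] []; rewrite /two_fun ?mdistxx ?mdist_ge0 //.
by rewrite metric_sym.
Qed.

Definition two_map M (r : {posnum R}) (x y : M) (xy : mdist x y <= r%:num) :
  lipMap (tb_two r) M := @LipMap _ (tb_two r) M _ (two_map_subproof xy).

End MetricLemmas.

Section Fibered.
Context {R : realType} (X : overCat R) (fX : fibered_in_groupoids X).

Lemma cart_pull (T' T : tbMet R) (f : lipMap T' T) (x : oob X T) :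
  exists (x' : oob X T') (m : omor x' x), obase m = f.
Proof. exact: (proj1 fX). Qed.

Lemma cart_lift (T2 T1 T : tbMet R) (x2 : oob X T2) (x1 : oob X T1)
    (x : oob X T) (m : omor x1 x) (n : omor x2 x) (g : lipMap T2 T1) :
  lcomp (obase m) g = obase n ->
  exists k : omor x2 x1, obase k = g /\ ocomp m k = n.
Proof. by move=> /(proj2 fX)[k [kP _]]; exists k. Qed.

Lemma cart_uniq (T2 T1 T : tbMet R) (x2 : oob X T2) (x1 : oob X T1)
    (x : oob X T) (m : omor x1 x) (k k' : omor x2 x1) :
  obase k = obase k' -> ocomp m k = ocomp m k' -> k = k'.
Proof.
move=> kk mk.
have /(proj2 fX)[k0 [_ k0U]] :
  lcomp (obase m) (obase k) = obase (ocomp m k) by rewrite obase_comp.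
by rewrite -(k0U k) // -(k0U k').
Qed.

Lemma cart_inv (T : tbMet R) (x' x : oob X T) (m : omor x' x) :
  obase m = lid T -> exists k : omor x x',
  [/\ obase k = lid T, ocomp m k = oid x & ocomp k m = oid x'].
Proof.
move=> mb; have [|k [kb mk]] := @cart_lift _ _ _ x x' x m (oid x) (lid T).
  by rewrite mb obase_id; exact: lipMap_eq.
exists k; split=> //; apply: (@cart_uniq _ _ _ _ _ _ m).
  by rewrite obase_comp kb mb obase_id; exact: lipMap_eq.
by rewrite ocomp_assoc mk ocomp_idl ocomp_idr.
Qed.

Lemma iso_epi (T T2 : tbMet R) (x' x : oob X T) (y : oob X T2) (m : omor x' x)
    (k k' : omor x y) :
  obase m = lid T -> ocomp k m = ocomp k' m -> k = k'.
Proof.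
move=> /cart_inv[n [_ mn _]] km.
by rewrite -[k]ocomp_idr -[k']ocomp_idr -mn !ocomp_assoc km.
Qed.

End Fibered.

Lemma lcomp_id_l (R : realType) (A B : metricType R) (f : lipMap A B) :
  lcomp (lid B) f = f.
Proof. exact: lipMap_eq. Qed.

Lemma lcomp_id_r (R : realType) (A B : metricType R) (f : lipMap A B) :
  lcomp f (lid A) = f.
Proof. exact: lipMap_eq. Qed.

Section GHMor.
Context {R : realType}.

Lemma ghm_comm (T' T : tbMet R) (P' : ghOb T') (P : ghOb T) (m : ghMor P' P) x :
  gh_map P (ghm_top m x) = ghm_base m (gh_map P' x).
Proof. by have [e _] := ghm_cart m; exact: (lipMap_app e). Qed.

Lemma ghm_lift (T' T : tbMet R) (P' : ghOb T') (P : ghOb T) (m : ghMor P' P) y t :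
  gh_map P y = ghm_base m t -> exists x, ghm_top m x = y /\ gh_map P' x = t.
Proof.
have [e /met_isoP[ms _]] := ghm_cart m => yt.
have [x xE] := ms (FibProd yt); exists x.
by split; [exact: (congr1 (@fp_fst _ _ _ _ _ _) xE)|
  exact: (congr1 (@fp_snd _ _ _ _ _ _) xE)].
Qed.

Lemma ghm_dist (T' T : tbMet R) (P' : ghOb T') (P : ghOb T) (m : ghMor P' P) x y :
  mdist x y <= Num.max (mdist (ghm_top m x) (ghm_top m y))
                       (mdist (gh_map P' x) (gh_map P' y)).
Proof. by have [e /met_isoP[_ mi]] := ghm_cart m; exact: (mi x y). Qed.

Lemma ghm_inj (T' T : tbMet R) (P' : ghOb T') (P : ghOb T) (m : ghMor P' P) x y :
  ghm_top m x = ghm_top m y -> gh_map P' x = gh_map P' y -> x = y.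
Proof.
move=> e1 e2; apply: mdist0_eq; apply: le_trans (ghm_dist m _ _) _.
by rewrite e1 e2 !mdistxx maxxx.
Qed.

(** The last two hypotheses make the comparison map to the fibre product surjective and
    non-contracting, hence an isomorphism by [met_isoP]. *)
Lemma ghMor_build (T' T : tbMet R) (P' : ghOb T') (P : ghOb T)
    (b : lipMap T' T) (t : lipMap (gh_space P') (gh_space P)) :
  (forall x, gh_map P (t x) = b (gh_map P' x)) ->
  (forall y u, gh_map P y = b u -> exists x, t x = y /\ gh_map P' x = u) ->
  (forall x y, mdist x y <= Num.max (mdist (t x) (t y))
                       (mdist (gh_map P' x) (gh_map P' y))) ->
  exists m : ghMor P' P, ghm_base m = b /\ ghm_top m = t.
Proof.
move=> tb ts td; have e : lcomp (gh_map P) t = lcomp b (gh_map P').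
  exact: lipMap_eq.
suff c : exists e : lcomp (gh_map P) t = lcomp b (gh_map P'), met_iso (fp_lift e).
  by exists (GhMor c).
exists e; apply/met_isoP; split=> [[y u yu]|x x'].
  have [x [xy xu]] := ts y u yu.
  by exists x; apply: fibProd_eq.
exact: td.
Qed.

Lemma ghm_lift_map (T' T : tbMet R) (P' : ghOb T') (P : ghOb T) (m : ghMor P' P)
    (S : metricType R) (y : lipMap S (gh_space P)) (u : lipMap S T') :
  (forall s, gh_map P (y s) = ghm_base m (u s)) ->
  exists x : lipMap S (gh_space P'),
    (forall s, ghm_top m (x s) = y s) /\ forall s, gh_map P' (x s) = u s.
Proof.
move=> yu; have /choice[x xE] := fun s => ghm_lift (yu s).
suff xl s s' : mdist (x s) (x s') <= mdist s s'.
  by exists (LipMap xl); split=> s /=; have [] := xE s.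
apply: le_trans (ghm_dist m _ _) _.
have [-> ->] := xE s; have [-> ->] := xE s'.
by rewrite ge_max !lipP.
Qed.

Lemma gh_fib_compact (T : tbMet R) (P : ghOb T) (t : T) :
  compact (gh_map P @^-1` [set t]).
Proof. by have [_ [_ fc]] := gh_proper P; exact: fc. Qed.

Lemma gh_surj (T : tbMet R) (P : ghOb T) (t : T) : exists x, gh_map P x = t.
Proof. by have [[fs _] _] := gh_proper P; exact: fs. Qed.

Lemma gh_lifting (T : tbMet R) (P : ghOb T) : eps_lifting (gh_map P).
Proof. by have [s _] := gh_proper P; exact: submetry_lifting. Qed.

End GHMor.

Section Pullback.
Context {R : realType} (M Y : metricType R) (q : lipMap M Y).
Hypothesis qP : proper_submetry q.

Lemma pullback_proper (T : metricType R) (u : lipMap T Y) :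
  proper_submetry (fp_pr2 q u).
Proof.
have [qs [_ qc]] := qP; apply: proper_submetryI.
- move=> t; have [x xt] := (proj1 qs) (u t).
  by exists (FibProd xt).
- move=> [x t xt] t' e e0 /=.
  have [x' x't' xx'] := submetry_lifting qs x (u t') e0.
  exists (FibProd x't') => //; rewrite fp_mdistE /= gt_max ltrDl e0 andbT.
  by apply: lt_le_trans xx' _; rewrite lerD2r xt lipP.
- move=> t.
  apply: (@compact_lip_rel _ _ _
    (fun (x : M) (p : fibProd q u) => fp_fst p = x /\ fp_snd p = t) _ _ _ _ _ (qc (u t))).
  + by move=> x /= xt; exists (FibProd xt).
  + by move=> [x t' /= xt'] /= t't; exists x => //=; rewrite -t't.
  + move=> x x' c c' [<- ct] [<- c't]; rewrite fp_mdistE ct c't mdistxx.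
    by rewrite ge_max lexx mdist_ge0.
Qed.

Definition pull_ob (T : tbMet R) (u : lipMap T Y) : ghOb T :=
  GhOb (pullback_proper u).

End Pullback.

(** * The stack GH *)

Section MetricOf.
Context {R : realType}.

Record metric_ax (M : Type) (d : M -> M -> R) : Prop := MetricAx {
  max_xx : forall x, d x x = 0;
  max_pos : forall x y, d x y = 0 -> x = y;
  max_sym : forall x y, d x y = d y x;
  max_tri : forall y x z, d x z <= d x y + d y z }.

(** An alias of M indexed by the proof, so that the metric is found from the type alone. *)
Definition metric_of (M : Type) (d : M -> M -> R) (dP : metric_ax d) : Type := M.

Section Instances.
Context (M : Type) (d : M -> M -> R) (dP : metric_ax d).
HB.instance Definition _ := gen_eqMixin (metric_of dP).
HB.instance Definition _ := gen_choiceMixin (metric_of dP).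
HB.instance Definition _ := @isMetric.Build R (metric_of dP) d
  (max_xx dP) (max_pos dP) (max_sym dP) (max_tri dP).
End Instances.

End MetricOf.

Section GHStack.
Context {R : realType}.

Lemma gh_fibered : fibered_in_groupoids (GH R).
Proof.
split=> [T' T f P|T2 T1 T P2 P1 P m n g mg].
  have [||| m [mb _]] := @ghMor_build _ _ _ (pull_ob (gh_proper P) f) P f
      (fp_pr1 (gh_map P) f); last by exists (pull_ob (gh_proper P) f), m.
  - by move=> [x u e].
  - by move=> y u yu; exists (FibProd yu).
  - by move=> x y; rewrite fp_mdistE.
have mgE s : ghm_base m (g s) = ghm_base n s := lipMap_app mg s.
have [x [xn xg]] : exists x : lipMap (gh_space P2) (gh_space P1),
    (forall s, ghm_top m (x s) = ghm_top n s) /\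
     forall s, gh_map P1 (x s) = g (gh_map P2 s).
  by apply: (@ghm_lift_map _ _ _ _ _ m _ (ghm_top n) (lcomp g (gh_map P2))) => s /=;
     rewrite ghm_comm mgE.
have [||| k [kb kt]] := @ghMor_build _ _ _ P2 P1 g x.
- exact: xg.
- move=> y u yu; have [|z [zy zu]] := @ghm_lift _ _ _ _ _ n (ghm_top m y) u.
    by rewrite ghm_comm yu mgE.
  exists z; split => //; apply: (@ghm_inj _ _ _ _ _ m); first by rewrite xn.
  by rewrite xg zu yu.
- move=> y y'; apply: le_trans (ghm_dist n y y') _; rewrite -!xn ge_max.
  by rewrite !le_max lipP lexx orbT.
exists k; split=> [|k' [k'b mk']].
  by split=> //; apply: ghMor_eq => /=; apply: lipMap_eq => s /=;
     rewrite ?kb ?kt.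
apply: ghMor_eq; first exact: etrans kb (esym k'b).
apply: lipMap_eq => s; apply: (@ghm_inj _ _ _ _ _ m).
  by rewrite kt xn -(congr1 (fun k => ghm_top k s) mk').
by rewrite !ghm_comm kb; congr (lip_fun _ _).
Qed.

(** Gluing and descent conditions compare arrows only; arrows from objects over the one-point space
    turn them into statements about points. *)
Lemma gh_pt_fib (T : tbMet R) (P : ghOb T) (p : gh_space P) :
  exists (z : oob (GH R) (tb_pt R)) (c : omor z P) (w : gh_space z),
    [/\ ghm_base c = pt_map (gh_map P p), ghm_top c w = p & gh_map z w = tt].
Proof.
have [z [c cb]] := cart_pull gh_fibered (pt_map (gh_map P p)) P.
have cb' : ghm_base c = pt_map (gh_map P p) := cb.
have [|w [wp wt]] := @ghm_lift _ _ _ _ _ c p tt; first by rewrite cb'.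
by exists z, c, w.
Qed.

Lemma gh_pt_lift (T' T : tbMet R) (P' : ghOb T') (P : ghOb T) (m : ghMor P' P)
    (z : ghOb (tb_pt R)) (c : ghMor z P) (w : gh_space z) (r : gh_space P') :
  ghm_top m r = ghm_top c w ->
  exists k : ghMor z P', [/\ gh_comp m k = c, ghm_top k w = r &
    ghm_base k = pt_map (gh_map P' r)].
Proof.
move=> rw_; have [|k [kb mk]] := @cart_lift _ _ gh_fibered _ _ _ z P' P m c
    (pt_map (gh_map P' r)).
  apply: lipMap_eq => -[] /=; rewrite -ghm_comm rw_ ghm_comm.
  by congr (lip_fun _ _); case: (gh_map z w).
have kb' : ghm_base k = pt_map (gh_map P' r) := kb.
exists k; split=> //; apply: (@ghm_inj _ _ _ _ _ m).
  by rewrite rw_ -(congr1 (fun k => ghm_top k w) mk).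
by rewrite ghm_comm kb'.
Qed.

(** The glued map sends p to the image under [m i] of any preimage of p along [a i]. As coverings
    lift pairs of points almost isometrically, it is 1-Lipschitz and satisfies the distance bound of
    a cartesian square. *)
Lemma gh_glue : morphisms_glue (GH R).
Proof.
move=> T U [_ Ucov] x y x' a m ab mb am.
have aE i u : ghm_base (a i) u = fam_map i u by have /= -> := ab i.
have mE i u : ghm_base (m i) u = fam_map i u by have /= -> := mb i.
(* Two preimages of one point give two arrows from the same object over the one-point space, to
   which the compatibility hypothesis applies. *)
have am_pt i j z z' : ghm_top (a i) z = ghm_top (a j) z' ->
    ghm_top (m i) z = ghm_top (m j) z'.
  move=> zz'; have [z0 [c [w [_ cw _]]]] := gh_pt_fib (ghm_top (a i) z).
  have [|ki [aki kiw _]] := @gh_pt_lift _ _ _ _ (a i) z0 c w z; first by rewrite cw.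
  have [|kj [akj kjw _]] := @gh_pt_lift _ _ _ _ (a j) z0 c w z'.
    by rewrite cw.
  have /(congr1 (fun k => ghm_top k w)) /= : ocomp (m i) ki = ocomp (m j) kj.
    by apply: am; rewrite /= aki akj.
  by rewrite kiw kjw.
have alift i p u : fam_map i u = gh_map x p ->
    exists z, ghm_top (a i) z = p /\ gh_map (x' i) z = u.
  by move=> up; apply: ghm_lift; rewrite aE.
have /choice[h hE] : forall p, exists q, forall i z, ghm_top (a i) z = p ->
    ghm_top (m i) z = q.
  move=> p; have [i [u [_ [_ [[up _ _] _]]]]] :=
    Ucov (gh_map x p) (gh_map x p) (gh_map x p) 1 ltr01.
  have [z [zp _]] := alift _ _ _ up; exists (ghm_top (m i) z) => j z' z'p.
  by apply: am_pt; rewrite zp.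
have two p p' e : 0 < e -> exists i z z', [/\ ghm_top (a i) z = p,
    ghm_top (a i) z' = p' & mdist (gh_map (x' i) z) (gh_map (x' i) z') <
      mdist (gh_map x p) (gh_map x p') + e].
  move=> e0; have [i [u [u' [_ [[up u'p' _] [uu' _]]]]]] :=
    Ucov (gh_map x p) (gh_map x p') (gh_map x p') e e0.
  have [z [zp zu]] := alift _ _ _ up; have [z' [zp' zu']] := alift _ _ _ u'p'.
  by exists i, z, z'; rewrite zu zu'.
have hmap p : gh_map y (h p) = gh_map x p.
  have [i [z [_ [zp _ _]]]] := two p p 1 ltr01.
  by rewrite -(hE _ _ _ zp) -zp !ghm_comm aE mE.
have hlip p p' : mdist (h p) (h p') <= mdist p p'.
  apply/ler_addgt0Pr => e e0; have [i [z [z' [zp zp' zz']]]] := two p p' e e0.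
  rewrite -(hE _ _ _ zp) -(hE _ _ _ zp'); apply: le_trans (lipP _ _ _) _.
  apply: le_trans (ghm_dist (a i) _ _) _; rewrite zp zp' ge_max lerDl (ltW e0) /=.
  by apply: le_trans (ltW zz') _; rewrite lerD2r lipP.
have [|||k [kb kt]] := @ghMor_build _ _ _ x y (lid T) (LipMap hlip).
- exact: hmap.
- move=> q u /= qu; have [p0 p0q] := gh_surj x (gh_map y q).
  have [i [z0 [_ [z0p _ _]]]] := two p0 p0 1 ltr01.
  have [|z [zq zv]] := @ghm_lift _ _ _ _ _ (m i) q (gh_map (x' i) z0).
    by rewrite mE -aE -ghm_comm z0p p0q.
  exists (ghm_top (a i) z); split; first by rewrite -(hE _ _ _ erefl).
  by rewrite ghm_comm aE -mE -ghm_comm zq.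
- move=> p p' /=; apply/ler_addgt0Pr => e e0.
  have [i [z [z' [zp zp' zz']]]] := two p p' e e0.
  rewrite -{1}zp -{1}zp'; apply: le_trans (lipP _ _ _) _.
  apply: le_trans (ghm_dist (m i) _ _) _.
  rewrite (hE _ _ _ zp) (hE _ _ _ zp') ge_max.
  apply/andP; split; first by rewrite ler_wpDr ?(ltW e0) // le_max lexx.
  by apply: le_trans (ltW zz') _; rewrite lerD2r le_max lexx orbT.
exists k; split=> [|k' [k'b k'm]].
  split=> // i; apply: ghMor_eq => /=; apply: lipMap_eq => s /=.
    by rewrite kb aE mE.
  by rewrite kt /= -(hE _ _ _ erefl).
apply: ghMor_eq; first exact: etrans kb (esym k'b).
apply: lipMap_eq => p; rewrite kt /=.
have [i [z [_ [zp _ _]]]] := two p p 1 ltr01.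
by rewrite -(hE _ _ _ zp) -zp -(congr1 (fun k => ghm_top k z) (k'm i)).
Qed.

(** * Effective descent for proper submetries *)

Section Descent.
Context (T : tbMet R) (U : metFamily T) (Ucov : lsm_covering U)
  (D : descentDatum (GH R) U).

Let P i : ghOb (fam_dom i) := dd_ob D i.
Let dfst i j : ghMor (dd_ob2 D i j) (P i) := dd_fst D i j.
Let dsnd i j : ghMor (dd_ob2 D i j) (P j) := dd_snd D i j.

Let fstE i j r : gh_map (P i) (ghm_top (dfst i j) r) = fp_fst (gh_map _ r).
Proof. by rewrite ghm_comm; have /= -> := dd_fst_base D i j. Qed.

Let sndE i j r : gh_map (P j) (ghm_top (dsnd i j) r) = fp_snd (gh_map _ r).
Proof. by rewrite ghm_comm; have /= -> := dd_snd_base D i j. Qed.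

Definition dd_rel i (p : gh_space (P i)) j (q : gh_space (P j)) :=
  exists r, ghm_top (dfst i j) r = p /\ ghm_top (dsnd i j) r = q.

(** The cocycle condition is tested on the fibre over the base point of p. A point of T can have
    several preimages in a chart, whence the hypothesis that s and s' lie over the same one. *)
Lemma dd_rel_cocycle i p j q k s s' :
  @dd_rel i p j q -> @dd_rel j q k s -> @dd_rel i p k s' ->
  gh_map (P k) s = gh_map (P k) s' -> s = s'.
Proof.
move=> [r [rp rq]] [r' [r'q r's]] [r'' [r''p r''s']] ss'.
have [z [c [w [_ cw _]]]] := gh_pt_fib p.
have [|kij [kijc kijw kijb]] := @gh_pt_lift _ _ _ _ (dfst i j) z c w r.
  by rewrite cw.
have [|kik [kikc kikw kikb]] := @gh_pt_lift _ _ _ _ (dfst i k) z c w r''.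
  by rewrite cw.
have [|kjk [kjkc kjkw kjkb]] :=
    @gh_pt_lift _ _ _ _ (dfst j k) z (gh_comp (dsnd i j) kij) w r'.
  by rewrite /= kijw rq.
have /(congr1 (fun h => ghm_top h w)) /= :
    gh_comp (dsnd j k) kjk = gh_comp (dsnd i k) kik.
  apply: (@dd_cocycle _ _ _ _ D i j k _ z kij kjk kik).
  - exact: etrans kijc (esym kikc).
  - exact: esym kjkc.
  - rewrite !dd_snd_base /= kjkb kikb; apply: lipMap_eq => -[] /=.
    by rewrite -!sndE r's r''s'.
by rewrite kjkw kikw r's r''s'.
Qed.

Lemma dd_rel_base i p j q : @dd_rel i p j q ->
  fam_map i (gh_map (P i) p) = fam_map j (gh_map (P j) q).
Proof. by move=> [r [<- <-]]; rewrite fstE sndE; exact: fp_eq. Qed.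

Lemma dd_rel_total i p j v : fam_map i (gh_map (P i) p) = fam_map j v ->
  exists q, @dd_rel i p j q /\ gh_map (P j) q = v.
Proof.
move=> pv; have [|r [rp rv]] := @ghm_lift _ _ _ _ _ (dfst i j) p (FibProd pv).
  by have /= -> := dd_fst_base D i j.
by exists (ghm_top (dsnd i j) r); split; [exists r|rewrite sndE rv].
Qed.

Lemma dd_rel_total_l i u j q : fam_map i u = fam_map j (gh_map (P j) q) ->
  exists p, @dd_rel i p j q /\ gh_map (P i) p = u.
Proof.
move=> uq; have [|r [rq ru]] := @ghm_lift _ _ _ _ _ (dsnd i j) q (FibProd uq).
  by have /= -> := dd_snd_base D i j.
by exists (ghm_top (dfst i j) r); split; [exists r|rewrite fstE ru].
Qed.

(** Descent data come without a unit condition; it follows from the cocycle condition. With p0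
    related to p, and p to q, all over one base point, both q and p are partners of p0, hence q =
    p. *)
Lemma dd_rel_refl i p : @dd_rel i p i p.
Proof.
have [q [pq qp]] := @dd_rel_total i p i _ erefl.
have [p0 [p0p _]] := @dd_rel_total_l i _ i p erefl.
by rewrite -{2}(dd_rel_cocycle p0p pq p0p qp).
Qed.

Lemma dd_rel_fun i p j q q' : @dd_rel i p j q -> @dd_rel i p j q' ->
  gh_map (P j) q = gh_map (P j) q' -> q = q'.
Proof. exact: dd_rel_cocycle (dd_rel_refl p). Qed.

Lemma dd_rel_trans i p j q k s :
  @dd_rel i p j q -> @dd_rel j q k s -> @dd_rel i p k s.
Proof.
move=> pq qs; have [|s' [ps' s's]] := @dd_rel_total i p k (gh_map (P k) s).
  by rewrite (dd_rel_base pq) (dd_rel_base qs).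
by rewrite (dd_rel_cocycle pq qs ps' (esym s's)).
Qed.

Lemma dd_rel_sym i p j q : @dd_rel i p j q -> @dd_rel j q i p.
Proof.
move=> pq; have [|p' [qp' p'p]] := @dd_rel_total j q i (gh_map (P i) p).
  by rewrite (dd_rel_base pq).
by rewrite -(dd_rel_fun (dd_rel_trans pq qp') (dd_rel_refl p) p'p).
Qed.

(** The base of the overlap carries the maximum of the distances in the two charts, and the one in
    chart i is at most [mdist p p']. *)
Lemma dd_rel_dist i p p' j q q' : @dd_rel i p j q -> @dd_rel i p' j q' ->
  mdist q q' <= Num.max (mdist p p') (mdist (gh_map (P j) q) (gh_map (P j) q')).
Proof.
move=> [r [rp rq]] [r' [rp' rq']]; rewrite -{1}rq -{1}rq'.
apply: le_trans (lipP _ _ _) _; apply: le_trans (ghm_dist (dfst i j) _ _) _.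
rewrite rp rp' fp_mdistE -!fstE -!sndE rp rp' rq rq' !ge_max !le_max.
by rewrite !lexx !lipP /= !orbT.
Qed.

(* One chart and one lift are chosen over every point of T, so that the glued
   space needs no quotient and stays in the universe of T, whatever the
   universe of the index type of the covering. *)
Context (ix : T -> fam_idx U) (uu : forall t, fam_dom (ix t)).
Hypothesis uuE : forall t, fam_map (ix t) (uu t) = t.

Record gluePt : Type := GluePt {
  gl_t : T;
  gl_p : gh_space (P (ix gl_t));
  gl_e : gh_map (P (ix gl_t)) gl_p = uu gl_t }.

Definition gl_rel (e : gluePt) k q := @dd_rel (ix (gl_t e)) (gl_p e) k q.

Lemma gl_rel_base e k q : @gl_rel e k q -> fam_map k (gh_map (P k) q) = gl_t e.
Proof. by move=> /dd_rel_base <-; rewrite gl_e uuE. Qed.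

Lemma gl_rel_total e k v : fam_map k v = gl_t e ->
  exists q, @gl_rel e k q /\ gh_map (P k) q = v.
Proof. by move=> vt; apply: dd_rel_total; rewrite gl_e uuE. Qed.

Lemma gl_rel_total_l k q : exists e, @gl_rel e k q.
Proof.
have [|p [pq pu]] := @dd_rel_total_l _ (uu (fam_map k (gh_map (P k) q))) k q.
  by rewrite uuE.
by exists (GluePt pu).
Qed.

Lemma gl_rel_inj e e' k q : @gl_rel e k q -> @gl_rel e' k q -> e = e'.
Proof.
move=> eq e'q; have tt' := etrans (esym (gl_rel_base eq)) (gl_rel_base e'q).
case: e e' tt' eq e'q => [t p pu] [t' p' p'u] /= tt'; subst t' => pq p'q.
have pp' := dd_rel_fun (dd_rel_trans pq (dd_rel_sym p'q)) (dd_rel_refl p).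
have {}pp' : p' = p by apply: pp'; rewrite pu p'u.
by subst p'; rewrite (Prop_irrelevance pu p'u).
Qed.

Definition gl_dists (e e' : gluePt) : set R :=
  [set d | exists k q q', [/\ @gl_rel e k q, @gl_rel e' k q' & d = mdist q q']].

(** Representatives in one chart may be too far apart because their base points are; the infimum
    over all charts removes this excess. *)
Definition gl_dist e e' : R := inf (gl_dists e e').

Lemma gl_dists_lb e e' : lbound (gl_dists e e') (mdist (gl_t e) (gl_t e')).
Proof.
move=> _ [k [q [q' [eq e'q' ->]]]]; rewrite -(gl_rel_base eq) -(gl_rel_base e'q').
by apply: le_trans (lipP _ _ _) _; exact: lipP.
Qed.

(** The three-point condition of a covering, lifted to the fibres; it serves the triangle inequality
    of the glued distance. *)
Lemma gl_three e1 e2 e3 (x : R) : 0 < x -> exists k q1 q2 q3,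
  [/\ @gl_rel e1 k q1, @gl_rel e2 k q2, @gl_rel e3 k q3,
   mdist (gh_map (P k) q1) (gh_map (P k) q2) < mdist (gl_t e1) (gl_t e2) + x &
   mdist (gh_map (P k) q2) (gh_map (P k) q3) < mdist (gl_t e2) (gl_t e3) + x].
Proof.
move=> x0; have [k [v1 [v2 [v3 [[h1 h2 h3] [d12 d23]]]]]] :=
  proj2 Ucov (gl_t e1) (gl_t e2) (gl_t e3) x x0.
have [q1 [? v1E]] := gl_rel_total h1; have [q2 [? v2E]] := gl_rel_total h2.
have [q3 [? v3E]] := gl_rel_total h3.
by exists k, q1, q2, q3; rewrite v1E v2E v3E.
Qed.

Lemma gl_dists_n0 e e' : gl_dists e e' !=set0.
Proof.
have [k [q [q' [_ [eq eq' _ _ _]]]]] := gl_three e e' e' ltr01.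
by exists (mdist q q'), k, q, q'.
Qed.

Lemma gl_dist_base e e' : mdist (gl_t e) (gl_t e') <= gl_dist e e'.
Proof. exact: (lb_le_inf (gl_dists_n0 e e') (@gl_dists_lb e e')). Qed.

Lemma gl_dist_le e e' k q q' : @gl_rel e k q -> @gl_rel e' k q' ->
  gl_dist e e' <= mdist q q'.
Proof.
move=> eq eq'; apply: ge_inf; last by exists k, q, q'.
by exists (mdist (gl_t e) (gl_t e')); exact: gl_dists_lb.
Qed.

(** If the distance in chart k exceeds that of the base points there, [dd_rel_dist] bounds it by the
    distance in every other chart, hence by the infimum. *)
Lemma gl_dist_ge e e' k q q' : @gl_rel e k q -> @gl_rel e' k q' ->
  mdist q q' <= Num.max (gl_dist e e') (mdist (gh_map (P k) q) (gh_map (P k) q')).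
Proof.
move=> eq eq'; rewrite le_max orbC; case: leP => //= lt.
apply: (lb_le_inf (gl_dists_n0 e e')) => _ [j [s [s' [es es' ->]]]].
have := dd_rel_dist (dd_rel_trans (dd_rel_sym es) eq)
  (dd_rel_trans (dd_rel_sym es') eq').
by rewrite le_max leNgt orbC leNgt lt /= -leNgt.
Qed.

Lemma gl_metric_ax : metric_ax gl_dist.
Proof.
have ge0 e e' : 0 <= gl_dist e e'.
  by apply: le_trans (gl_dist_base _ _); exact: mdist_ge0.
split.
- move=> e; apply/eqP; rewrite eq_le ge0 andbT.
  by apply: le_trans (gl_dist_le (dd_rel_refl _) (dd_rel_refl _)) _; rewrite mdistxx.
- move=> e e' ee'; have tt' : gl_t e = gl_t e'.
    by apply: mdist0_eq; rewrite -ee' gl_dist_base.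
  (* Over the common base point, e' has a representative in the chart of e above the chosen lift, at
     distance at most the maximum of two zeros. *)
  have [q [e'q qp]] := @gl_rel_total e' (ix (gl_t e)) (uu (gl_t e)) (etrans (uuE _) tt').
  have pq : @dd_rel (ix (gl_t e)) (gl_p e) (ix (gl_t e)) (gl_p e) by exact: dd_rel_refl.
  have := gl_dist_ge pq e'q; rewrite ee' gl_e qp mdistxx maxxx => /mdist0_eq pE.
  by apply: (gl_rel_inj pq); rewrite pE.
- move=> e e'; congr inf; apply/seteqP; split=> d [k [q [q' [? ? ->]]]];
  by exists k, q', q; rewrite metric_sym.
- move=> e2 e1 e3; apply/ler_addgt0Pr => x x0; have x20 : 0 < x / 2 by rewrite divr_gt0.
  have [k [q1 [q2 [q3 [h1 h2 h3 d12 d23]]]]] := gl_three e1 e2 e3 x20.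
  apply: le_trans (gl_dist_le h1 h3) _; apply: le_trans (metric_triangle _ q2 _) _.
  rewrite (splitr x) addrACA; apply: lerD.
    apply: le_trans (gl_dist_ge h1 h2) _; rewrite ge_max lerDl (ltW x20) /=.
    by apply: le_trans (ltW d12) _; rewrite lerD2r gl_dist_base.
  apply: le_trans (gl_dist_ge h2 h3) _; rewrite ge_max lerDl (ltW x20) /=.
  by apply: le_trans (ltW d23) _; rewrite lerD2r gl_dist_base.
Qed.

Definition gl_space : metricType R := metric_of gl_metric_ax.

Definition gl_map : lipMap gl_space T := @LipMap _ gl_space T gl_t gl_dist_base.

(** A lift is found in a chart that lifts both base points almost isometrically. The fibre over t is
    a 1-Lipschitz image of the compact fibre over the chosen lift of t. *)
Lemma gl_proper : proper_submetry gl_map.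
Proof.
apply: proper_submetryI.
- move=> t; have [p pu] := gh_surj (P (ix t)) (uu t).
  by exists (GluePt pu : gl_space).
- move=> e t' x x0; have x20 : 0 < x / 2 by rewrite divr_gt0.
  have [k [v [v' [_ [[vt vt' _] [vv' _]]]]]] := proj2 Ucov (gl_t e) t' t' _ x20.
  have [q [eq qv]] := gl_rel_total vt.
  have [q' q'v' qq'] := gh_lifting q v' x20.
  have [e' e'q'] := gl_rel_total_l q'.
  exists e'; first by rewrite /= -(gl_rel_base e'q') q'v'.
  apply: le_lt_trans (gl_dist_le eq e'q') _; apply: lt_trans qq' _.
  by rewrite qv [in ltRHS](splitr x) addrA ltrD2r.
- move=> t; refine (@compact_lip_rel R (gh_space (P (ix t))) gl_space
    (fun p e => @gl_rel e (ix t) p) (gh_map (P (ix t)) @^-1` [set uu t]) _ _ _ _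
    (@gh_fib_compact _ _ (P (ix t)) (uu t))).
  + move=> p pu; have pu' : gh_map (P (ix t)) p = uu t := pu.
    by exists (GluePt pu') => //; exact: dd_rel_refl.
  + move=> [t' p pu] /= t't; subst t'; exists p => //; exact: dd_rel_refl.
  + by move=> p p' e e' ep ep'; exact: (gl_dist_le ep ep').
Qed.

Definition gl_ob : ghOb T := GhOb gl_proper.

Lemma gl_chart k : exists a : ghMor (P k) gl_ob,
  ghm_base a = fam_map k /\ forall q, @gl_rel (ghm_top a q) k q.
Proof.
have /choice[a aE] := @gl_rel_total_l k.
have al q q' : gl_dist (a q) (a q') <= mdist q q'.
  exact: gl_dist_le (aE _) (aE _).
have [|||h [hb ht]] := @ghMor_build _ _ _ (P k) gl_ob (fam_map k)
    (@LipMap _ (gh_space (P k)) gl_space a al).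
- by move=> q; rewrite /= (gl_rel_base (aE q)).
- move=> e v /= ev; have [q [eq qv]] := gl_rel_total (esym ev).
  by exists q; split=> //; exact: gl_rel_inj (aE q) eq.
- by move=> q q'; exact: gl_dist_ge (aE q) (aE q').
by exists h; rewrite ht.
Qed.

Lemma gl_effective : effective D.
Proof.
have /dep_choice[a aE] := gl_chart.
exists gl_ob, a; split=> [i|i j]; first by have [] := aE i.
have [ib ir] := aE i; have [jb jr] := aE j.
apply: ghMor_eq; apply: lipMap_eq => r /=.
  rewrite ib jb; have /= -> := dd_fst_base D i j; have /= -> := dd_snd_base D i j.
  exact: fp_eq.
apply: (gl_rel_inj _ (jr _)); apply: dd_rel_trans (ir _) _.
by exists r.
Qed.

End Descent.

Lemma gh_stack : is_stack (GH R).
Proof.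
split; [exact: gh_fibered|exact: gh_glue|move=> T U Ucov D].
have /choice[ix ixE] : forall t : T, exists i : fam_idx U,
    exists u : fam_dom i, fam_map i u = t.
  by move=> t; have [i [u [_ [_ [[ut _ _] _]]]]] := proj2 Ucov t t t 1 ltr01;
     exists i, u.
pose uu t := sval (cid (ixE t)).
exact: (gl_effective Ucov D (fun t => svalP (cid (ixE t)))).
Qed.

End GHStack.

(** * Classifying functors *)

Section Classifier.
Context {R : realType}.

(* A classifier exhibits P, up to equivalence over X, as the stack of pairs of
   an object x of X and a section of F x: it attaches to every object of P its
   section, and compares arrows. *)
Record classifier (X P : overCat R) (F : overFun X (GH R)) (p : overFun P X) :=
  Classifier {
  cls_sec : forall T (z : oob P T), lipMap T (gh_space (F T (p T z)));
  cls_secK : forall T (z : oob P T) t, gh_map (F T (p T z)) (cls_sec z t) = t;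
  cls_nat : forall T' T (z' : oob P T') (z : oob P T) (k : omor z' z) t,
    ghm_top (fmor F (fmor p k)) (cls_sec z' t) = cls_sec z (obase k t);
  cls_surj : forall T (x : oob X T) (y : lipMap T (gh_space (F T x))),
    (forall t, gh_map (F T x) (y t) = t) ->
    exists (z : oob P T) (m : omor (p T z) x), obase m = lid T /\
      forall t, ghm_top (fmor F m) (cls_sec z t) = y t;
  cls_full : forall T' T (z' : oob P T') (z : oob P T) (n : omor (p T' z') (p T z)),
    (forall t, ghm_top (fmor F n) (cls_sec z' t) = cls_sec z (obase n t)) ->
    exists k : omor z' z, fmor p k = n;
  cls_faith : forall T' T (z' : oob P T') (z : oob P T) (k k' : omor z' z),
    fmor p k = fmor p k' -> k = k' }.

Lemma ghm_base_fmor (X : overCat R) (F : overFun X (GH R)) T' T (x' : oob X T')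
  (x : oob X T) (m : omor x' x) : ghm_base (fmor F m) = obase m.
Proof. exact: (fmor_base F m). Qed.

Lemma ghm_top_fmor (X : overCat R) (F : overFun X (GH R)) T2 T1 T (x2 : oob X T2)
    (x1 : oob X T1) (x : oob X T) (m : omor x1 x) (n : omor x2 x1) y :
  ghm_top (fmor F (ocomp m n)) y = ghm_top (fmor F m) (ghm_top (fmor F n) y).
Proof. by rewrite fmor_comp. Qed.

Lemma ghm_top_fmor_id (X : overCat R) (F : overFun X (GH R)) T (x : oob X T) y :
  ghm_top (fmor F (oid x)) y = y.
Proof. by rewrite fmor_id. Qed.

Section Theory.
Context (X P : overCat R) (F : overFun X (GH R)) (p : overFun P X).
Context (fX : fibered_in_groupoids X) (c : classifier F p).

Let s T (z : oob P T) := cls_sec c z.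

(** Pulling x back along the base map of y turns y into a section, and sections come from objects of
    P. *)
Lemma cls_points T (x : oob X T) S (y : lipMap (tb_sort S) (gh_space (F T x))) :
  exists (z : oob P S) (n : omor (p S z) x),
    obase n = lcomp (gh_map (F T x)) y /\
    forall t, ghm_top (fmor F n) (s z t) = y t.
Proof.
have [x' [k kb]] := cart_pull fX (lcomp (gh_map (F T x)) y) x.
have [|y' [ky' y't]] := @ghm_lift_map _ _ _ _ _ (fmor F k) _ y (lid S).
  by move=> t; rewrite ghm_base_fmor kb.
have [z [m [mb my]]] := cls_surj c y't.
exists z, (ocomp k m); split=> [|t]; first by rewrite obase_comp kb mb lcomp_id_r.
by rewrite ghm_top_fmor my ky'.
Qed.

Lemma cls_hom T0 T' T (x : oob X T0) (z' : oob P T') (z : oob P T)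
    (n' : omor (p T' z') x) (n : omor (p T z) x) (f : lipMap T' T) :
  lcomp (obase n) f = obase n' ->
  (forall t, ghm_top (fmor F n') (s z' t) = ghm_top (fmor F n) (s z (f t))) ->
  exists k : omor z' z, obase k = f /\ ocomp n (fmor p k) = n'.
Proof.
move=> nf ns; have [m [mb nm]] := cart_lift fX nf.
have [|k kP] := @cls_full _ _ _ _ c _ _ z' z m.
  move=> t; apply: (@ghm_inj _ _ _ _ _ (fmor F n)).
    by rewrite -ghm_top_fmor nm ns mb.
  by rewrite ghm_comm !cls_secK ghm_base_fmor.
by exists k; rewrite kP; split=> //; rewrite -mb -kP fmor_base.
Qed.

Lemma cls_fibered : fibered_in_groupoids P.
Proof.
split=> [T' T f z|T2 T1 T z2 z1 z m n g mg].
  have [z' [n [nb ns]]] := @cls_points _ (p T z) T' (lcomp (s z) f).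
  have [||k [kb _]] := @cls_hom _ _ _ (p T z) z' z n (oid _) f; last by exists z', k.
    rewrite obase_id nb; apply: lipMap_eq => t /=.
    by rewrite cls_secK.
  by move=> t; rewrite ghm_top_fmor_id ns.
have [||k [kb kP]] := @cls_hom _ _ _ (p T z) z2 z1 (fmor p n) (fmor p m) g.
- by rewrite !fmor_base.
- by move=> t; rewrite !cls_nat -(lipMap_app mg).
exists k; split=> [|k' [k'b k'm]].
  by split=> //; apply: (cls_faith c); rewrite fmor_comp.
apply: (cls_faith c); apply: (cart_uniq fX (m := fmor p m)).
  by rewrite !fmor_base kb k'b.
by rewrite kP -fmor_comp k'm.
Qed.

End Theory.

Section Lifting.
Context (X P : overCat R) (p : overFun P X).
Context (fX : fibered_in_groupoids X) (fP : fibered_in_groupoids P).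

Lemma fun_lift T T1 T2 (z : oob P T) (z1 : oob P T1) (z2 : oob P T2)
    (a : omor z1 z) (q : omor z2 z) (n : omor (p T2 z2) (p T1 z1)) :
  ocomp (fmor p a) n = fmor p q ->
  exists l : omor z2 z1, fmor p l = n /\ ocomp a l = q.
Proof.
move=> an; have [|l [lb al]] := @cart_lift _ _ fP _ _ _ z2 z1 z a q (obase n).
  by rewrite -(fmor_base p a) -obase_comp an fmor_base.
exists l; split=> //; apply: (cart_uniq fX (m := fmor p a)).
  by rewrite fmor_base.
by rewrite an -fmor_comp al.
Qed.

(** An arrow of X into [p T z] comes from P after composition with an isomorphism e, which may be
    cancelled. Conditions tested on arrows of X thus reduce to arrows of P. *)
Lemma fun_lift_ob T V (z : oob P T) (w : oob X V) (u : omor w (p T z)) :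
  exists (z0 : oob P V) (k : omor z0 z) (e : omor (p V z0) w),
    [/\ obase e = lid V, fmor p k = ocomp u e &
      forall S (y : oob X S) (f g : omor w y), ocomp f e = ocomp g e -> f = g].
Proof.
have [z0 [k kb]] := cart_pull fP (obase u) z.
have [|e [eb ue]] := @cart_lift _ _ fX _ _ _ (p V z0) w _ u (fmor p k) (lid V).
  by rewrite fmor_base kb lcomp_id_r.
by exists z0, k, e; split=> // S y f g; exact: iso_epi.
Qed.

End Lifting.

(** * The stack conditions for a classified category *)

Section ClsStack.
Context (X P : overCat R) (F : overFun X (GH R)) (p : overFun P X).
Context (sX : is_stack X) (c : classifier F p).

Let fX : fibered_in_groupoids X. Proof. by case: sX. Qed.
Let fP : fibered_in_groupoids P. Proof. exact: cls_fibered c. Qed.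
Let s T (z : oob P T) := cls_sec c z.

Lemma cls_glue : morphisms_glue P.
Proof.
move=> T U Ucov z1 z2 z' a m ab mb am.
have [_ gX _] := sX.
have [|||h []] := gX T U Ucov (p T z1) (p T z2) (fun i => p _ (z' i))
    (fun i => fmor p (a i)) (fun i => fmor p (m i)).
- by move=> i; rewrite fmor_base.
- by move=> i; rewrite fmor_base.
- move=> i j V w u v auv; have [z0 [k [e [eb ku epi]]]] := fun_lift_ob fX fP u.
  have [|l [lv al]] := fun_lift fX fP (a := a j) (q := ocomp (a i) k) (n := ocomp v e).
    by rewrite fmor_comp ku !ocomp_assoc auv.
  have := am i j V z0 k l (esym al).
  move=> /(congr1 (fun k => fmor p k)); rewrite !fmor_comp ku lv !ocomp_assoc.
  exact: epi.
move=> [hb ha] hU.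
(* The arrow glued in X respects the sections, since every point of T lies in the image of a chart,
   and the arrows of P respect them there. *)
have hs t : ghm_top (fmor F h) (s z1 t) = s z2 (obase h t).
  have [i [u [_ [_ [[ut _ _] _]]]]] := proj2 Ucov t t t 1 ltr01.
  rewrite hb -{1}ut -ab -cls_nat -ghm_top_fmor ha cls_nat.
  by congr (lip_fun _ _); rewrite mb ut.
have [k kh] := cls_full hs.
have kb : obase k = lid T by rewrite -(fmor_base p) kh.
exists k; split=> [|k' [k'b k'm]].
  by split=> // i; apply: (cls_faith c); rewrite fmor_comp kh ha.
apply: (cls_faith c); rewrite kh; apply: hU; rewrite fmor_base.
by split=> // i; rewrite -fmor_comp k'm.
Qed.

Program Definition map_descent T (U : metFamily T) (D : descentDatum P U) :
  descentDatum X U :=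
  {| dd_ob := fun i => p _ (dd_ob D i);
     dd_ob2 := fun i j => p _ (dd_ob2 D i j);
     dd_fst := fun i j => fmor p (dd_fst D i j);
     dd_snd := fun i j => fmor p (dd_snd D i j) |}.
Next Obligation. by move=> T U D i j; rewrite /= fmor_base dd_fst_base. Qed.
Next Obligation. by move=> T U D i j; rewrite /= fmor_base dd_snd_base. Qed.
Next Obligation.
move=> T U D i j k V w u v r /= uw uv vr.
have [z0 [l [e [eb lu epi]]]] := fun_lift_ob fX fP u.
have [|l1 [l1r r1]] := fun_lift fX fP (a := dd_fst D i k)
    (q := ocomp (dd_fst D i j) l) (n := ocomp r e).
  by rewrite fmor_comp lu !ocomp_assoc uw.
have [|l2 [l2v v2]] := fun_lift fX fP (a := dd_fst D j k)
    (q := ocomp (dd_snd D i j) l) (n := ocomp v e).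
  by rewrite fmor_comp lu !ocomp_assoc uv.
apply: epi; rewrite -!ocomp_assoc -l1r -l2v -!fmor_comp; congr (fmor p _).
apply: (dd_cocycle (u := l)) => //.
rewrite -(fmor_base p l1) -(fmor_base p l2) l1r l2v !obase_comp eb !lcomp_id_r.
by rewrite !fmor_base in vr.
Qed.

(** Descent in X glues the underlying objects to x. The sections glue to one of F x, which is
    1-Lipschitz because pairs of points lift almost isometrically; an object of P with this section
    is the glued object. *)
Lemma cls_effective T (U : metFamily T) : lsm_covering U ->
  forall D : descentDatum P U, effective D.
Proof.
move=> Ucov D; have [_ _ eX] := sX.
have [x [a [ab aD]]] := eX T U Ucov (map_descent D).
have aE i j u v : fam_map i u = fam_map j v ->
    ghm_top (fmor F (a i)) (s (dd_ob D i) u) =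
    ghm_top (fmor F (a j)) (s (dd_ob D j) v).
  move=> uv; pose r := FibProd uv : tb_fibProd (fam_map i) (fam_map j).
  have <- : obase (dd_fst D i j) r = u by rewrite dd_fst_base.
  have <- : obase (dd_snd D i j) r = v by rewrite dd_snd_base.
  rewrite -!cls_nat -!ghm_top_fmor.
  by have /= -> := aD i j.
have /choice[y yE] : forall t, exists y : gh_space (F T x),
    forall i u, fam_map i u = t -> ghm_top (fmor F (a i)) (s (dd_ob D i) u) = y.
  move=> t; have [i [u [_ [_ [[ut _ _] _]]]]] := proj2 Ucov t t t 1 ltr01.
  exists (ghm_top (fmor F (a i)) (s (dd_ob D i) u)) => j v vt.
  by apply: aE; rewrite ut.
have yl t t' : mdist (y t) (y t') <= mdist t t'.
  apply/ler_addgt0Pr => e e0.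
  have [i [u [u' [_ [[ut u't' _] [uu' _]]]]]] := proj2 Ucov t t' t' e e0.
  rewrite -(yE _ _ _ ut) -(yE _ _ _ u't'); apply: le_trans (lipP _ _ _) _.
  by apply: le_trans (lipP _ _ _) _; exact: ltW.
have [|z [m [mb my]]] := @cls_surj _ _ _ _ c T x (LipMap yl).
  move=> t /=; have [i [u [_ [_ [[ut _ _] _]]]]] := proj2 Ucov t t t 1 ltr01.
  by rewrite -(yE _ _ _ ut) ghm_comm cls_secK ghm_base_fmor ab.
have /dep_choice[b bE] : forall i, exists b : omor (dd_ob D i) z,
    obase b = fam_map i /\ ocomp m (fmor p b) = a i.
  move=> i; apply: (cls_hom fX (c := c)) => [|t].
    by rewrite mb ab lcomp_id_l.
  by rewrite my /=; exact: yE.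
exists z, b; split=> [i|i j]; first by have [] := bE i.
have [bi bai] := bE i; have [bj baj] := bE j.
apply: (cls_faith c); apply: (cart_uniq fX (m := m)).
  rewrite !fmor_comp !obase_comp !fmor_base bi bj dd_fst_base dd_snd_base.
  by apply: lipMap_eq => -[].
by rewrite !fmor_comp !ocomp_assoc bai baj; exact: aD.
Qed.

Lemma cls_stack : is_stack P.
Proof. by split; [exact: fP|exact: cls_glue|exact: cls_effective]. Qed.

End ClsStack.

(** * The pullback of the universal object *)

Section Tautological.
Context (X : overCat R) (F : overFun X (GH R)).

(** The section stored in z belongs to [f2_snd z]; the cell over the identity carries it back to
    F. *)
Lemma pb_sec_ex T (z : oob (fib2 F (gh_p0 R)) T) :
  exists y : lipMap T (gh_space (F T (f2_fst z))),
    (forall t, ghm_top (f2_cell z) (y t) = gh1_sec (f2_snd z) t) /\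
    forall t, gh_map (F T (f2_fst z)) (y t) = t.
Proof.
apply: (@ghm_lift_map _ _ _ _ _ (f2_cell z) _ (gh1_sec (f2_snd z)) (lid T)) => t.
by have /= -> := f2_cell_base z; exact: (lipMap_app (gh1_secP (f2_snd z))).
Qed.

Definition pb_sec T (z : oob (fib2 F (gh_p0 R)) T) := sval (cid (pb_sec_ex z)).

Lemma pb_secE T (z : oob (fib2 F (gh_p0 R)) T) t :
  ghm_top (f2_cell z) (@pb_sec T z t) = gh1_sec (f2_snd z) t.
Proof. by have [] := svalP (cid (pb_sec_ex z)). Qed.

Lemma pb_secK T (z : oob (fib2 F (gh_p0 R)) T) t : gh_map (F T (f2_fst z)) (@pb_sec T z t) = t.
Proof. by have [] := svalP (cid (pb_sec_ex z)). Qed.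

Lemma pb_classifier : classifier F (gh_pullback F).
Proof.
apply: (@Classifier _ _ F (gh_pullback F) pb_sec pb_secK).
- move=> T' T z' z k t /=; apply: (@ghm_inj _ _ _ _ _ (f2_cell z)).
    have /(congr1 (fun h => ghm_top h (pb_sec z' t))) /= := f2m_comm k.
    move=> ->; rewrite !pb_secE; have /= := lipMap_app (svalP (f2m_snd k)) t.
    by move=> ->; rewrite f2m_base.
  by rewrite ghm_comm !pb_secK ghm_base_fmor.
- move=> T x y yt; have ys : lcomp (gh_map (F T x)) y = lid T by exact: lipMap_eq.
  pose z : oob (fib2 F (gh_p0 R)) T :=
    @Fib2Ob _ _ _ _ F (gh_p0 R) T x (Gh1Ob ys) (oid (F T x)) (obase_id _).
  exists z, (oid x); split=> [|t]; first exact: obase_id.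
  by rewrite ghm_top_fmor_id; exact: (pb_secE z t).
- move=> T' T z' z n ns.
  have [ci [cib _ cci]] := cart_inv gh_fibered (f2_cell_base z').
  (* The second component of the required arrow is forced: it is F n conjugated by the two cells. *)
  pose m2 : ghMor _ _ := gh_comp (gh_comp (f2_cell z) (fmor F n)) ci.
  have m2b : ghm_base m2 = obase n.
    rewrite /m2 /= ghm_base_fmor; have /= -> := f2_cell_base z.
    by have /= -> := cib; apply: lipMap_eq.
  have m2c : ocomp (f2_cell z) (fmor F n) = ocomp (m2 : omor (_ : oob (GH R) _) _) (f2_cell z').
    by rewrite -[RHS]ocomp_assoc cci ocomp_idr.
  have m2s : lcomp (ghm_top m2) (gh1_sec (f2_snd z')) =
      lcomp (gh1_sec (f2_snd z)) (ghm_base m2).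
    apply: lipMap_eq => t; rewrite m2b /= -pb_secE -pb_secE.
    by have /(congr1 (fun h => ghm_top h (pb_sec z' t))) /= <- := m2c; rewrite ns.
  unshelve eexists; first exact: (@Fib2Mor _ _ _ _ F (gh_p0 R) _ _ z' z n
    (exist _ m2 m2s) (esym m2b) m2c).
  by [].
- move=> T' T z' z k k' kk'; apply: fib2Mor_eq => //; apply: gh1Mor_eq.
  apply: (iso_epi gh_fibered (f2_cell_base z')).
  have /= <- := f2m_comm k; have /= <- := f2m_comm k'.
  by congr (gh_comp _ (fmor F _)).
Qed.

End Tautological.

End Classifier.

(** * Equivalence of stacks with the same classifying functor *)

Section ClsEquivalence.
Context {R : realType} (X P P' : overCat R) (F : overFun X (GH R)).
Context (p : overFun P X) (p' : overFun P' X) (fX : fibered_in_groupoids X).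
Context (c : classifier F p) (c' : classifier F p').

Lemma cls_transfer_ex T (z : oob P T) :
  exists zm : {z' : oob P' T & omor (p' T z') (p T z)},
    obase (projT2 zm) = lid T /\
    forall t, ghm_top (fmor F (projT2 zm)) (cls_sec c' (projT1 zm) t) = cls_sec c z t.
Proof.
have [z' [m [mb ms]]] := cls_surj c' (cls_secK c z).
by exists (existT _ z' m).
Qed.

Let ob T (z : oob P T) := projT1 (sval (cid (cls_transfer_ex z))).
Let cell T (z : oob P T) : omor (p' T (ob z)) (p T z) :=
  projT2 (sval (cid (cls_transfer_ex z))).
Let cell_base T (z : oob P T) : obase (cell z) = lid T.
Proof. by have [] := svalP (cid (cls_transfer_ex z)). Qed.
Let cell_sec T (z : oob P T) t :
  ghm_top (fmor F (cell z)) (cls_sec c' (ob z) t) = cls_sec c z t.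
Proof. by have [_] := svalP (cid (cls_transfer_ex z)); apply. Qed.

Lemma cls_transfer_mor_ex T' T (z' : oob P T') (z : oob P T) (k : omor z' z) :
  exists k' : omor (ob z') (ob z),
    ocomp (cell z) (fmor p' k') = ocomp (fmor p k) (cell z').
Proof.
have [||k' [_ k'E]] := @cls_hom _ _ _ _ _ fX c' _ _ _ _ (ob z') (ob z)
  (ocomp (fmor p k) (cell z')) (cell z) (obase k); last by exists k'.
- by rewrite obase_comp fmor_base !cell_base lcomp_id_l lcomp_id_r.
- by move=> t; rewrite ghm_top_fmor !cell_sec cls_nat.
Qed.

Let mor T' T (z' : oob P T') (z : oob P T) (k : omor z' z) :=
  sval (cid (cls_transfer_mor_ex k)).
Let morE T' T (z' : oob P T') (z : oob P T) (k : omor z' z) :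
  ocomp (cell z) (fmor p' (mor k)) = ocomp (fmor p k) (cell z').
Proof. exact: svalP (cid (cls_transfer_mor_ex k)). Qed.

Lemma cls_transfer_mono T' T (z' : oob P' T') (z : oob P T) (k k' : omor z' (ob z)) :
  ocomp (cell z) (fmor p' k) = ocomp (cell z) (fmor p' k') -> k = k'.
Proof.
move=> kk'; apply: (cls_faith c'); apply: (cart_uniq fX (m := cell z)) => //.
move: (congr1 (@obase _ _ _ _ _ _) kk').
by rewrite !obase_comp cell_base !lcomp_id_l.
Qed.

(** An object goes to one with the same section; arrows follow by [cls_hom], and functoriality by
    [cls_transfer_mono]. *)
Lemma cls_transfer : exists (E : overFun P P') (a : twoCell (fcomp p' E) p),
  forall T z t, ghm_top (fmor F (a T z)) (cls_sec c' (E T z) t) = cls_sec c z t.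
Proof.
have mb T' T (z' : oob P T') (z : oob P T) (k : omor z' z) : obase (mor k) = obase k.
  move: (congr1 (@obase _ _ _ _ _ _) (morE k)).
  by rewrite !obase_comp !fmor_base !cell_base lcomp_id_l lcomp_id_r.
have mi T (z : oob P T) : mor (oid z) = oid (ob z).
  by apply: cls_transfer_mono; rewrite morE !fmor_id ocomp_idl ocomp_idr.
have mc T2 T1 T (z2 : oob P T2) (z1 : oob P T1) (z : oob P T)
    (k : omor z1 z) (l : omor z2 z1) : mor (ocomp k l) = ocomp (mor k) (mor l).
  apply: cls_transfer_mono; rewrite morE !fmor_comp ocomp_assoc morE -ocomp_assoc.
  by rewrite -ocomp_assoc morE.
pose E : overFun P P' := @OverFun _ P P' ob mor mb mi mc.
by exists E, (@TwoCell _ _ _ (fcomp p' E) p cell cell_base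
  (fun T' T z' z k => morE k)) => T z t; exact: cell_sec.
Qed.

End ClsEquivalence.

Section ClsEquivalence2.
Context {R : realType} (X : overCat R) (F : overFun X (GH R)).
Context (fX : fibered_in_groupoids X).

(** The round trip keeps the section of z, so the composite of the two cells comes from an arrow of
    P. *)
Lemma cls_unit (P P' : overCat R) (p : overFun P X) (p' : overFun P' X)
    (c : classifier F p) (c' : classifier F p')
    (E : overFun P P') (a : twoCell (fcomp p' E) p)
    (E' : overFun P' P) (a' : twoCell (fcomp p E') p') :
  (forall T z t, ghm_top (fmor F (a T z)) (cls_sec c' (E T z) t) = cls_sec c z t) ->
  (forall T z t, ghm_top (fmor F (a' T z)) (cls_sec c (E' T z) t) = cls_sec c' z t) ->
  two_isomorphic (fcomp E' E) (fid P).
Proof.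
move=> aE a'E.
have dE T (z : oob P T) : exists d : omor (E' T (E T z)) z,
    fmor p d = ocomp (a T z) (a' T (E T z)).
  apply: (cls_full (c := c)) => t; rewrite ghm_top_fmor a'E aE.
  by rewrite obase_comp tc_base; have /= -> := tc_base a' (E T z).
pose d T z := sval (cid (dE T z)).
have dp T z : fmor p (d T z) = ocomp (a T z) (a' T (E T z)) := svalP (cid (dE T z)).
have db T z : obase (d T z) = lid T.
  rewrite -(fmor_base p) dp obase_comp tc_base; have /= -> := tc_base a' (E T z).
  exact: lipMap_eq.
constructor; apply: (@TwoCell _ _ _ (fcomp E' E) (fid P) d db) => T' T z' z k /=.
apply: (cls_faith c); rewrite !fmor_comp !dp.
rewrite -ocomp_assoc; have /= -> := tc_nat a' (fmor E k).
by rewrite !ocomp_assoc; have /= -> := tc_nat a k.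
Qed.

Lemma cls_equivalent (P P' : overCat R) (p : overFun P X) (p' : overFun P' X) :
  classifier F p -> classifier F p' -> equivalent_over p p'.
Proof.
move=> c c'; have [E [a aE]] := cls_transfer fX c c'.
have [E' [a' a'E]] := cls_transfer fX c' c.
exists E, E'; split; first by split.
- exact: (cls_unit a'E aE).
- exact: (cls_unit aE a'E).
Qed.

End ClsEquivalence2.

(** * Recovering the fibres from test objects *)

Section Presentation.
Context {R : realType} (X P : overCat R) (p : overFun P X).

(* The points of M over T, parametrised by test spaces, are the objects of P
   over x up to isomorphism. *)
Record presentation (T : tbMet R) (x : oob X T) (M : ghOb T) := Presentation {
  ev : forall (S : tbMet R) (z : oob P S) (n : omor (p S z) x),
    lipMap S (gh_space M);
  ev_base : forall S (z : oob P S) (n : omor (p S z) x) t,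
    gh_map M (ev n t) = obase n t;
  ev_nat : forall S' S (z' : oob P S') (z : oob P S) (n : omor (p S z) x)
    (k : omor z' z) t, ev (ocomp n (fmor p k)) t = ev n (obase k t);
  ev_surj : forall S (y : lipMap (tb_sort S) (gh_space M)),
    exists (z : oob P S) (n : omor (p S z) x), forall t, ev n t = y t;
  ev_full : forall S' S (z' : oob P S') (z : oob P S) (n' : omor (p S' z') x)
    (n : omor (p S z) x) (f : lipMap S' S), (forall t, ev n' t = ev n (f t)) ->
    exists k : omor z' z, obase k = f /\ ocomp n (fmor p k) = n';
  ev_faith : forall S' S (z' : oob P S') (z : oob P S) (n : omor (p S z) x)
    (k k' : omor z' z), obase k = obase k' ->
    ocomp n (fmor p k) = ocomp n (fmor p k') -> k = k' }.

Context (fX : fibered_in_groupoids X) (fP : fibered_in_groupoids P).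

Section PresMap.
Context (T' T : tbMet R) (x' : oob X T') (x : oob X T) (m : omor x' x).
Context (M' : ghOb T') (M : ghOb T).
Context (e' : presentation x' M') (e : presentation x M).

Lemma ev_point (y : gh_space M') : exists (z : oob P (tb_pt R))
  (n : omor (p _ z) x'), ev e' n tt = y.
Proof. by have [z [n nE]] := ev_surj e' (pt_map y); exists z, n; rewrite nE. Qed.

(** Both test objects are restricted to the one-point space, where [ev_full] compares them by an
    arrow of P; evaluation over x is natural in that arrow. *)
Lemma ev_wd S1 S2 (z1 : oob P S1) (z2 : oob P S2) (n1 : omor (p S1 z1) x')
    (n2 : omor (p S2 z2) x') u1 u2 :
  ev e' n1 u1 = ev e' n2 u2 -> ev e (ocomp m n1) u1 = ev e (ocomp m n2) u2.
Proof.
move=> uu; have [w1 [k1 k1b]] := cart_pull fP (pt_map u1) z1.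
have [w2 [k2 k2b]] := cart_pull fP (pt_map u2) z2.
have [t|l [lb lE]] := @ev_full _ _ _ e' _ _ w1 w2 (ocomp n1 (fmor p k1))
    (ocomp n2 (fmor p k2)) (lid _).
  by rewrite !ev_nat k1b k2b.
have -> : u1 = obase k1 tt by rewrite k1b.
have -> : u2 = obase k2 tt by rewrite k2b.
rewrite -!ev_nat -!ocomp_assoc -lE.
by rewrite [ocomp m _]ocomp_assoc [ocomp m _]ocomp_assoc ev_nat lb -!ocomp_assoc.
Qed.

(* Test objects over the point define the map, and test objects over the
   two-point spaces 2_r control distances. *)
Lemma pres_map : exists h : ghMor M' M, ghm_base h = obase m /\
  forall S (z : oob P S) (n : omor (p S z) x') t,
    ghm_top h (ev e' n t) = ev e (ocomp m n) t.
Proof.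
have /choice[h hE] : forall y, exists v, forall S (z : oob P S)
    (n : omor (p S z) x') t, ev e' n t = y -> ev e (ocomp m n) t = v.
  move=> y; have [z0 [n0 n0y]] := ev_point y.
  exists (ev e (ocomp m n0) tt) => S z n t nty.
  by apply: ev_wd; rewrite nty.
have hl y1 y2 : mdist (h y1) (h y2) <= mdist y1 y2.
  have [y12|] := leP (mdist y1 y2) 0.
    by rewrite (mdist0_eq y12) !mdistxx.
  move=> r0; pose r := PosNum r0.
  have [z [n nE]] := ev_surj e' (@two_map _ _ r y1 y2 (lexx _)).
  rewrite -(hE y1 _ _ n false) ?nE // -(hE y2 _ _ n true) ?nE //.
  exact: lipP.
have hb y : gh_map M (h y) = obase m (gh_map M' y).
  have [z0 [n0 n0y]] := ev_point y.
  by rewrite -(hE _ _ _ _ _ n0y) ev_base obase_comp /= -n0y ev_base.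
(* Equal images are compared by an arrow l of P over x; as m is cartesian and the base points agree,
   l is compatible with n1 and n2 already over x'. *)
have hinj y1 y2 : h y1 = h y2 -> gh_map M' y1 = gh_map M' y2 -> y1 = y2.
  have [z1 [n1 n1y]] := ev_point y1; have [z2 [n2 n2y]] := ev_point y2.
  rewrite -(hE _ _ _ _ _ n1y) -(hE _ _ _ _ _ n2y) -n1y -n2y !ev_base => hh bb.
  have [|l [lb lE]] := @ev_full _ _ _ e _ _ z1 z2 (ocomp m n1) (ocomp m n2) (lid _).
    by case.
  suff <- : ocomp n2 (fmor p l) = n1 by rewrite ev_nat lb.
  apply: (cart_uniq fX (m := m)); last by rewrite ocomp_assoc.
  by rewrite obase_comp fmor_base lb; apply: lipMap_eq => -[].
have [|||k [kb kt]] := @ghMor_build _ _ _ M' M (obase m) (LipMap hl).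
- exact: hb.
- move=> y v yv; have [z [n nE]] := ev_surj e (pt_map y).
  have [|n' [n'b mn']] := @cart_lift _ _ fX _ _ _ (p _ z) x' x m n (pt_map v).
    by apply: lipMap_eq => t /=; rewrite -yv -(ev_base e) nE.
  exists (ev e' n' tt); split; last by rewrite ev_base n'b.
  by rewrite /= -(hE _ _ _ n' tt erefl) mn' nE.
(* The pair of images is realised by a test object over 2_r, with r the maximum; m lifts it to x',
   where it evaluates to y1 and y2. The case r0 = 0 is apart because 2_r requires r > 0. *)
- move=> y1 y2 /=; set r0 := Num.max _ _.
  have [r00|r_gt0] := leP r0 0.
    move: r00; rewrite ge_max => /andP[/mdist0_eq h1 /mdist0_eq h2].
    by rewrite (hinj _ _ h1 h2) mdistxx /r0 le_max mdist_ge0.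
  pose r := PosNum r_gt0.
  have ar : mdist (h y1) (h y2) <= r%:num by rewrite /= /r0 le_max lexx.
  have br : mdist (gh_map M' y1) (gh_map M' y2) <= r%:num.
    by rewrite /= /r0 le_max lexx orbT.
  have [z [n nE]] := ev_surj e (two_map ar).
  have [|n' [n'b mn']] := @cart_lift _ _ fX _ _ _ (p _ z) x' x m n (two_map br).
    by apply: lipMap_eq => t /=; rewrite -(ev_base e) nE /=; case: t; rewrite /= hb.
  have -> : y1 = ev e' n' false.
    apply: hinj; last by rewrite ev_base n'b.
    by rewrite -(hE _ _ _ n' false erefl) mn' nE.
  have -> : y2 = ev e' n' true.
    apply: hinj; last by rewrite ev_base n'b.
    by rewrite -(hE _ _ _ n' true erefl) mn' nE.
  exact: lipP.
exists k; split=> // S z n t; rewrite kt /=.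
by rewrite -(hE _ _ _ n t erefl).
Qed.

Lemma pres_map_uniq (h h' : ghMor M' M) : ghm_base h = ghm_base h' ->
  (forall S (z : oob P S) (n : omor (p S z) x') t,
    ghm_top h (ev e' n t) = ghm_top h' (ev e' n t)) -> h = h'.
Proof.
move=> hb hE; apply: ghMor_eq => //; apply: lipMap_eq => y.
by have [z [n <-]] := ev_point y; exact: hE.
Qed.

End PresMap.

Lemma pres_classifier (M : forall T, oob X T -> ghOb T)
    (e : forall T (x : oob X T), presentation x (M T x)) :
  exists F : overFun X (GH R), inhabited (classifier F p).
Proof.
pose h T' T (x' : oob X T') (x : oob X T) (m : omor x' x) :
  ghMor (M T' x') (M T x) := sval (cid (pres_map m (e T' x') (e T x))).
have hb T' T (x' : oob X T') (x : oob X T) (m : omor x' x) :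
    ghm_base (h _ _ _ _ m) = obase m.
  by have [] := svalP (cid (pres_map m (e T' x') (e T x))).
have hE T' T (x' : oob X T') (x : oob X T) (m : omor x' x) S (z : oob P S)
    (n : omor (p S z) x') t :
    ghm_top (h _ _ _ _ m) (ev (e T' x') n t) = ev (e T x) (ocomp m n) t.
  by have [_] := svalP (cid (pres_map m (e T' x') (e T x))); apply.
have hi T (x : oob X T) : h _ _ _ _ (oid x) = gh_id (M T x).
  apply: (pres_map_uniq (e' := e T x)); first by rewrite hb obase_id.
  by move=> S z n t; rewrite hE ocomp_idl.
have hc T2 T1 T (x2 : oob X T2) (x1 : oob X T1) (x : oob X T)
    (m : omor x1 x) (n : omor x2 x1) :
    h _ _ _ _ (ocomp m n) = gh_comp (h _ _ _ _ m) (h _ _ _ _ n).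
  apply: (pres_map_uniq (e' := e T2 x2)); first by rewrite /= !hb obase_comp.
  by move=> S z k t; rewrite /= !hE ocomp_assoc.
pose F : overFun X (GH R) := @OverFun _ X (GH R) M h hb hi hc.
exists F; constructor.
apply: (@Classifier _ _ _ F p (fun T z => ev (e T (p T z)) (oid (p T z)))).
- by move=> T z t; rewrite ev_base obase_id.
- by move=> T' T z' z k t; rewrite hE ocomp_idr -(ev_nat (e T (p T z))) ocomp_idl.
- move=> T x y yt; have [z [n nE]] := ev_surj (e T x) y.
  exists z, n; split=> [|t]; last by rewrite hE ocomp_idr nE.
  by apply: lipMap_eq => t; rewrite -(ev_base (e T x)) nE yt.
- move=> T' T z' z n nE.
  have [t|k [kb kE]] := @ev_full _ _ _ (e T (p T z)) _ _ z' z n (oid _) (obase n).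
    by rewrite -nE hE ocomp_idr.
  by exists k; rewrite -kE ocomp_idl.
- move=> T' T z' z k k' kk'; apply: (@ev_faith _ _ _ (e T (p T z)) _ _ z' z (oid _)).
    by rewrite -!(fmor_base p) kk'.
  by rewrite kk'.
Qed.

Lemma cls_presentation (F : overFun X (GH R)) (c : classifier F p)
  (T : tbMet R) (x : oob X T) : presentation x (F T x).
Proof.
apply: (@Presentation _ _ _
  (fun S z n => lcomp (ghm_top (fmor F n)) (cls_sec c z))).
- by move=> S z n t; rewrite /= ghm_comm cls_secK ghm_base_fmor.
- by move=> S' S z' z n k t; rewrite /= ghm_top_fmor cls_nat.
- move=> S y; have [z [n [_ nE]]] := cls_points fX c y.
  by exists z, n.
- move=> S' S z' z n' n f nn'; apply: (cls_hom fX (c := c)) => //.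
  apply: lipMap_eq => t; move: (congr1 (gh_map (F T x)) (nn' t)).
  by rewrite /= !ghm_comm !cls_secK !ghm_base_fmor.
- move=> S' S z' z n k k' kk' nk; apply: (cls_faith c).
  by apply: (cart_uniq fX (m := n)) => //; rewrite !fmor_base.
Defined.

(** F x and G x are presented by the same test objects, so [pres_map] at the identity of x compares
    them; naturality holds by [pres_map_uniq]. *)
Lemma cls_unique (F G : overFun X (GH R)) :
  classifier F p -> classifier G p -> two_isomorphic F G.
Proof.
move=> c d; have hE T (x : oob X T) : exists h : ghMor (F T x) (G T x),
    ghm_base h = lid T /\ forall S (z : oob P S) (n : omor (p S z) x) t,
    ghm_top h (ev (cls_presentation c x) n t) = ev (cls_presentation d x) n t.
  have [h [hb he]] := pres_map (oid x) (cls_presentation c x) (cls_presentation d x).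
  by exists h; split=> [|S z n t]; rewrite ?hb ?obase_id // he ocomp_idl.
pose h T (x : oob X T) := sval (cid (hE T x)).
have hb T x : ghm_base (h T x) = lid T by have [] := svalP (cid (hE T x)).
have he T x S (z : oob P S) (n : omor (p S z) x) t :
    ghm_top (h T x) (ev (cls_presentation c x) n t) =
    ev (cls_presentation d x) n t.
  by have [_] := svalP (cid (hE T x)); apply.
constructor; apply: (@TwoCell _ X (GH R) F G h hb) => T' T x' x m.
apply: (pres_map_uniq (e' := cls_presentation c x')) => [|S z n t].
  by rewrite /= !ghm_base_fmor !hb; exact: lipMap_eq.
rewrite /= -ghm_top_fmor (he _ _ _ _ (ocomp m n)) /= ghm_top_fmor.
by rewrite (he _ _ _ _ n).
Qed.

End Presentation.

(** * Operations on classifiers *)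

Section ClsOperations.
Context {R : realType}.

Lemma rep_arrow (M : metricType R) S' S (y' : oob (rep M) S') (y : oob (rep M) S)
  (m : omor y' y) t : y (obase m t) = y' t.
Proof. exact: (lipMap_app (svalP m) t). Qed.

Definition rep_mor (M : metricType R) (S' S : tbMet R) (y' : lipMap S' M)
    (y : lipMap S M) (f : lipMap S' S) (e : lcomp y f = y') :
  @omor R (rep M) S' S y' y := exist _ f e.

Lemma rep_fibered (M : metricType R) : fibered_in_groupoids (rep M).
Proof.
split=> [T' T f x|T2 T1 T x2 x1 x m n g mg].
  by exists (lcomp x f), (rep_mor erefl).
have gx : lcomp x1 g = x2.
  apply: lipMap_eq => t; rewrite -(rep_arrow n) -mg /=.
  by rewrite -(rep_arrow m).
exists (rep_mor gx); split=> [|k [kb _]]; last exact: repMor_eq.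
by split=> //; apply: repMor_eq.
Qed.

Lemma cls_iso (X P : overCat R) (p : overFun P X) (F G : overFun X (GH R)) :
  twoCell F G -> classifier F p -> classifier G p.
Proof.
move=> a c; have ab T (x : oob X T) t : ghm_base (a T x) t = t.
  by have /= -> := tc_base a x.
have an T' T (x' : oob X T') (x : oob X T) (m : omor x' x) y :
    ghm_top (fmor G m) (ghm_top (a T' x') y) = ghm_top (a T x) (ghm_top (fmor F m) y).
  by have /(congr1 (fun h => ghm_top h y)) /= := tc_nat a m.
apply: (@Classifier _ _ _ G p
  (fun T z => lcomp (ghm_top (a T (p T z))) (cls_sec c z))).
- by move=> T z t /=; rewrite ghm_comm cls_secK ab.
- by move=> T' T z' z k t /=; rewrite an cls_nat.
- move=> T x y yt.
  have [|y' [y'y y't]] := @ghm_lift_map _ _ _ _ _ (a T x) _ y (lid T).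
    by move=> t; rewrite ab yt.
  have [z [m [mb my]]] := cls_surj c y't.
  by exists z, m; split=> // t; rewrite /= an my y'y.
- move=> T' T z' z n nE; apply: (cls_full (c := c)) => t.
  apply: (@ghm_inj _ _ _ _ _ (a T (p T z))); first by rewrite -an; exact: nE.
  by rewrite ghm_comm !cls_secK ghm_base_fmor.
- by move=> T' T z' z k k'; exact: (cls_faith c).
Qed.

Lemma cls_pullback (X Y P : overCat R) (p : overFun P X) (F : overFun X (GH R))
    (b : overFun Y X) : fibered_in_groupoids X ->
  classifier F p -> classifier (fcomp F b) (fib2_pr2 p b).
Proof.
move=> fX c.
have cb T (z : oob (fib2 p b) T) t : ghm_base (fmor F (f2_cell z)) t = t.
  by rewrite ghm_base_fmor f2_cell_base.
apply: (@Classifier _ _ _ (fcomp F b) (fib2_pr2 p b)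
  (fun T z => lcomp (ghm_top (fmor F (f2_cell z))) (cls_sec c (f2_fst z)))).
- by move=> T z t /=; rewrite ghm_comm cls_secK cb.
- move=> T' T z' z k t /=; rewrite -ghm_top_fmor -(f2m_comm k) ghm_top_fmor.
  by rewrite cls_nat.
- move=> T x y yt; have [z [m [mb my]]] := @cls_surj _ _ _ _ _ c T (b T x) y yt.
  exists (@Fib2Ob _ _ _ _ p b T z x m mb), (oid x); split; first exact: obase_id.
  by move=> t; rewrite ghm_top_fmor_id /= my.
- move=> T' T z' z n nE.
  have [||k [kb kE]] := @cls_hom _ _ _ _ _ fX c _ _ _ (b T (f2_snd z))
    (f2_fst z') (f2_fst z) (ocomp (fmor b n) (f2_cell z')) (f2_cell z) (obase n).
  + by rewrite obase_comp !f2_cell_base fmor_base lcomp_id_l lcomp_id_r.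
  + by move=> t; rewrite ghm_top_fmor; exact: nE.
  by exists (@Fib2Mor _ _ _ _ p b _ _ z' z k n kb kE).
- move=> T' T z' z k k' /= kk'; apply: fib2Mor_eq => //; apply: (cls_faith c).
  apply: (cart_uniq fX (m := f2_cell z)).
    by rewrite !fmor_base !f2m_base kk'.
  by rewrite !f2m_comm kk'.
Qed.

Lemma rep_cls_ex (T : tbMet R) (F : overFun (rep T) (GH R)) S
    (z : lipMap (tb_sort S) (gh_space (F T (lid T)))) :
  exists y : lipMap S (gh_space (F S (lcomp (gh_map (F T (lid T))) z))),
    (forall rho : omor (lcomp (gh_map (F T (lid T))) z : oob (rep T) S)
                       (lid T : oob (rep T) T),
       forall t, ghm_top (fmor F rho) (y t) = z t) /\
    forall t, gh_map _ (y t) = t.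
Proof.
set q := lcomp _ z.
pose rho0 : omor (q : oob (rep T) S) (lid T : oob (rep T) T) :=
  rep_mor (lcomp_id_l q).
have [|y [yz yt]] := @ghm_lift_map _ _ _ _ _ (fmor F rho0) _ z (lid S).
  by move=> t; rewrite ghm_base_fmor.
exists y; split=> // rho; suff -> : rho = rho0 by [].
apply: repMor_eq => /=; case: rho => f /= <-; exact: lipMap_eq.
Qed.

(** A map z from S to the space of F at the identity of T amounts to a section of the pullback along
    the base map of z. *)
Lemma rep_classifier (T : tbMet R) (F : overFun (rep T) (GH R)) :
  classifier F (rep_map (gh_map (F T (lid T)))).
Proof.
set q := gh_map _.
pose s S (z : oob (rep (gh_space (F T (lid T)))) S) := sval (cid (rep_cls_ex z)).
have sE S z (rho : omor (lcomp q z : oob (rep T) S) (lid T : oob (rep T) T)) t :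
    ghm_top (fmor F rho) (s S z t) = z t.
  by have [+ _] := svalP (cid (rep_cls_ex z)); apply.
have sK S z t : gh_map _ (s S z t) = t.
  by have [_] := svalP (cid (rep_cls_ex z)); apply.
pose rho S (x : oob (rep T) S) : omor x (lid T : oob (rep T) T) :=
  rep_mor (lcomp_id_l x).
apply: (@Classifier _ _ _ F (rep_map q) s sK).
- move=> S' S z' z k t; apply: (@ghm_inj _ _ _ _ _ (fmor F (rho S (lcomp q z)))).
    rewrite -ghm_top_fmor.
    apply: etrans (sE S' z' (ocomp (rho S (lcomp q z)) (fmor (rep_map q) k)) t) _.
    by rewrite sE; exact: esym (rep_arrow k t).
  by rewrite ghm_comm !sK ghm_base_fmor.
- move=> S x y yt; pose z : oob (rep (gh_space (F T (lid T)))) S :=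
    lcomp (ghm_top (fmor F (rho S x))) y.
  have zx : lcomp x (lid S) = lcomp q z.
    by apply: lipMap_eq => t /=; rewrite /q ghm_comm yt ghm_base_fmor.
  exists z, (rep_mor zx); split=> // t.
  apply: (@ghm_inj _ _ _ _ _ (fmor F (rho S x))); first by rewrite -ghm_top_fmor sE.
  by rewrite ghm_comm sK yt ghm_base_fmor.
- move=> S' S z' z n nE; have zn : lcomp z (obase n) = z'.
    apply: lipMap_eq => t /=.
    by rewrite -(sE _ _ (rho S (lcomp q z))) -nE -ghm_top_fmor sE.
  by exists (rep_mor zn); apply: repMor_eq.
- by move=> S' S z' z k k' /(congr1 (fun m => obase m)) /= kk'; exact: repMor_eq.
Qed.

(** Over [rep T], the space M and the pulled-back stack are both classified by F composed with b. *)
Lemma gh_pullback_representable (X : overCat R) (F : overFun X (GH R)) :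
  fibered_in_groupoids X -> representable_proper_submetry (gh_pullback F).
Proof.
move=> fX T b; pose M : ghOb T := F T (b T (lid T)).
exists (gh_space M), (gh_map M); split; first exact: gh_proper.
apply: (cls_equivalent (F := fcomp F b) (@rep_fibered T)).
  exact: (rep_classifier (fcomp F b)).
exact: cls_pullback fX (pb_classifier F).
Qed.

(** * Transport of classifiers along equivalences *)

Section Transport.
Context (X P Q : overCat R) (p : overFun P X) (q : overFun Q X).
Context (G : overFun X (GH R)).
Context (fX : fibered_in_groupoids X) (fP : fibered_in_groupoids P)
  (fQ : fibered_in_groupoids Q) (d : classifier G q).
Context (E : overFun P Q) (E' : overFun Q P) (a : twoCell (fcomp q E) p)
  (u : twoCell (fcomp E E') (fid Q)) (v : twoCell (fcomp E' E) (fid P)).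

Let ub T z : obase (u T z) = lid T. Proof. exact: (tc_base u z). Qed.
Let vb T z : obase (v T z) = lid T. Proof. exact: (tc_base v z). Qed.
Let ab T z : obase (a T z) = lid T. Proof. exact: (tc_base a z). Qed.
Let un T' T (z' : oob Q T') (z : oob Q T) (k : omor z' z) :
  ocomp (u T z) (fmor E (fmor E' k)) = ocomp k (u T' z').
Proof. exact: (tc_nat u k). Qed.
Let vn T' T (z' : oob P T') (z : oob P T) (k : omor z' z) :
  ocomp (v T z) (fmor E' (fmor E k)) = ocomp k (v T' z').
Proof. exact: (tc_nat v k). Qed.
Let an T' T (z' : oob P T') (z : oob P T) (k : omor z' z) :
  ocomp (a T z) (fmor q (fmor E k)) = ocomp (fmor p k) (a T' z').
Proof. exact: (tc_nat a k). Qed.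

Lemma equiv_faithful T' T (z' : oob P T') (z : oob P T) (k k' : omor z' z) :
  fmor E k = fmor E k' -> k = k'.
Proof.
by move=> kk'; apply: (iso_epi fP (vb z')); rewrite -!vn kk'.
Qed.

Lemma equiv_faithful' T' T (z' : oob Q T') (z : oob Q T) (k k' : omor z' z) :
  fmor E' k = fmor E' k' -> k = k'.
Proof.
by move=> kk'; apply: (iso_epi fQ (ub z')); rewrite -!un kk'.
Qed.

Lemma equiv_full T' T (z' : oob P T') (z : oob P T) (l : omor (E T' z') (E T z)) :
  exists k : omor z' z, fmor E k = l.
Proof.
have [w [wb vw wv]] := cart_inv fP (vb z').
exists (ocomp (ocomp (v T z) (fmor E' l)) w); apply: equiv_faithful'.
apply: (cart_uniq fP (m := v T z)).
  by rewrite !fmor_base !obase_comp vb wb fmor_base lcomp_id_l lcomp_id_r.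
by rewrite vn -!ocomp_assoc wv ocomp_idr.
Qed.

Lemma cls_transport : classifier G p.
Proof.
have abt T z t : ghm_base (fmor G (a T z)) t = t by rewrite ghm_base_fmor ab.
apply: (@Classifier _ _ _ G p
  (fun T z => lcomp (ghm_top (fmor G (a T z))) (cls_sec d (E T z)))).
- by move=> T z t /=; rewrite ghm_comm cls_secK abt.
- move=> T' T z' z k t /=; rewrite -ghm_top_fmor -an ghm_top_fmor cls_nat.
  by rewrite fmor_base.
- move=> T x y yt; have [z0 [m [mb my]]] := cls_surj d yt.
  have [w [wb aw wa]] := cart_inv fX (ab (E' T z0)).
  exists (E' T z0), (ocomp (ocomp m (fmor q (u T z0))) w); split=> [|t /=].
    by rewrite !obase_comp mb wb fmor_base ub; exact: lipMap_eq.
  have wE y0 : ghm_top (fmor G w) (ghm_top (fmor G (a T (E' T z0))) y0) = y0.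
    by rewrite -ghm_top_fmor wa ghm_top_fmor_id.
  rewrite 2!ghm_top_fmor; apply: etrans (my t).
  by rewrite wE cls_nat ub.
- move=> T' T z' z n nE; have [w [wb aw wa]] := cart_inv fX (ab z).
  pose l := ocomp w (ocomp n (a T' z')).
  have lb : obase l = obase n by rewrite !obase_comp wb ab; exact: lipMap_eq.
  have [t|l' l'l] := @cls_full _ _ _ _ _ d _ _ (E T' z') (E T z) l.
    apply: (@ghm_inj _ _ _ _ _ (fmor G (a T z))).
      rewrite -ghm_top_fmor ocomp_assoc aw ocomp_idl ghm_top_fmor lb.
      exact: nE.
    by rewrite ghm_comm ghm_base_fmor !(cls_secK d).
  have [k kl'] := equiv_full l'.
  exists k; apply: (iso_epi fX (ab z')).
  by rewrite -an kl' l'l ocomp_assoc aw ocomp_idl.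
- move=> T' T z' z k k' kk'; apply: equiv_faithful; apply: (cls_faith d).
  apply: (cart_uniq fX (m := a T z)); last by rewrite !an kk'.
  by rewrite !fmor_base -!(fmor_base p) kk'.
Qed.

End Transport.

(** * Presentations from representable submetries *)

Section RepresentablePresentation.
Context (X P : overCat R) (p : overFun P X).
Context (fX : fibered_in_groupoids X) (fP : fibered_in_groupoids P).
Context (pR : representable_proper_submetry p).
Context (T : tbMet R) (x : oob X T).

(** The functor chooses a pullback of x along each t; kap is the resulting cocone to x, and it
    determines the values on arrows. *)
Lemma yoneda_fun : exists (b : overFun (rep T) X)
    (kap : forall S (t : oob (rep T) S), omor (b S t) x),
  (forall S (t : oob (rep T) S), obase (kap S t) = t) /\
  forall S' S (t' : oob (rep T) S') (t : oob (rep T) S) (f : omor t' t),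
    ocomp (kap S t) (fmor b f) = kap S' t'.
Proof.
have pull (S : tbMet R) (t : lipMap S T) :
    exists xk : {x' : oob X S & omor x' x}, obase (projT2 xk) = t.
  by have [x' [k kb]] := cart_pull fX t x; exists (existT _ x' k).
pose ob (S : tbMet R) (t : lipMap S T) := projT1 (sval (cid (pull S t))).
pose kap (S : tbMet R) (t : lipMap S T) : omor (ob S t) x := projT2 (sval (cid (pull S t))).
have kb S t : obase (kap S t) = t := svalP (cid (pull S t)).
have morE S' S (t' : oob (rep T) S') (t : oob (rep T) S) (f : omor t' t) :
    exists k : omor (ob S' t') (ob S t), obase k = obase f /\
      ocomp (kap S t) k = kap S' t'.
  by apply: cart_lift => //; rewrite !kb; exact: (svalP f).
pose mor S' S (t' : oob (rep T) S') (t : oob (rep T) S) (f : omor t' t) :=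
  sval (cid (morE S' S t' t f)).
have mb S' S (t' : oob (rep T) S') (t : oob (rep T) S) (f : omor t' t) :
    obase (mor _ _ _ _ f) = obase f.
  by have [] := svalP (cid (morE S' S t' t f)).
have mk S' S (t' : oob (rep T) S') (t : oob (rep T) S) (f : omor t' t) :
    ocomp (kap S t) (mor _ _ _ _ f) = kap S' t'.
  by have [] := svalP (cid (morE S' S t' t f)).
have mi S (t : oob (rep T) S) : mor _ _ _ _ (oid t) = oid (ob S t).
  apply: (cart_uniq fX (m := kap S t)); first by rewrite mb !obase_id.
  by rewrite mk ocomp_idr.
have mc S2 S1 S (t2 : oob (rep T) S2) (t1 : oob (rep T) S1) (t : oob (rep T) S)
    (m : omor t1 t) (n : omor t2 t1) :
    mor _ _ _ _ (ocomp m n) = ocomp (mor _ _ _ _ m) (mor _ _ _ _ n).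
  apply: (cart_uniq fX (m := kap S t)); first by rewrite mb !obase_comp !mb.
  by rewrite ocomp_assoc !mk.
by exists (@OverFun _ (rep T) X ob mor mb mi mc), kap.
Qed.

Lemma fib2_inv (Y : overCat R) (b : overFun Y X) S (w' w : oob (fib2 p b) S)
    (m : omor w' w) : fibered_in_groupoids Y -> obase m = lid S ->
  exists n : omor w w', [/\ obase n = lid S, ocomp m n = oid w & ocomp n m = oid w'].
Proof.
move=> fY mb; have [i1 [i1b mi1 im1]] := cart_inv fP mb.
have [i2 [i2b mi2 im2]] := cart_inv fY (etrans (esym (f2m_base m)) mb).
have ic : ocomp (f2_cell w') (fmor p i1) = ocomp (fmor b i2) (f2_cell w).
  rewrite -[LHS]ocomp_idl -(fmor_id b) -im2 fmor_comp -!ocomp_assoc.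
  congr ocomp; rewrite ocomp_assoc -(f2m_comm m) -ocomp_assoc -fmor_comp mi1.
  by rewrite fmor_id ocomp_idr.
exists (@Fib2Mor _ _ _ _ p b _ _ w w' i1 i2 (etrans i1b (esym i2b)) ic).
by split=> //; apply: fib2Mor_eq.
Qed.

(** A test object (z, n) amounts to an object w of the fibre product of p with the functor b of x.
    This fibre product is equivalent to a space M, and the map to M given by [E' w] is the
    evaluation. *)
Lemma rep_presentation : exists M : ghOb T, inhabited (presentation p x M).
Proof.
have [b [kap [kb kn]]] := yoneda_fun.
have [M [q [qP [E [E' [[a] [u] [v]]]]]]] := pR b.
exists (GhOb qP); constructor.
have ub S w : obase (u S w) = lid S := tc_base u w.
have un S' S (w' : oob (fib2 p b) S') (w : oob (fib2 p b) S) (k : omor w' w) :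
  ocomp (u S w) (fmor E (fmor E' k)) = ocomp k (u S' w') := tc_nat u k.
have cellE S (z : oob P S) (n : omor (p S z) x) :
    exists l : omor (p S z) (b S (obase n)), obase l = lid S /\
      ocomp (kap S (obase n)) l = n.
  by apply: cart_lift => //; rewrite kb lcomp_id_r.
pose cell S (z : oob P S) (n : omor (p S z) x) := sval (cid (cellE S z n)).
have cb S z n : obase (cell S z n) = lid S by have [] := svalP (cid (cellE S z n)).
have ck S z n : ocomp (kap S (obase n)) (cell S z n) = n.
  by have [] := svalP (cid (cellE S z n)).
pose w S (z : oob P S) (n : omor (p S z) x) : oob (fib2 p b) S :=
  @Fib2Ob _ _ _ _ p b S z (obase n) (cell S z n) (cb S z n).
have cell_kap S (w0 : oob (fib2 p b) S) S' (z' : oob P S')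
    (n' : omor (p S' z') x) (k : omor z' (f2_fst w0))
    (g : omor (obase n' : oob (rep T) S') (f2_snd w0)) : obase k = obase g ->
    ocomp (ocomp (kap S (f2_snd w0)) (f2_cell w0)) (fmor p k) = n' ->
    ocomp (f2_cell w0) (fmor p k) = ocomp (fmor b g) (cell S' z' n').
  move=> kg nk; apply: (cart_uniq fX (m := kap S (f2_snd w0))).
    by rewrite !obase_comp f2_cell_base cb !fmor_base kg lcomp_id_l lcomp_id_r.
  by rewrite ocomp_assoc nk ocomp_assoc kn ck.
have warr S' S (z' : oob P S') (z : oob P S) (n' : omor (p S' z') x)
    (n : omor (p S z) x) (k : omor z' z) : ocomp n (fmor p k) = n' ->
    exists m : omor (w S' z' n') (w S z n), f2m_fst m = k.
  move=> nk; have nb : lcomp (obase n) (obase k) = obase n'.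
    by rewrite -nk obase_comp fmor_base.
  pose g : omor (obase n' : oob (rep T) S') (obase n : oob (rep T) S) :=
    rep_mor nb.
  have kg : obase k = obase g by [].
  have cc : ocomp (cell S z n) (fmor p k) = ocomp (fmor b g) (cell S' z' n').
    by apply: (cell_kap S (w S z n)) => //=; rewrite ck.
  by exists (@Fib2Mor _ _ _ _ p b _ _ (w S' z' n') (w S z n) k g kg cc).
(* Arrows over identities in a representable stack are equalities of maps, so E' preserves the maps
   to T strictly. *)
have qE' S (w0 : oob (fib2 p b) S) t : q (E' S w0 t) = f2_snd w0 t.
  have := rep_arrow (f2m_snd (u S w0)) t; rewrite -f2m_base.
  have /= -> := ub S w0; move=> /= ->.
  have /= := rep_arrow (a S (E' S w0)) t.
  by have /= -> := tc_base a (E' S w0); move=> ->.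
apply: (@Presentation _ _ _ p T x (GhOb qP) (fun S z n => E' S (w S z n))).
- by move=> S z n t /=; rewrite qE'.
- move=> S' S z' z n k t; have [m mk] := warr _ _ _ _ _ n k erefl.
  have := rep_arrow (fmor E' m) t; rewrite fmor_base /=; have -> := mk.
  by move=> ->.
- move=> S y; pose w0 := E S y.
  pose n := ocomp (kap S (f2_snd w0)) (f2_cell w0).
  have nb : obase n = f2_snd w0 by rewrite obase_comp kb f2_cell_base lcomp_id_r.
  exists (f2_fst w0), n => t.
  have gb : lcomp (f2_snd w0) (lid S) = obase n by rewrite nb lcomp_id_r.
  pose g : omor (obase n : oob (rep T) S) (f2_snd w0 : oob (rep T) S) :=
    rep_mor gb.
  have kg : obase (oid (f2_fst w0)) = obase g by rewrite obase_id.
  have cc : ocomp (f2_cell w0) (fmor p (oid (f2_fst w0))) =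
      ocomp (fmor b g) (cell S (f2_fst w0) n).
    by apply: cell_kap => //; rewrite fmor_id ocomp_idr.
  pose m := @Fib2Mor _ _ _ _ p b _ _ (w S _ n) w0 (oid (f2_fst w0)) g kg cc.
  have := rep_arrow (fmor E' (m : omor (_ : oob (fib2 p b) S) w0)) t.
  rewrite fmor_base /= obase_id => <- /=.
  by have := rep_arrow (v S y) t; have /= -> := tc_base v y; move=> /= <-.
- move=> S' S z' z n' n f ff.
  have fE : lcomp (E' S (w S z n)) f = E' S' (w S' z' n').
    by apply: lipMap_eq => t; rewrite /= ff.
  pose g : omor (E' S' (w S' z' n')) (E' S (w S z n)) := rep_mor fE.
  have [i [ib ui iu]] := @fib2_inv _ b _ _ _ (u S' (w S' z' n'))
    (@rep_fibered T) (ub _ _).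
  pose m : omor (w S' z' n') (w S z n) := ocomp (ocomp (u S (w S z n)) (fmor E g)) i.
  have mb : obase m = f.
    by rewrite /m !obase_comp ib ub fmor_base lcomp_id_l lcomp_id_r.
  exists (f2m_fst m); split; first exact: mb.
  by rewrite -{1}(ck S z n) -ocomp_assoc [X in ocomp _ X](f2m_comm m) ocomp_assoc kn ck.
- move=> S' S z' z n k k' kk' nk.
  (* The common composite is named n', so that k and k' give arrows with the same source. *)
  move: (erefl (ocomp n (fmor p k'))) nk.
  move: {1 3}(ocomp n (fmor p k')) => n' nk' nk.
  have [m mk] := warr _ _ _ _ _ n k nk; have [m' mk'] := warr _ _ _ _ _ n k' (esym nk').
  suff mm : m = m' by rewrite -mk -mk' mm.
  have [i [ib ui iu]] := @fib2_inv _ b _ _ _ (u S' (w S' z' n'))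
    (@rep_fibered T) (ub _ _).
  rewrite -[m]ocomp_idr -[m']ocomp_idr -ui !ocomp_assoc -!un.
  suff -> : fmor E' m = fmor E' m' by [].
  apply: repMor_eq; apply: etrans (_ : obase (fmor E' m) = obase (fmor E' m')) => //.
  by rewrite !fmor_base /= mk mk'.
Qed.

End RepresentablePresentation.

Lemma representable_classifier (X P : overCat R) (p : overFun P X) :
  fibered_in_groupoids X -> fibered_in_groupoids P ->
  representable_proper_submetry p ->
  exists F : overFun X (GH R), inhabited (classifier F p).
Proof.
move=> fX fP pR.
pose M T (x : oob X T) := sval (cid (rep_presentation fX fP pR x)).
have e T x : exists _ : presentation p x (M T x), True.
  by have [e] := svalP (cid (rep_presentation fX fP pR x)); exists e.
exact: (pres_classifier fX fP (fun T x => sval (cid (e T x)))).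
Qed.

Lemma gh_correspondence (X : overCat R) (F G : overFun X (GH R)) : is_stack X ->
  two_isomorphic F G <-> equivalent_over (gh_pullback F) (gh_pullback G).
Proof.
move=> [fX _ _]; split=> [[a]|[E [E' [[a] [u] [v]]]]].
  apply: (cls_equivalent (F := G) fX); last exact: pb_classifier.
  exact: cls_iso a (pb_classifier F).
apply: (cls_unique fX _ (pb_classifier F)).
  exact: cls_fibered fX (pb_classifier F).
apply: (cls_transport fX _ _ (pb_classifier G) a u v).
  exact: cls_fibered fX (pb_classifier F).
exact: cls_fibered fX (pb_classifier G).
Qed.

End ClsOperations.

(** * The universal family *)

Section BoundedFunctions.
Context {R : realType}.

(** Indexing by real sequences gives at least as many coordinates as there are admissible functions
    on a totally bounded space. *)
Record bfun := BFun {
  bf :> (nat -> R) -> R;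
  bf_bounded : exists b, forall g, `|bf g| <= b }.

Lemma bfun_eq (f g : bfun) : bf f =1 bf g -> f = g.
Proof.
case: f g => [f fP] [g gP] /= /funext fg; subst g.
by rewrite (Prop_irrelevance fP gP).
Qed.

Definition bf_dists (f g : bfun) : set R := range (fun c => `|f c - g c|).
Definition bf_dist (f g : bfun) : R := sup (bf_dists f g).

Lemma bf_dist_ub (f g : bfun) c : `|f c - g c| <= bf_dist f g.
Proof.
apply: ub_le_sup; last by exists c.
have [b fb] := bf_bounded f; have [b' gb] := bf_bounded g.
exists (b + b') => _ [c' _ <-]; apply: le_trans (ler_normB _ _) _.
exact: lerD.
Qed.

Lemma bf_dist_le (f g : bfun) d : (forall c, `|f c - g c| <= d) -> bf_dist f g <= d.
Proof.
move=> fg; apply: ge_sup; last by move=> _ [c _ <-].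
by exists `|f (fun=> 0) - g (fun=> 0)|, (fun=> 0).
Qed.

Lemma bf_metric_ax : metric_ax bf_dist.
Proof.
have ge0 (f g : bfun) : 0 <= bf_dist f g.
  by apply: le_trans (bf_dist_ub f g (fun=> 0)).
split.
- move=> f; apply/eqP; rewrite eq_le ge0 andbT; apply: bf_dist_le => c.
  by rewrite subrr normr0.
- move=> f g fg; apply: bfun_eq => c; apply/eqP.
  by rewrite -subr_eq0 -normr_le0 -fg bf_dist_ub.
- by move=> f g; congr sup; apply/seteqP; split=> _ [c _ <-]; exists c => //;
    rewrite distrC.
- move=> g f h; apply: bf_dist_le => c.
  rewrite -(subrKA (g c)); apply: le_trans (ler_normD _ _) _.
  by apply: lerD; exact: bf_dist_ub.
Qed.

Definition linf : metricType R := metric_of bf_metric_ax.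

Definition coord (f : linf) (c : nat -> R) : R := bf f c.

Lemma linf_dist_ub (f g : linf) c : `|coord f c - coord g c| <= mdist f g.
Proof. exact: bf_dist_ub. Qed.

Lemma linf_dist_le (f g : linf) d :
  (forall c, `|coord f c - coord g c| <= d) -> mdist f g <= d.
Proof. exact: bf_dist_le. Qed.

Lemma bfun0_bounded : exists b : R, forall g : nat -> R, `|(0 : R)| <= b.
Proof. by exists 0 => g; rewrite normr0. Qed.

Definition linf0 : linf := BFun bfun0_bounded.

End BoundedFunctions.

Arguments linf R : clear implicits.
Arguments linf0 {R}.

(** * Generic isometric embeddings *)

Section GenericEmbedding.
Context {R : realType}.
Local Notation code := (nat -> R).

(* phi is the restriction to K of a 1-Lipschitz function on the space obtained
   from Q by adding a point at distance N q from each q, vanishing there. *)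
Definition admissible (Q : metricType R) (N : Q -> R) (K : set Q) (phi : Q -> R) :=
  (forall x y, K x -> K y -> phi x <= phi y + mdist x y) /\
  (forall x, K x -> `|phi x| <= N x).

(** Katetov functions: the possible distances to one point added to Q. *)
Definition katetov (Q : metricType R) (N : Q -> R) :=
  (forall x y, N x <= N y + mdist x y) /\ forall x y, mdist x y <= N x + N y.

(* The coordinates of the points of A realise every admissible function, each
   of them as often as there are codes. *)
Definition generic (A : set (linf R)) :=
  exists sigma : code -> code, forall phi,
    admissible (fun a : linf R => mdist a linf0) A phi ->
    forall g, exists c, (forall a, A a -> coord a c = phi a) /\ sigma c = g.

Lemma katetov_ge0 (Q : metricType R) (N : Q -> R) x : katetov N -> 0 <= N x.
Proof. by move=> [_ /(_ x x)]; rewrite mdistxx; lra. Qed.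

Lemma linf_admissible (A : set (linf R)) c :
  admissible (fun a : linf R => mdist a linf0) A (fun a => coord a c).
Proof.
split=> [x y _ _|x _].
  by have := linf_dist_ub x y c; rewrite ler_norml => /andP[_]; lra.
by have := linf_dist_ub x linf0 c; rewrite /= subr0.
Qed.

(** McShane's formula for phi extended by 0 at the added point, which contributes the candidate
    [N q] to the infimum. *)
Lemma mcshane (Q : metricType R) (N : Q -> R) (K : set Q) phi :
  katetov N -> admissible N K phi ->
  exists psi, admissible N setT psi /\ forall x, K x -> psi x = phi x.
Proof.
move=> kN [lphi bphi].
have lN := proj1 kN.
pose S q := [set r | r = N q \/ exists2 k, K k & r = phi k + mdist k q].
have Sne q : S q !=set0 by exists (N q); left.
have Slb q : lbound (S q) (- N q).
  move=> r [->|[k Kk ->]]; first by have := katetov_ge0 q kN; lra.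
  have := bphi k Kk; rewrite ler_norml => /andP[+ _].
  by have := lN k q; lra.
have Sle q r : S q r -> inf (S q) <= r by apply: ge_inf; exists (- N q).
exists (fun q => inf (S q)); split; [split|].
- move=> x y _ _; rewrite -lerBlDr; apply: lb_le_inf => // r [->|[k Kk ->]].
    by rewrite lerBlDr; apply: le_trans (lN _ _); apply: Sle; left.
  rewrite lerBlDr -addrA; apply: le_trans (_ : phi k + mdist k x <= _).
    by apply: Sle; right; exists k.
  by rewrite lerD2l [mdist x y]metric_sym; exact: metric_triangle.
- move=> x _; rewrite ler_norml; apply/andP; split; first exact: lb_le_inf.
  by apply: Sle; left.
- move=> x Kx; apply/eqP; rewrite eq_le; apply/andP; split.
    by apply: Sle; right; exists x; rewrite // mdistxx addr0.
  apply: lb_le_inf => // r [->|[k Kk ->]].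
    by have := bphi x Kx; rewrite ler_norml => /andP[].
  by rewrite metric_sym; exact: lphi.
Qed.

Lemma tot_bounded_countable (Q : metricType R) : tot_bounded Q ->
  exists (D : set Q) (i : Q -> nat),
    {in D &, injective i} /\
    forall q (e : R), 0 < e -> exists2 d, D d & mdist d q < e.
Proof.
move=> tQ; have /choice[net netP] : forall n : nat, exists A : set Q,
    finite_set A /\ [set: Q] `<=` \bigcup_(a in A) ball a (n.+1%:R^-1 : R).
  by move=> n; have [|A fA cA] := tQ (n.+1%:R^-1); [rewrite invr_gt0|exists A].
have /countable_injP[i iI] : countable (\bigcup_n net n).
  apply: bigcup_countable => // n _; apply: finite_set_countable.
  by have [] := netP n.
exists (\bigcup_n net n), i; split.
  exact: iI.
move=> q e e0; have [n ne] : exists n, n.+1%:R^-1 < e.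
  exists (Num.truncn e^-1); rewrite -[ltRHS]invrK ltf_pV2 ?posrE ?invr_gt0 //.
  exact: truncnS_gt.
have [_ /(_ q I)[a na]] := netP n; rewrite ballEmdist /= => aq.
by exists a; [exists n|exact: lt_trans ne].
Qed.

(* An admissible function is determined by its values on a countable dense
   set, so the admissible functions are no more numerous than the codes. *)
Lemma admissible_code (Q : metricType R) (N : Q -> R) : tot_bounded Q ->
  exists dec : code -> Q -> R,
    forall psi, admissible N setT psi -> exists g, dec g = psi.
Proof.
move=> /tot_bounded_countable[D [i [iI Dd]]].
pose agree (g : code) (psi : Q -> R) :=
  admissible N setT psi /\ forall d, D d -> psi d = g (i d).
have /choice[dec decE] : forall g, exists psi,
    (exists psi', agree g psi') -> agree g psi.
  move=> g; have [[psi h]|no] := pselect (exists psi, agree g psi).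
    by exists psi.
  by exists (fun=> 0).
exists dec => psi psiA.
have /choice[g gE] : forall n, exists r, forall d, D d -> i d = n -> r = psi d.
  move=> n; have [[d Dd' dn]|no] := pselect (exists2 d, D d & i d = n).
    exists (psi d) => d' Dd'' d'n; congr psi; apply: iI; rewrite ?inE //.
    by rewrite dn.
  by exists 0 => d Dd' dn; exfalso; apply: no; exists d.
have [[l1 _] a1] : agree g (dec g).
  by apply: decE; exists psi; split=> // d Dd'; rewrite (gE _ d).
exists g; apply/funext => q; have [l2 _] := psiA.
apply/eqP; rewrite eq_le; apply/andP; split; apply/ler_addgt0Pr => e e0;
  have e20 : 0 < e / 2 by rewrite divr_gt0.
  have [d Dd' dq] := Dd q _ e20.
  have := l1 q d I I; have := l2 d q I I; rewrite (a1 d Dd') (gE _ d Dd' erefl).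
  by rewrite (metric_sym q d); lra.
have [d Dd' dq] := Dd q _ e20.
have := l1 d q I I; have := l2 q d I I; rewrite (a1 d Dd') (gE _ d Dd' erefl).
by rewrite (metric_sym q d); lra.
Qed.

(* Coordinate by coordinate, e extends e0 by a McShane extension, unless the
   first half of the code sigma0 c prescribes another one; the second half is
   kept as the code for the extended embedding. *)
Lemma generic_extension (Q : metricType R) (N : Q -> R) (K : set Q)
    (e0 : Q -> linf R) (sigma0 : code -> code) :
  tot_bounded Q -> katetov N ->
  (forall c, admissible N K (fun q => coord (e0 q) c)) ->
  (forall phi, admissible N K phi -> forall g, exists c,
     (forall q, K q -> coord (e0 q) c = phi q) /\ sigma0 c = g) ->
  exists e : Q -> linf R, [/\ forall q, K q -> e q = e0 q,
    forall q q', mdist (e q) (e q') = mdist q q' &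
    forall B : set Q, generic (e @` B)].
Proof.
move=> tQ kN e0A e0G; have [dec decE] := admissible_code N tQ.
pose good c psi := admissible N setT psi /\ forall q, K q -> psi q = coord (e0 q) c.
pose fsth (g : code) : code := fun n => g n.*2.
pose sndh (g : code) : code := fun n => g n.*2.+1.
have /choice[Psi PsiE] : forall c, exists psi, good c psi /\
    (good c (dec (fsth (sigma0 c))) -> psi = dec (fsth (sigma0 c))).
  move=> c; have [gd|ng] := pselect (good c (dec (fsth (sigma0 c)))).
    by exists (dec (fsth (sigma0 c))).
  by have [psi psiA] := mcshane kN (e0A c); exists psi.
have Pb q : exists b, forall c, `|Psi c q| <= b.
  by exists (N q) => c; have [[[_ +] _] _] := PsiE c; apply.
pose e q : linf R := BFun (Pb q).
have real phi : admissible N setT phi -> forall g,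
    exists c, (forall q, coord (e q) c = phi q) /\ sndh (sigma0 c) = g.
  move=> phiA g; have [h hE] := decE _ phiA.
  (* The even entries code phi, so that [Psi c] becomes phi; the odd entries carry the free code
     g. *)
  pose hg : code := fun n => if odd n then g n./2 else h n./2.
  have [|c [cphi cs]] := e0G phi _ hg.
    by have [l b] := phiA; split=> [x y _ _|x _]; [exact: l|exact: b].
  have fE : fsth (sigma0 c) = h.
    by apply/funext => n; rewrite cs /fsth /hg odd_double doubleK.
  have sE : sndh (sigma0 c) = g.
    by apply/funext => n; rewrite cs /sndh /hg /= odd_double /= uphalf_double.
  exists c; split=> // q; have [_] := PsiE c; rewrite fE hE => /= -> //.
  by split=> // k Kk; rewrite cphi.
have eN q : mdist (e q) linf0 = N q.
  apply/eqP; rewrite eq_le; apply/andP; split.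
    apply: linf_dist_le => c; rewrite subr0.
    by have [[[_ +] _] _] := PsiE c; apply.
  (* N is itself admissible, so some coordinate attains the norm. *)
  have [|c [cN _]] := real N _ (fun=> 0).
    split=> [x y _ _|x _]; first exact: (proj1 kN).
    by rewrite ger0_norm // katetov_ge0.
  apply: le_trans (linf_dist_ub (e q) linf0 c); rewrite cN subr0.
  exact: ler_norm.
have ed q q' : mdist (e q) (e q') = mdist q q'.
  apply/eqP; rewrite eq_le; apply/andP; split.
    apply: linf_dist_le => c; have [[[l _] _] _] := PsiE c.
    have := l q q' I I; have := l q' q I I; rewrite (metric_sym q' q) /= => h1 h2.
    by rewrite ler_norml; apply/andP; split; lra.
  (* This admissible function is a coordinate, and its values at q and q' differ by [mdist q q']. *)
  have [|c [cq _]] := real (fun x => mdist x q' - N q') _ (fun=> 0).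
    split=> [x y _ _|x _].
      by have := metric_triangle x y q'; lra.
    have := proj2 kN x q'; have := proj1 kN q' x; rewrite (metric_sym q' x) => h1 h2.
    by rewrite ler_norml; apply/andP; split; lra.
  apply: le_trans (linf_dist_ub (e q) (e q') c); rewrite !cq mdistxx.
  by apply: le_trans (ler_norm _); lra.
exists e; split=> // [q Kq|B].
  by apply: bfun_eq => c; have [[_ +] _] := PsiE c; apply.
exists (sndh \o sigma0) => phi [phil phib] g.
(* A function admissible on the image is pulled back to B, extended to Q and realised there; norms
   correspond by [eN]. *)
have [|psi [psiA psiE]] := @mcshane Q N B (phi \o e) kN.
  split=> [x y Bx By|x Bx] /=.
    by rewrite -ed; apply: phil; [exists x|exists y].
  by rewrite -eN; apply: phib; exists x.
have [c [cpsi cg]] := real psi psiA g.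
exists c; split=> // _ [q Bq <-]; rewrite cpsi psiE //.
Qed.

Lemma generic_embedding (Q : metricType R) : tot_bounded Q ->
  exists e : Q -> linf R, (forall q q', mdist (e q) (e q') = mdist q q') /\
    forall B : set Q, generic (e @` B).
Proof.
move=> tQ; have [N kN] : exists N : Q -> R, katetov N.
  have [[q0]|no] := pselect (inhabited Q); last first.
    by exists (fun=> 0); split=> x; exfalso; apply: no.
  exists (mdist q0); split=> x y.
    by rewrite [mdist x y]metric_sym; exact: metric_triangle.
  by rewrite (metric_sym q0 x); exact: metric_triangle.
(* Over the empty set every coordinate realises every function, so the identity serves as
   [sigma0]. *)
have [c||e [_ ed eG]] := @generic_extension Q N set0 (fun=> linf0) id tQ kN.
- by [].
- by move=> phi _ g; exists g.
by exists e.
Qed.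

(** The norms on A being prescribed, N is the distance to the origin when Q is glued along A to A
    with the origin. Genericity of A supplies the coordinates needed for the extension. *)
Lemma generic_embedding_rel (Q : metricType R) (A : set (linf R)) (kap : linf R -> Q) :
  tot_bounded Q -> generic A -> A !=set0 ->
  (forall a b, A a -> A b -> mdist (kap a) (kap b) = mdist a b) ->
  exists e : Q -> linf R, [/\ forall a, A a -> e (kap a) = a,
    forall q q', mdist (e q) (e q') = mdist q q' &
    forall B : set Q, generic (e @` B)].
Proof.
move=> tQ [sigma sigmaE] [a0 Aa0] kd.
pose S q := [set r | exists2 a, A a & r = mdist q (kap a) + mdist a linf0].
have Sne q : S q !=set0 by exists (mdist q (kap a0) + mdist a0 linf0), a0.
have Slb q : lbound (S q) 0 by move=> _ [a Aa ->]; rewrite addr_ge0 ?mdist_ge0.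
have Sle q r : S q r -> inf (S q) <= r by apply: ge_inf; exists 0.
pose N q := inf (S q).
have kN : katetov N.
  split=> x y.
    rewrite -lerBlDr; apply: lb_le_inf => // _ [a Aa ->]; rewrite lerBlDr.
    apply: le_trans (_ : mdist x (kap a) + mdist a linf0 <= _).
      by apply: Sle; exists a.
    by have := metric_triangle x y (kap a); lra.
  rewrite -lerBlDr; apply: lb_le_inf => // _ [a Aa ->]; rewrite lerBlDr addrC.
  rewrite -lerBlDr; apply: lb_le_inf => // _ [b Ab ->]; rewrite lerBlDr.
  have := metric_triangle x (kap a) y; have := metric_triangle (kap a) (kap b) y.
  rewrite (kd _ _ Aa Ab) (metric_sym (kap b)).
  by have := metric_triangle a linf0 b; rewrite (metric_sym linf0 b); lra.
have NE a : A a -> N (kap a) = mdist a linf0.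
  move=> Aa; apply/eqP; rewrite eq_le; apply/andP; split.
    by apply: Sle; exists a => //; rewrite mdistxx add0r.
  apply: lb_le_inf => // _ [b Ab ->]; rewrite (kd _ _ Aa Ab).
  exact: metric_triangle.
(* e0 inverts kap on the image of A; elsewhere its value a0 is a default. *)
have /choice[e0 e0E] : forall q, exists a, forall b, A b -> kap b = q -> a = b.
  move=> q; have [[b Ab bq]|no] := pselect (exists2 b, A b & kap b = q).
    exists b => b' Ab' b'q; apply: mdist_positivity.
    by rewrite -(kd _ _ Ab Ab') bq b'q mdistxx.
  by exists a0 => b Ab bq; exfalso; apply: no; exists b.
have e0k a : A a -> e0 (kap a) = a by move=> Aa; exact: (e0E (kap a)).
have [c|phi [phil phib] g|e [ee0 ed eG]] :=
    @generic_extension Q N (kap @` A) e0 sigma tQ kN.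
- have [l b] := linf_admissible A c.
  split=> [_ _ [x Ax <-] [y Ay <-]|_ [x Ax <-]].
    by rewrite !e0k // (kd _ _ Ax Ay); exact: l.
  by rewrite e0k // NE //; exact: b.
- have [|c [cE cg]] := sigmaE (phi \o kap) _ g.
    split=> [x y Ax Ay|x Ax] /=.
      by rewrite -(kd _ _ Ax Ay); apply: phil; [exists x|exists y].
    by rewrite -NE //; apply: phib; exists x.
  by exists c; split=> // _ [a Aa <-]; rewrite e0k // cE.
by exists e; split=> // a Aa; rewrite ee0 ?e0k.
Qed.

End GenericEmbedding.

(** * Pullback of a proper submetry as a map of stacks *)

Section PullbackFunctor.
Context {R : realType} (M Y : metricType R) (q : lipMap M Y).
Hypothesis qP : proper_submetry q.

Lemma pull_top_subproof (T' T : tbMet R) (u' : lipMap T' Y) (u : lipMap T Y)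
    (f : lipMap T' T) (e : lcomp u f = u') (z : fibProd q u') :
  q (fp_fst z) = u (f (fp_snd z)).
Proof. by rewrite (fp_eq z) -(lipMap_app e). Qed.

Lemma pull_top_lip (T' T : tbMet R) (u' : lipMap T' Y) (u : lipMap T Y)
    (f : lipMap T' T) (e : lcomp u f = u') (z z' : fibProd q u') :
  mdist (FibProd (pull_top_subproof e z)) (FibProd (pull_top_subproof e z')) <=
  mdist z z'.
Proof. by rewrite !fp_mdistE /= ge_max !le_max lexx lipP !orbT. Qed.

Definition pull_top (T' T : tbMet R) (u' : lipMap T' Y) (u : lipMap T Y)
    (f : lipMap T' T) (e : lcomp u f = u') :
  lipMap (gh_space (pull_ob qP u')) (gh_space (pull_ob qP u)) :=
  @LipMap _ (fibProd q u') (fibProd q u) _ (pull_top_lip e).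

Lemma pull_mor_ex (T' T : tbMet R) (u' : oob (rep Y) T') (u : oob (rep Y) T)
    (m : omor u' u) :
  exists h : ghMor (pull_ob qP u') (pull_ob qP u),
    ghm_base h = obase m /\ ghm_top h = pull_top (svalP m).
Proof.
apply: ghMor_build.
- by [].
- move=> [x t xt] t' /= tt'.
  have xt' : q x = u' t' by rewrite xt tt' -(rep_arrow m).
  by exists (FibProd xt'); split=> //; apply: fibProd_eq.
- by move=> x y; rewrite !fp_mdistE /= ge_max !le_max !lexx !orbT.
Qed.

Let mor (T' T : tbMet R) (u' : oob (rep Y) T') (u : oob (rep Y) T)
  (m : omor u' u) := sval (cid (pull_mor_ex m)).

Let mor_base (T' T : tbMet R) (u' : oob (rep Y) T') (u : oob (rep Y) T)
  (m : omor u' u) : ghm_base (mor m) = obase m.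
Proof. by have [] := svalP (cid (pull_mor_ex m)). Qed.

Let mor_top (T' T : tbMet R) (u' : oob (rep Y) T') (u : oob (rep Y) T)
  (m : omor u' u) : ghm_top (mor m) = pull_top (svalP m).
Proof. by have [] := svalP (cid (pull_mor_ex m)). Qed.

Lemma pull_id (T : tbMet R) (u : oob (rep Y) T) : mor (oid u) = gh_id (pull_ob qP u).
Proof.
apply: ghMor_eq; first by rewrite mor_base.
by rewrite mor_top; apply: lipMap_eq => z; apply: fibProd_eq.
Qed.

Lemma pull_comp (T2 T1 T : tbMet R) (u2 : oob (rep Y) T2) (u1 : oob (rep Y) T1)
    (u : oob (rep Y) T) (m : omor u1 u) (n : omor u2 u1) :
  mor (ocomp m n) = gh_comp (mor m) (mor n).
Proof.
apply: ghMor_eq; first by rewrite /= !mor_base.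
by rewrite /= !mor_top; apply: lipMap_eq => z; apply: fibProd_eq.
Qed.

Definition pull_fun : overFun (rep Y) (GH R) :=
  @OverFun _ (rep Y) (GH R) (fun T u => pull_ob qP u) mor mor_base pull_id pull_comp.

Lemma pull_fun_fst (T' T : tbMet R) (u' : oob (rep Y) T') (u : oob (rep Y) T)
  (m : omor u' u) (z : fibProd q u') : fp_fst (ghm_top (fmor pull_fun m) z) = fp_fst z.
Proof. by rewrite /= mor_top. Qed.

End PullbackFunctor.

(** * 2-cells out of a representable stack *)

Section Yoneda.
Context {R : realType} (X : overCat R) (fX : fibered_in_groupoids X).
Context (T : tbMet R) (F G : overFun (rep T) X).
Let one : oob (rep T) T := lid T.
Context (m : omor (F T one) (G T one)) (mb : obase m = lid T).

Definition to_one S (t : oob (rep T) S) : omor t one := rep_mor (lcomp_id_l t).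

Lemma yoneda_cell : exists c : twoCell F G, forall S (t : oob (rep T) S),
  ocomp (fmor G (to_one t)) (c S t) = ocomp m (fmor F (to_one t)).
Proof.
have cE S (t : oob (rep T) S) : exists k : omor (F S t) (G S t),
    obase k = lid S /\ ocomp (fmor G (to_one t)) k = ocomp m (fmor F (to_one t)).
  apply: cart_lift => //; rewrite obase_comp mb !fmor_base.
  exact: lipMap_eq.
pose c S t := sval (cid (cE S t)).
have cb S t : obase (c S t) = lid S by have [] := svalP (cid (cE S t)).
have ck S t : ocomp (fmor G (to_one t)) (c S t) = ocomp m (fmor F (to_one t)).
  by have [] := svalP (cid (cE S t)).
suff nat S' S (t' : oob (rep T) S') (t : oob (rep T) S) (f : omor t' t) :
    ocomp (c S t) (fmor F f) = ocomp (fmor G f) (c S' t').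
  by exists (TwoCell cb nat).
apply: (cart_uniq fX (m := fmor G (to_one t))).
  by rewrite !obase_comp !cb !fmor_base; exact: lipMap_eq.
have tf : ocomp (to_one t) f = to_one t'.
  by apply: repMor_eq => /=; exact: (svalP f).
by rewrite !ocomp_assoc ck -ocomp_assoc -!fmor_comp tf ck.
Qed.

End Yoneda.

(** * Generic compacts with the Hausdorff distance *)

Section UniversalFamily.
Context {R : realType}.

(** Nonemptiness makes Hausdorff distances finite and the universal family surjective. *)
Record gcompact := GCompact {
  gc_set :> set (linf R);
  gc_ne : gc_set !=set0;
  gc_compact : compact gc_set;
  gc_generic : generic gc_set }.

Lemma gcompact_eq (A B : gcompact) : gc_set A = gc_set B -> A = B.
Proof.
case: A B => [A a1 a2 a3] [B b1 b2 b3] /= AB; subst B.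
by rewrite (Prop_irrelevance a1 b1) (Prop_irrelevance a2 b2) (Prop_irrelevance a3 b3).
Qed.

Definition near_sets (A B : set (linf R)) (e : R) :=
  (forall a, A a -> exists2 b, B b & mdist a b <= e) /\
  (forall b, B b -> exists2 a, A a & mdist a b <= e).

Definition hd_bounds (A B : set (linf R)) := [set e : R | 0 <= e /\ near_sets A B e].

Definition hd (A B : gcompact) : R := inf (hd_bounds A B).

Lemma compact_bounded (M : metricType R) (A : set M) (x : M) : compact A ->
  exists b : R, forall a, A a -> mdist x a <= b.
Proof.
move=> cA; apply: contrapT => nb.
pose F := filter_from [set: R] (fun b => [set a | A a /\ b < mdist x a]).
have FF : ProperFilter F.
  apply: filter_from_proper; last first.
    move=> b _; apply: contrapT => h; apply: nb; exists b => a Aa.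
    by rewrite leNgt; apply/negP => ba; apply: h; exists a.
  apply: filter_from_filter; first by exists 0.
  move=> b1 b2 _ _; exists (Num.max b1 b2) => // a [Aa].
  by rewrite gt_max => /andP[].
have FA : F A by exists 0 => // a [].
have [c [_ Fc]] := cA F FF FA.
have Fc1 : F [set a | A a /\ mdist x c + 1 < mdist x a] by exists (mdist x c + 1).
have [a [[_ h] ca]] := Fc _ _ Fc1 (mdist_lt_nbhs c ltr01).
have := metric_triangle x c a; rewrite /= in ca; lra.
Qed.

Lemma hd_bounds_n0 (A B : gcompact) : hd_bounds A B !=set0.
Proof.
have [a0 Aa0] := gc_ne A; have [b0 Bb0] := gc_ne B.
have [x xB] := compact_bounded a0 (@gc_compact B).
have [y yA] := compact_bounded b0 (@gc_compact A).
have x0 : 0 <= x by apply: le_trans (xB _ Bb0); exact: mdist_ge0.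
have y0 : 0 <= y by apply: le_trans (yA _ Aa0); exact: mdist_ge0.
exists (x + y); split; first exact: addr_ge0.
split=> [a Aa|b Bb].
  by exists b0 => //; rewrite metric_sym; have := yA _ Aa; lra.
by exists a0 => //; have := xB _ Bb; lra.
Qed.

Lemma hd_ge0 (A B : gcompact) : 0 <= hd A B.
Proof. by apply: lb_le_inf (hd_bounds_n0 A B) _ => e []. Qed.

Lemma hd_le (A B : gcompact) e : 0 <= e -> near_sets A B e -> hd A B <= e.
Proof. by move=> e0 ABe; apply: ge_inf => //; exists 0 => x []. Qed.

Lemma hd_near (A B : gcompact) e : hd A B < e -> near_sets A B e.
Proof.
move=> /(inf_lt (hd_bounds_n0 A B))[d [d0 [h1 h2]] de]; split=> [a Aa|b Bb].
  by have [b Bb ab] := h1 a Aa; exists b => //; exact: le_trans (ltW de).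
by have [a Aa ab] := h2 b Bb; exists a => //; exact: le_trans (ltW de).
Qed.

Lemma near_sets_sym (A B : set (linf R)) e : near_sets A B e -> near_sets B A e.
Proof.
move=> [h1 h2]; split=> [b Bb|a Aa].
  by have [a Aa ab] := h2 b Bb; exists a => //; rewrite metric_sym.
by have [b Bb ab] := h1 a Aa; exists b => //; rewrite metric_sym.
Qed.

Lemma near_sets_trans (A B C : set (linf R)) e e' :
  near_sets A B e -> near_sets B C e' -> near_sets A C (e + e').
Proof.
move=> [h1 h2] [k1 k2]; split=> [a Aa|c Cc].
  have [b Bb ab] := h1 a Aa; have [c Cc bc] := k1 b Bb; exists c => //.
  by apply: le_trans (metric_triangle _ b _) _; exact: lerD.
have [b Bb bc] := k2 c Cc; have [a Aa ab] := h2 b Bb; exists a => //.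
by apply: le_trans (metric_triangle _ b _) _; exact: lerD.
Qed.

Lemma near_sets0_sub (A B : gcompact) :
  (forall e, 0 < e -> near_sets A B e) -> gc_set A `<=` gc_set B.
Proof.
move=> AB a Aa; have cB := compact_closed (@metric_hausdorff _ (linf R)) (@gc_compact B).
apply: cB => D /nbhs_mdistW[e e0 eD]; have e20 : 0 < e / 2 by rewrite divr_gt0.
have [b Bb ab] := (AB _ e20).1 a Aa; exists b; split=> //; apply: eD.
by apply: le_lt_trans ab _; rewrite ltr_pdivrMr // ltr_pMr // ltr1n.
Qed.

Lemma hd_metric_ax : metric_ax hd.
Proof.
split.
- move=> A; apply/eqP; rewrite eq_le hd_ge0 andbT; apply: hd_le => //.
  by split=> a Aa; exists a; rewrite // mdistxx.
- move=> A B AB; have AB' e : 0 < e -> near_sets A B e by rewrite -AB; exact: hd_near.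
  apply: gcompact_eq; apply/seteqP; split; apply: near_sets0_sub => e e0.
    exact: AB'.
  by apply: near_sets_sym; exact: AB'.
- by move=> A B; congr inf; apply/seteqP; split=> e [e0 /near_sets_sym].
- move=> B A C; apply/ler_addgt0Pr => e e0; have e20 : 0 < e / 2 by rewrite divr_gt0.
  have h1 : near_sets A B (hd A B + e / 2) by apply: hd_near; rewrite ltrDl.
  have h2 : near_sets B C (hd B C + e / 2) by apply: hd_near; rewrite ltrDl.
  have := near_sets_trans h1 h2; rewrite addrACA -splitr; apply: hd_le.
  by rewrite !addr_ge0 ?hd_ge0 // ltW.
Qed.

Definition univ : metricType R := metric_of hd_metric_ax.

Record univ_pt := UnivPt {
  up_set : gcompact;
  up_pt : linf R;
  up_in : gc_set up_set up_pt }.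

Lemma univ_pt_eq x y : up_set x = up_set y -> up_pt x = up_pt y -> x = y.
Proof.
case: x y => [A a Aa] [B b Bb] /= AB ab; subst B b.
by rewrite (Prop_irrelevance Aa Bb).
Qed.

Definition up_dist (x y : univ_pt) : R :=
  Num.max (mdist (up_set x : univ) (up_set y)) (mdist (up_pt x) (up_pt y)).

Lemma up_metric_ax : metric_ax up_dist.
Proof.
rewrite /up_dist; split.
- by move=> x; rewrite !mdistxx maxxx.
- move=> x y xy; have : up_dist x y <= 0 by rewrite /up_dist xy.
  by rewrite ge_max => /andP[/mdist0_eq h1 /mdist0_eq h2]; exact: univ_pt_eq.
- by move=> x y; congr Num.max; rewrite metric_sym.
- move=> y x z; rewrite ge_max; apply/andP; split.
    apply: le_trans (metric_triangle _ (up_set y : univ) _) _.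
    by apply: lerD; rewrite le_max lexx.
  apply: le_trans (metric_triangle _ (up_pt y) _) _.
  by apply: lerD; rewrite le_max lexx orbT.
Qed.

Definition univ_fam : metricType R := metric_of up_metric_ax.

Lemma univ_map_lip (x y : univ_fam) : mdist (up_set x : univ) (up_set y) <= mdist x y.
Proof. by rewrite {2}/mdist /= /up_dist le_max lexx. Qed.

Definition univ_map : lipMap univ_fam univ := @LipMap _ univ_fam univ up_set univ_map_lip.

Lemma univ_famE (x y : univ_fam) : mdist x y =
  Num.max (mdist (up_set x : univ) (up_set y)) (mdist (up_pt x) (up_pt y)).
Proof. by []. Qed.

Lemma univ_proper : proper_submetry univ_map.
Proof.
apply: proper_submetryI.
- by move=> A; have [a Aa] := gc_ne A; exists (UnivPt Aa).
- move=> [A a Aa] B e e0.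
  have e20 : 0 < e / 2 by rewrite divr_gt0.
  have [|h _] := @hd_near A B (hd A B + e / 2); first by rewrite ltrDl.
  have [b Bb ab] := h a Aa; exists (UnivPt Bb) => //=.
  rewrite univ_famE /= gt_max ltrDl e0 /=; apply: le_lt_trans ab _.
  by rewrite ltrD2l ltr_pdivrMr // ltr_pMr // ltr1n.
- move=> A; refine (@compact_lip_rel R (linf R) univ_fam
    (fun a x => up_set x = A /\ up_pt x = a) (gc_set A) _ _ _ _ (@gc_compact A)).
  + by move=> a Aa; exists (UnivPt Aa).
  + by move=> [B b Bb] /= BA; exists b; rewrite -?BA.
  + move=> a a' x y [xA <-] [yA <-]; rewrite univ_famE xA yA mdistxx.
    by rewrite ge_max lexx mdist_ge0.
Qed.

End UniversalFamily.

Arguments univ R : clear implicits.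
Arguments univ_fam R : clear implicits.

(** * The formal submetry onto GH *)

Section UniversalSubmetry.
Context {R : realType}.

Definition univ_fun : overFun (rep (univ R)) (GH R) := pull_fun (@univ_proper R).

Lemma isometric_image (Q : metricType R) (e : Q -> linf R) (B : set Q) :
  (forall q q', mdist (e q) (e q') = mdist q q') -> compact B -> compact (e @` B).
Proof.
move=> ed; apply: (@compact_lip_rel R Q (linf R) (fun q f => e q = f)).
- by move=> q Bq; exists (e q) => //; exists q.
- by move=> _ [q Bq <-]; exists q.
- by move=> q q' _ _ <- <-; rewrite ed.
Qed.

(** The gap between [mdist t t'] and x is the slack for lifting from one fibre to the other. *)
Lemma fiber_near (T : tbMet R) (P : ghOb T) (e : gh_space P -> linf R) (t t' : T) (x : R) :
  (forall q q', mdist (e q) (e q') = mdist q q') -> mdist t t' < x ->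
  near_sets (e @` (gh_map P @^-1` [set t])) (e @` (gh_map P @^-1` [set t'])) x.
Proof.
have half t1 t2 y : (forall q q', mdist (e q) (e q') = mdist q q') ->
    mdist t1 t2 < y -> forall a, (e @` (gh_map P @^-1` [set t1])) a ->
    exists2 b, (e @` (gh_map P @^-1` [set t2])) b & mdist a b <= y.
  move=> ed ty _ [q qt <-]; have y0 : 0 < y - mdist t1 t2 by rewrite subr_gt0.
  have [q' q't qq'] := gh_lifting q t2 y0; exists (e q'); first by exists q'.
  by rewrite ed; apply: ltW; rewrite qt addrC subrK in qq'.
move=> ed tx; split; first exact: half.
move=> b Bb; have [|a Aa ab] := half t' t x ed _ b Bb; first by rewrite metric_sym.
by exists a; rewrite // metric_sym.
Qed.

(* An object over T is the pullback of the universal family along any map to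
   univ that sends t to an isometric copy of the fibre over t, all copies being
   cut out of one embedding of the total space. *)
Lemma univ_mor (T0 T : tbMet R) (P : ghOb T) (f : lipMap T0 T)
    (e : gh_space P -> linf R) (u : lipMap T0 (univ R)) :
  (forall q q', mdist (e q) (e q') = mdist q q') ->
  (forall t, gc_set (u t) = e @` (gh_map P @^-1` [set f t])) ->
  exists m : ghMor (pull_ob (@univ_proper R) u) P, ghm_base m = f /\
    forall z : fibProd univ_map u, e (ghm_top m z) = up_pt (fp_fst z).
Proof.
move=> ed uE.
have /choice[h hE] : forall z : fibProd univ_map u, exists q,
    gh_map P q = f (fp_snd z) /\ e q = up_pt (fp_fst z).
  move=> z; have := up_in (fp_fst z).
  have -> : up_set (fp_fst z) = u (fp_snd z) := fp_eq z.
  by rewrite uE => -[q qz qe]; exists q.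
have hE' z z' : mdist (h z) (h z') = mdist (up_pt (fp_fst z)) (up_pt (fp_fst z')).
  by rewrite -ed (hE z).2 (hE z').2.
have hl z z' : mdist (h z) (h z') <= mdist z z'.
  by rewrite hE' fp_mdistE univ_famE !le_max lexx orbT.
have [|||m [mb mt]] := @ghMor_build _ _ _ (pull_ob (@univ_proper R) u) P f
  (@LipMap _ (fibProd univ_map u) (gh_space P) h hl).
- by move=> z; exact: (hE z).1.
- move=> y t yt; have yu : gc_set (u t) (e y) by rewrite uE; exists y.
  pose w : univ_fam R := UnivPt yu.
  have wt : univ_map w = u t by [].
  exists (FibProd wt); split=> //=; apply: mdist_positivity.
  by rewrite -ed (hE _).2 mdistxx.
- move=> z z'; rewrite fp_mdistE univ_famE !ge_max -hE'.
  have -> : up_set (fp_fst z) = u (fp_snd z) := fp_eq z.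
  have -> : up_set (fp_fst z') = u (fp_snd z') := fp_eq z'.
  by rewrite !le_max lipP !lexx !orbT.
by exists m; split=> // z; rewrite mt; exact: (hE z).2.
Qed.

Lemma univ_ess_surj (T : tbMet R) : essentially_surjective_at univ_fun T.
Proof.
move=> P; have tP := proper_submetry_tot_bounded (gh_proper P) (@tbP _ T).
have [e [ed eG]] := generic_embedding tP.
have ne t : e @` (gh_map P @^-1` [set t]) !=set0.
  by have [q qt] := gh_surj P t; exists (e q), q.
have co t : compact (e @` (gh_map P @^-1` [set t])).
  exact: isometric_image (@gh_fib_compact _ _ P t).
pose u t : univ R := GCompact (ne t) (co t) (eG _).
have ul t t' : mdist (u t) (u t') <= mdist t t'.
  apply/ler_addgt0Pr => x x0; apply: hd_le.
    by rewrite addr_ge0 ?mdist_ge0 // ltW.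
  by apply: fiber_near => //; rewrite ltrDl.
have [|m [mb _]] := @univ_mor T T P (lid T) e (LipMap ul) ed; first by [].
by exists (LipMap ul : oob (rep (univ R)) T), m.
Qed.

(** The compact A given by x is a copy of the fibre over 0 of the space Q given by g. A generic
    embedding of Q extending this copy yields a copy A' of the other fibre within r of A, hence a
    map from 2_r to [univ]. *)
Lemma univ_formal_submetry : formal_submetry univ_fun.
Proof.
split=> [|r s sr x g alpha]; first exact: univ_ess_surj.
pose one : oob (rep met_pt) (tb_pt R) := lid (tb_pt R).
pose u0 : lipMap (tb_pt R) (univ R) := x _ one.
pose A : univ R := u0 tt.
pose one_s : oob (rep (met_two s)) (tb_two s) := lid (tb_two s).
pose Q : ghOb (tb_two s) := g _ one_s.
have tQ := proper_submetry_tot_bounded (gh_proper Q) (@tbP _ (tb_two s)).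
have x_const T (t : oob (rep met_pt) T) t0 : x T t t0 = A.
  have th : lcomp one t = t by exact: lipMap_eq.
  have := rep_arrow (fmor x (rep_mor th : omor t one)) t0.
  by move=> <-; rewrite /A /u0; congr (lip_fun _ _); case: (obase _ _).
pose j S (t : oob (rep (met_two s)) S) : omor t one_s :=
  @to_one R (tb_two s) S t.
pose t_pt := (rep_map (iota0 s)) _ one.
pose al : ghMor (pull_ob (@univ_proper R) u0) (g _ t_pt) := alpha _ one.
pose gj : ghMor (g _ t_pt) Q := fmor g (j _ t_pt).
have gjb t : ghm_base gj t = false by rewrite /gj ghm_base_fmor.
(* alpha identifies A with the fibre over 0, and top is the resulting isometric inclusion into Q. *)
pose top (z : fibProd univ_map u0) : gh_space Q := ghm_top gj (ghm_top al z).
have top_map z : gh_map Q (top z) = false.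
  by rewrite /top ghm_comm gjb.
have pt_dist (v v' : tb_pt R) : mdist v v' = 0 by [].
have top_dist z z' : mdist (top z) (top z') = mdist (up_pt (fp_fst z)) (up_pt (fp_fst z')).
  have zz' : mdist z z' = mdist (up_pt (fp_fst z)) (up_pt (fp_fst z')).
    rewrite fp_mdistE univ_famE.
    have -> : up_set (fp_fst z) = u0 (fp_snd z) := fp_eq z.
    have -> : up_set (fp_fst z') = u0 (fp_snd z') := fp_eq z'.
    case: (fp_snd z) (fp_snd z') => -[]; rewrite !mdistxx.
    by rewrite [Num.max 0 (mdist _ _)]max_r ?mdist_ge0 // max_l ?mdist_ge0.
  rewrite -zz'; apply/eqP; rewrite eq_le; apply/andP; split.
    by apply: le_trans (lipP _ _ _) _; exact: lipP.
  apply: le_trans (ghm_dist al z z') _; rewrite ge_max; apply/andP; split; last first.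
    by rewrite pt_dist mdist_ge0.
  apply: le_trans (ghm_dist gj _ _) _.
  by rewrite ge_max lexx pt_dist mdist_ge0.
have pt_of a : gc_set A a -> exists z : fibProd univ_map u0, up_pt (fp_fst z) = a.
  move=> Aa; pose w : univ_fam R := UnivPt Aa.
  have wA : univ_map w = u0 tt by [].
  by exists (FibProd wA).
have [a0 Aa0] := gc_ne A; have [z0 z0a] := pt_of a0 Aa0.
(* kap is top as a function of the point of A alone; off A its value is a default. *)
have /choice[kap kapE] : forall a : linf R, exists q, forall z : fibProd univ_map u0,
    up_pt (fp_fst z) = a -> top z = q.
  move=> a; have [[z za]|no] := pselect (exists z : fibProd univ_map u0, up_pt (fp_fst z) = a).
    exists (top z) => z' z'a; apply: mdist_positivity.
    by rewrite top_dist z'a za mdistxx.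
  by exists (top z0) => z za; exfalso; apply: no; exists z.
have kap_dist a b : gc_set A a -> gc_set A b -> mdist (kap a) (kap b) = mdist a b.
  move=> /pt_of[z <-] /pt_of[z' <-].
  by rewrite -(kapE _ z erefl) -(kapE _ z' erefl) top_dist.
have [e [ek ed eG]] := generic_embedding_rel tQ (gc_generic A) (gc_ne A) kap_dist.
have top_surj q : gh_map Q q = false -> exists z, top z = q.
  move=> qf; have [|y [yq yt]] := @ghm_lift _ _ _ _ _ gj q tt.
    by rewrite qf gjb.
  have [|z [zy _]] := @ghm_lift _ _ _ _ _ al y tt.
    by rewrite yt; case: (ghm_base _ _).
  by exists z; rewrite /top zy.
have AE : gc_set A = e @` (gh_map Q @^-1` [set false : met_two s]).
  apply/seteqP; split=> [a Aa|_ [q qf <-]].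
    have [z za] := pt_of a Aa; exists (kap a); last exact: ek.
    by rewrite /= -(kapE _ z za) top_map.
  have [z zq] := top_surj q qf; have := up_in (fp_fst z).
  have -> : up_set (fp_fst z) = u0 (fp_snd z) := fp_eq z.
  rewrite -zq (kapE _ z erefl) ek; first by case: (fp_snd z).
  by have := up_in (fp_fst z); have -> : up_set (fp_fst z) = u0 (fp_snd z) := fp_eq z;
    case: (fp_snd z).
have A'ne : e @` (gh_map Q @^-1` [set true : met_two s]) !=set0.
  by have [q qt] := gh_surj Q (true : tb_two s); exists (e q), q.
pose A' : univ R := GCompact A'ne (isometric_image ed
  (@gh_fib_compact _ _ Q (true : tb_two s))) (eG _).
(* The two fibres lie over points at distance s; the strict inequality s < r gives the slack in
   [fiber_near]. *)
have AA' : mdist A A' <= r%:num.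
  apply: hd_le; first exact: ltW.
  by rewrite AE; apply: fiber_near => //; exact: sr.
pose h0 : lipMap (tb_two r) (univ R) := two_map AA'.
have [|H0 [H0b H0e]] := @univ_mor (tb_two r) (tb_two s) Q (iota2 sr) e h0 ed.
  by case; rewrite //= AE.
pose one_r : oob (rep (met_two r)) (tb_two r) := lid (tb_two r).
pose gi := fcomp g (rep_map (iota2 sr)).
pose h : overFun (rep (met_two r)) (rep (univ R)) := rep_map h0.
pose rho : omor (rep_map (iota2 sr) _ one_r) one_s := j _ _.
have h0one : lcomp h0 (lid (tb_two r)) = h0 by exact: lipMap_eq.
pose eps : omor (h _ one_r) (h0 : oob (rep (univ R)) (tb_two r)) :=
  rep_mor (etrans (lcomp_id_r h0) (esym h0one)).
(* gamma is determined by its value G0 at the identity of 2_r, obtained by factoring H0 through the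
   cartesian arrow to Q. *)
have [|G0 [G0b G0E]] := @cart_lift _ _ gh_fibered _ _ _ _ _ _ (fmor g rho)
    (gh_comp H0 (fmor univ_fun eps) : omor (_ : oob (GH R) _) _) (lid (tb_two r)).
  rewrite fmor_base; apply: lipMap_eq => t.
  by rewrite -[RHS]/(ghm_base H0 (ghm_base (fmor univ_fun eps) t)) H0b ghm_base_fmor.
have [gamma gammaE] := @yoneda_cell _ _ gh_fibered (tb_two r)
  (fcomp univ_fun h) gi G0 G0b.
(* x is constant with value A, so h restricted to 0 agrees with x and beta can be taken over
   identities. *)
have hx T (t : oob (rep met_pt) T) :
    lcomp (x T t) (lid T) = (fcomp h (rep_map (iota0 r))) T t.
  by apply: lipMap_eq => t0 /=; rewrite x_const.
pose bt T (t : oob (rep met_pt) T) : omor ((fcomp h (rep_map (iota0 r))) T t) (x T t) :=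
  rep_mor (hx T t).
have btb T (t : oob (rep met_pt) T) : obase (bt T t) = lid T by [].
have btn T' T (t' : oob (rep met_pt) T') (t : oob (rep met_pt) T) (m : omor t' t) :
    ocomp (bt T t) (fmor (fcomp h (rep_map (iota0 r))) m) = ocomp (fmor x m) (bt T' t').
  apply: repMor_eq; apply: etrans
    (_ : obase (ocomp (bt T t) (fmor (fcomp h (rep_map (iota0 r))) m)) =
         obase (ocomp (fmor x m) (bt T' t'))) => //.
  by rewrite !obase_comp !fmor_base; exact: lipMap_eq.
exists h, (@TwoCell _ _ _ (fcomp h (rep_map (iota0 r))) x bt btb btn), gamma => T t.
pose beta := @TwoCell _ _ _ (fcomp h (rep_map (iota0 r))) x bt btb btn.
pose ts : oob (rep (met_two s)) T := rep_map (iota0 s) T t.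
pose tr : oob (rep (met_two r)) T := rep_map (iota0 r) T t.
have th1 : lcomp one t = t by exact: lipMap_eq.
pose th : omor t one := rep_mor th1.
apply: (cart_uniq gh_fibered (m := fmor g (j _ ts))).
  rewrite !obase_comp (tc_base alpha) (tc_base (whiskl _ _)).
  rewrite (tc_base (whiskl _ _)).
  by have -> := tc_base (whiskr gamma (rep_map (iota0 r))) t.
(* Both sides are compared after the cartesian arrow to Q, where a point is
   determined by its image under the embedding e. *)
have L : ocomp (fmor g (j _ ts)) (ocomp (alpha T t) (whiskl univ_fun beta T t)) =
    gh_comp gj (gh_comp al (gh_comp (fmor univ_fun (fmor x th)) (fmor univ_fun (bt T t)))).
  have jE : fmor g (j _ ts) = ocomp (fmor g (j _ t_pt)) (fmor g (fmor (rep_map (iota0 s)) th)).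
    by rewrite -fmor_comp; congr (fmor g _); apply: repMor_eq; exact: lipMap_eq.
  have aE := tc_nat alpha th.
  rewrite jE -ocomp_assoc; congr (ocomp (_ : omor (_ : oob (GH R) _) _) _).
  by rewrite ocomp_assoc -[X in ocomp X _]aE -ocomp_assoc.
have Rr : ocomp (fmor g (j _ ts)) (ocomp (whiskl g (rep_comp (iota2K sr)) T t)
    (whiskr gamma (rep_map (iota0 r)) T t)) =
    gh_comp H0 (gh_comp (fmor univ_fun eps) (fmor univ_fun (fmor h (to_one (T := tb_two r) tr)))).
  have gE := gammaE _ tr.
  have jE : ocomp (j _ ts) (rep_comp (iota2K sr) T t) =
      ocomp rho (fmor (rep_map (iota2 sr)) (to_one (T := tb_two r) tr)).
    by apply: repMor_eq; exact: lipMap_eq.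
  rewrite ocomp_assoc -[X in ocomp X _](fmor_comp g) jE fmor_comp -ocomp_assoc.
  rewrite [X in ocomp _ X]gE ocomp_assoc G0E.
  by apply: ghMor_eq; exact: lipMap_eq.
apply: etrans L _; apply: etrans (esym Rr).
apply: ghMor_eq; apply: lipMap_eq => z.
  apply: etrans (gjb _) _; apply: esym; apply: etrans (lipMap_app H0b _) _.
  apply: etrans (lipMap_app (ghm_base_fmor univ_fun eps) _) _.
  exact: (lipMap_app (ghm_base_fmor univ_fun (fmor h (to_one (T := tb_two r) tr))) z).
pose w1 : fibProd univ_map u0 :=
  ghm_top (fmor univ_fun (fmor x th)) (ghm_top (fmor univ_fun (bt T t)) z).
pose w2 : fibProd univ_map h0 := ghm_top (fmor univ_fun eps)
  (ghm_top (fmor univ_fun (fmor h (to_one (T := tb_two r) tr))) z).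
have w12 : up_pt (fp_fst w1) = up_pt (fp_fst w2).
  congr up_pt; rewrite /w1 /w2.
  rewrite (pull_fun_fst _ (fmor x th)) (pull_fun_fst _ (bt T t)).
  by rewrite (pull_fun_fst _ eps) (pull_fun_fst _ (fmor h _)).
have Aw : gc_set A (up_pt (fp_fst w1)).
  have := up_in (fp_fst w1).
  have -> : up_set (fp_fst w1) = u0 (fp_snd w1) := fp_eq w1.
  by case: (fp_snd w1).
apply: mdist_positivity; rewrite -ed.
have -> : e (ghm_top H0 w2) = up_pt (fp_fst w2) := H0e w2.
have -> : e (top w1) = up_pt (fp_fst w1) by rewrite (kapE _ w1 erefl) ek.
by rewrite w12 mdistxx.
Qed.

End UniversalSubmetry.

Lemma identity_covering (R : realType) (T : tbMet R) :
  lsm_covering (@MetFamily _ T unit (fun=> T) (fun=> lid T)).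
Proof.
split=> [i x|x1 x2 x3 e e0]; last by exists tt, x1, x2, x3; rewrite !ltrDl.
by exists 1 => // x' _ s _ _; rewrite image_id.
Qed.

Lemma gh_quotient_type (R : realType) : quotient_type (GH R).
Proof.
exists (univ R), univ_fun; split=> [|T P]; first exact: univ_formal_submetry.
exists (@MetFamily _ T unit (fun=> T) (fun=> lid T)).
split=> [|[]]; first exact: identity_covering.
have [u [m mb]] := univ_ess_surj P.
exists P, (oid P); split; first exact: obase_id.
by exists u, m.
Qed.

Theorem theoremA (R : realType) :
  (naive_metric_stack (GH R) /\ quotient_type (GH R)) /\
  (forall X : overCat R, naive_metric_stack X -> quotient_type X ->
    (forall F : overFun X (GH R),
       is_stack (fib2 F (gh_p0 R)) /\
       representable_proper_submetry (gh_pullback F)) /\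
    (forall F G : overFun X (GH R),
       two_isomorphic F G <->
       equivalent_over (gh_pullback F) (gh_pullback G)) /\
    (forall (P : overCat R) (p : overFun P X),
       is_stack P -> representable_proper_submetry p ->
       exists F : overFun X (GH R), equivalent_over (gh_pullback F) p)).
Proof.
split=> [|X [sX _] _].
  split; last exact: gh_quotient_type.
  split; first exact: gh_stack.
  by exists (univ R), univ_fun; exact: univ_formal_submetry.
have [fX _ _] := sX; split; [|split] => [F|F G|P p [fP _ _] pR].
- split; first exact: cls_stack sX (pb_classifier F).
  exact: gh_pullback_representable.
- exact: gh_correspondence.
- have [F [c]] := representable_classifier fX fP pR.
  by exists F; apply: (cls_equivalent (F := F) fX) => //; exact: pb_classifier.
Qed.
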